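(* For every $n\geq1$: $\mathrm{SPE}_{\mathfrak{D}_n\cup\overline{\mathfrak{D}_n}}\equiv_W\lim^{(n)}$.
   Context: $f\leq_W g$ iff there are computable partial $K,H$ on $\mathbb{N}^\mathbb{N}$ such that for every realizer $G$ of $g$, $p\mapsto K(\langle p,G(H(p))\rangle)$ realizes $f$; $\equiv_W$ induced equivalence. $\lim:\subseteq\mathbb{N}^\mathbb{N}\to\mathbb{N}^\mathbb{N}$, $\lim(p)(n)=\lim_{i\to\infty}p(\langle n,i\rangle)$. $f\star g$ is the $\leq_W$-maximum of $\{f_0\circ g_0\mid f_0\equiv_W f,g_0\equiv_W g\}$; $\lim^{(0)}=\mathrm{id}$, $\lim^{(n+1)}=\lim^{(n)}\star\lim$. $\mathfrak{D}_m$: sets $D\subseteq\{0,1\}^\mathbb{N}$ for which there are open $U_0,\ldots,U_{m-1}$ with $x\in D\iff\min\{\beta\mid x\in U_\beta\}\not\equiv m\pmod2$ ($\min\emptyset=m$), named by names of the $U_i$ (open sets named by enumerations of words whose cylinders form them); $\overline{\mathfrak{D}_m}$: complements; the union class named by tag plus name. Games: two-player infinite sequential games with choices $\{0,1\}$, turn function $d:\{0,1\}^*\to\{1,2\}$, finitely many outcomes, valuation $v$, linear antagonistic preferences ($\prec_1=\prec_2^{-1}$). Strategy profiles $s:\{0,1\}^*\to\{0,1\}$; play from history $\lambda$: $p_n=\lambda_n$ for $n<|\lambda|$, else $p_n=s(p_{<n})$. Nash equilibrium: no player can unilaterally deviate to a strictly preferred outcome; subgame perfect equilibrium: Nash equilibrium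 of the game started at every history. $\mathrm{SPE}_\Gamma$ takes such a game, named by the number of outcomes, $d$ and preferences as tables, and for each player and upper set $U$ w.r.t. its preference a $\Gamma$-name of $v^{-1}(U)$, and outputs any subgame perfect equilibrium. *)

(* Defs.v *)
From Stdlib Require Import Arith List PArith.
Import ListNotations.

Definition baire := nat -> nat.
Definition cantor := nat -> bool.

Definition pair (a b : nat) : nat := (a + b) * (a + b + 1) / 2 + b.

Fixpoint listcode (l : list nat) : nat :=
  match l with [] => 0 | x :: l' => S (pair x (listcode l')) end.

Definition prefix {A} (p : nat -> A) (k : nat) : list A := map p (seq 0 k).

Definition tuple (p q : baire) : baire :=
  fun m => if Nat.even m then p (Nat.div2 m) else q (Nat.div2 m).

(* bijective enumeration of words {0,1}^* : n |-> binary expansion of n+1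
   without its leading 1 *)
Fixpoint word_of_pos (x : positive) : list bool :=
  match x with
  | xH => []
  | xO y => word_of_pos y ++ [false]
  | xI y => word_of_pos y ++ [true]
  end.
Definition wordOfNat (n : nat) : list bool := word_of_pos (Pos.of_succ_nat n).

Inductive prcode : Type :=
| PZero : prcode
| PSucc : prcode
| PProj : nat -> prcode
| PComp : prcode -> list prcode -> prcode
| PRec  : prcode -> prcode -> prcode
| PMu   : prcode -> prcode.

Inductive peval : prcode -> list nat -> nat -> Prop :=
| ev_zero : forall args, peval PZero args 0
| ev_succ : forall x args, peval PSucc (x :: args) (S x)
| ev_proj : forall i args, peval (PProj i) args (nth i args 0)
| ev_comp : forall f gs args ys y,
    pevals gs args ys -> peval f ys y -> peval (PComp f gs) args y
| ev_rec0 : forall f g args y, peval f args y -> peval (PRec f g) (0 :: args) y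
| ev_recS : forall f g n args r y,
    peval (PRec f g) (n :: args) r -> peval g (n :: r :: args) y ->
    peval (PRec f g) (S n :: args) y
| ev_mu : forall f args n,
    peval f (n :: args) 0 ->
    (forall m, m < n -> exists r, peval f (m :: args) (S r)) ->
    peval (PMu f) args n
with pevals : list prcode -> list nat -> list nat -> Prop :=
| evs_nil : forall args, pevals [] args []
| evs_cons : forall g gs args y ys,
    peval g args y -> pevals gs args ys -> pevals (g :: gs) args (y :: ys).

Definition computable (alpha : nat -> nat) : Prop :=
  exists c : prcode, forall n, peval c [n] (alpha n).

(* Type-2 computability via (computable) Kleene associates.             *)
(* Every computable partial F on Baire space has an extension of the    *)
(* form Phi alpha with alpha computable, and each such Phi alpha is      *)
(* computable.                                                          *)
Definition Phi (alpha : nat -> nat) (p q : baire) : Prop :=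
  forall n, exists k,
    0 < alpha (pair n (listcode (prefix p k))) /\
    (forall j, j < k -> alpha (pair n (listcode (prefix p j))) = 0) /\
    q n = alpha (pair n (listcode (prefix p k))) - 1.

Definition problem := baire -> baire -> Prop.

Definition pdom (f : problem) (p : baire) : Prop := exists q, f p q.

Definition realizer (f : problem) (G : baire -> baire -> Prop) : Prop :=
  (forall p q1 q2, G p q1 -> G p q2 -> q1 = q2) /\
  (forall p, pdom f p -> exists q, G p q /\ f p q).

Definition WRed (f g : problem) : Prop :=
  exists alphaK alphaH, computable alphaK /\ computable alphaH /\
    forall G, realizer g G ->
      forall p, pdom f p ->
        exists r s t, Phi alphaH p r /\ G r s /\
                      Phi alphaK (tuple p s) t /\ f p t.

Definition WEquiv (f g : problem) : Prop := WRed f g /\ WRed g f.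

Definition IdP : problem := fun p q => q = p.

Definition LimP : problem := fun p q =>
  forall n, exists N, forall i, N <= i -> p (pair n i) = q n.

Definition CompP (f g : problem) : problem := fun p r =>
  (forall q, g p q -> pdom f q) /\ exists q, g p q /\ f q r.

Definition IsCompProd (f g h : problem) : Prop :=
  (exists f0 g0, WEquiv f0 f /\ WEquiv g0 g /\ WEquiv h (CompP f0 g0)) /\
  (forall f0 g0, WEquiv f0 f -> WEquiv g0 g -> WRed (CompP f0 g0) h).

Definition IsLimIter (L : nat -> problem) : Prop :=
  WEquiv (L 0) IdP /\ forall k, IsCompProd (L k) LimP (L (S k)).

Definition isPrefix (w : list bool) (x : cantor) : Prop :=
  forall i, i < length w -> nth i w false = x i.

(* open set named by a : a enumerates (codes+1 of) words; 0 = nothing *)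
Definition OpenOf (a : baire) (x : cantor) : Prop :=
  exists j c, a j = S c /\ isPrefix (wordOfNat c) x.

(* x in D(U_0..U_{m-1}) iff min{beta | x in U_beta} (min empty = m) has
   parity different from m *)
Definition InD (m : nat) (U : nat -> cantor -> Prop) (x : cantor) : Prop :=
  exists beta, beta <= m /\ (beta < m -> U beta x) /\
    (forall gamma, gamma < beta -> ~ U gamma x) /\
    Nat.odd beta <> Nat.odd m.

Definition GammaName (m : nat) (a : baire) (A : cantor -> Prop) : Prop :=
  let U := fun i => OpenOf (fun j => a (1 + pair i j)) in
  (a 0 = 0 /\ forall x, A x <-> InD m U x) \/
  (a 0 = 1 /\ forall x, A x <-> ~ InD m U x).

Record game : Type := mkGame {
  g_k    : nat;                         (* outcomes are 0..k-1 *)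
  g_turn : list bool -> nat;            (* d : {0,1}^* -> {1,2} *)
  g_pref : nat -> nat -> nat -> bool;   (* g_pref i a b : a <_i b, i.e.
                                            player i strictly prefers b to a *)
  g_val  : cantor -> nat
}.

Definition strict_linear_on (k : nat) (lt : nat -> nat -> bool) : Prop :=
  (forall a, a < k -> lt a a = false) /\
  (forall a b c, a < k -> b < k -> c < k -> lt a b = true -> lt b c = true ->
     lt a c = true) /\
  (forall a b, a < k -> b < k -> a <> b -> lt a b = true \/ lt b a = true).

Definition game_wf (G : game) : Prop :=
  (forall w, g_turn G w = 1 \/ g_turn G w = 2) /\
  (forall x, g_val G x < g_k G) /\
  strict_linear_on (g_k G) (g_pref G 1) /\
  (forall a b, a < g_k G -> b < g_k G -> g_pref G 2 a b = g_pref G 1 b a).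

Definition inMask (k c a : nat) : Prop := a < k /\ Nat.testbit c a = true.

Definition upperMask (G : game) (i c : nat) : Prop :=
  forall a b, a < g_k G -> b < g_k G -> Nat.testbit c a = true ->
    g_pref G i a b = true -> Nat.testbit c b = true.

Definition GameName (m : nat) (p : baire) (G : game) : Prop :=
  p (pair 0 0) = g_k G /\
  (forall n, p (pair 1 n) = g_turn G (wordOfNat n)) /\
  (forall i a b, (i = 1 \/ i = 2) -> a < g_k G -> b < g_k G ->
     p (pair (1 + i) (pair a b)) = if g_pref G i a b then 1 else 0) /\
  (forall i c, (i = 1 \/ i = 2) -> c < 2 ^ g_k G -> upperMask G i c ->
     GammaName m (fun j => p (pair (4 + pair i c) j))
               (fun x => inMask (g_k G) c (g_val G x))).

Definition profile := list bool -> bool.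

Fixpoint run (s : profile) (lam : list bool) (n : nat) : list bool :=
  match n with
  | 0 => []
  | S m => let h := run s lam m in
           h ++ [if m <? length lam then nth m lam false else s h]
  end.

Definition play (s : profile) (lam : list bool) : cantor :=
  fun i => nth i (run s lam (S i)) false.

Definition NashAt (G : game) (s : profile) (lam : list bool) : Prop :=
  forall i s', (i = 1 \/ i = 2) ->
    (forall w, g_turn G w <> i -> s' w = s w) ->
    g_pref G i (g_val G (play s lam)) (g_val G (play s' lam)) = false.

Definition IsSPE (G : game) (s : profile) : Prop :=
  forall lam, NashAt G s lam.

Definition StratName (q : baire) (s : profile) : Prop :=
  forall n, q n = if s (wordOfNat n) then 1 else 0.

Definition SPEP (m : nat) : problem := fun p q =>
  exists G, game_wf G /\ GameName m p G /\
    exists s, StratName q s /\ IsSPE G s.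

(* Main.v *)
(** Write [lim^k] for the [k]-fold composition of [lim]. Since a recursive functional
    commutes with [lim], it can be moved inside the limit, so that [lim^k] is a
    representative of the degree [L k].

    Upper bound. Order the outcomes by the preference of player 1. For each threshold
    [r], the plays with an outcome of rank at least [r] form a difference set or the
    complement of one. For the difference set of [U_0, ..., U_(n-1)], its player [D]
    wins from a position iff [D] can force a position at which [U_(n-1)] is entered
    and from which the opponent, now being the difference player of
    [U_0, ..., U_(n-2)], does not win. By compactness such a reachability win has a
    finite certificate, so [n] limits compute all winning regions. From these an
    equilibrium is recursive: player 1 plays for the largest threshold that is won at
    the current position, player 2 against the smallest one that is not won by
    player 1.

    Lower bound. If [q] is the [(n-1)]-st iterated limit of [p], then
    [exists j >= i, q (m, j) <> v] is a [Sigma_n] statement about [p]. At the node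
    [0^z 1] with [z = (m, (i, v))], player 1 either takes a middle outcome or enters a
    game in which the players alternately choose numbers, in unary, as witnesses of
    the [n] quantifiers; a player who never completes a number loses, and this makes
    the winning set a difference set of [n] open sets. In a subgame perfect
    equilibrium player 1 enters iff the statement is true, and [lim q m] is the [v] of
    any [(i, v)] for which it is false. *)

From Stdlib Require Import Arith List PArith Lia Bool Cantor Classical ClassicalEpsilon
  FunctionalExtensionality.
Import ListNotations.
Require Import Defs.

(** * Recursive functions of fixed arity *)

(** Computability is treated by a shallow embedding: functions are ordinary terms over an
    environment [e] of arguments, and [Rec], [RC], [RCS] state that one code computes them,
    uniformly in a family of oracles. The degrees [L k] are given only up to equivalence, so
    recursive functionals may sit between any two limits. Moving all of them inside makes [L k]
    comparable with the concrete [LimIt k]. A player who merely stays in a winning region may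
    postpone the target forever. The equilibrium therefore follows least certificates: along a play
    that avoids the target their codes never increase, while the numbers of the positions, which are
    bits of them, grow. In the lower bound each chosen number codes a pair: the argument at which a
    limit is inspected, and the stage from which the next limit is constant. Thus adjacent
    quantifiers of the same kind merge, and [n] choices suffice. The middle outcome makes the choice
    at a node strict: entering is worth either more or less than leaving, never the same. *)

Definition Rec (k : nat) (f : list nat -> nat) : Prop :=
  exists c, forall e, length e = k -> peval c e (f e).

Create HintDb rc discriminated.
#[global] Hint Constants Opaque : rc.

Lemma Rec_ext k f g :
  (forall e, length e = k -> f e = g e) -> Rec k f -> Rec k g.
Proof.
  intros H [c Hc]. exists c. intros e He. rewrite <- H by exact He. auto.
Qed.

Lemma Rec_var k i : Rec k (fun e => nth i e 0).
Proof. exists (PProj i). intros. constructor. Qed.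

Lemma Rec_list k gs : Forall (Rec k) gs ->
  exists cs, forall e, length e = k -> pevals cs e (map (fun g => g e) gs).
Proof.
  induction 1 as [|g gs [c Hc] _ [cs Hcs]].
  - exists []. intros. constructor.
  - exists (c :: cs). intros e He. simpl. constructor; auto.
Qed.

Lemma Rec_comp m k f gs : Rec m f -> length gs = m -> Forall (Rec k) gs ->
  Rec k (fun e => f (map (fun g => g e) gs)).
Proof.
  intros [c Hc] Hl Hg. destruct (Rec_list k gs Hg) as [cs Hcs].
  exists (PComp c cs). intros e He. econstructor; [apply Hcs, He|].
  apply Hc. now rewrite length_map.
Qed.

Lemma map_nth_seq (e : list nat) : map (fun i => nth i e 0) (seq 0 (length e)) = e.
Proof.
  apply nth_ext with 0 0; rewrite length_map, length_seq; auto.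
  intros i Hi. rewrite nth_indep with (d' := nth 0 e 0) by now rewrite length_map, length_seq.
  rewrite map_nth with (f := fun i => nth i e 0) (d := 0). now rewrite seq_nth.
Qed.

Lemma nth_tl i (e : list nat) : nth (S i) e 0 = nth i (tl e) 0.
Proof. destruct e; destruct i; reflexivity. Qed.

Lemma Forall_vars k j m : Forall (Rec k) (map (fun i e => nth (j + i) e 0) (seq 0 m)).
Proof. apply Forall_map, Forall_forall. intros. apply Rec_var. Qed.

Lemma map_vars (e : list nat) :
  map (fun g => g e) (map (fun i e => nth (0 + i) e 0) (seq 0 (length e))) = e.
Proof. rewrite map_map. apply map_nth_seq. Qed.

Lemma Rec_bind k f a : Rec (S k) f -> Rec k a -> Rec k (fun e => f (a e :: e)).
Proof.
  intros Hf Ha.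
  eapply Rec_ext; [|apply (Rec_comp _ k f (a :: map (fun i e => nth (0 + i) e 0) (seq 0 k)) Hf)].
  - intros e He. cbn beta. rewrite map_cons, <- He, map_vars. reflexivity.
  - simpl. now rewrite length_map, length_seq.
  - constructor; auto using Forall_vars.
Qed.

Lemma Rec_weaken k f : Rec k f -> Rec (S k) (fun e => f (tl e)).
Proof.
  intros Hf.
  eapply Rec_ext; [|apply (Rec_comp _ (S k) f (map (fun i e => nth (1 + i) e 0) (seq 0 k)) Hf)].
  - intros e He. cbn beta. f_equal. rewrite map_map.
    destruct e as [|a e]; [discriminate|]. injection He as He. simpl.
    rewrite <- He. apply map_nth_seq.
  - now rewrite length_map, length_seq.
  - apply Forall_vars.
Qed.

Lemma Rec_app1 k g a : Rec 1 (fun e => g (nth 0 e 0)) -> Rec k a ->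
  Rec k (fun e => g (a e)).
Proof.
  intros Hg Ha. apply (Rec_comp 1 k _ [a] Hg); auto.
Qed.

Lemma Rec_app2 k g a b : Rec 2 (fun e => g (nth 0 e 0) (nth 1 e 0)) ->
  Rec k a -> Rec k b -> Rec k (fun e => g (a e) (b e)).
Proof.
  intros Hg Ha Hb. apply (Rec_comp 2 k _ [a; b] Hg); auto.
Qed.

Lemma Rec_S k a : Rec k a -> Rec k (fun e => S (a e)).
Proof.
  intros [c Hc]. exists (PComp PSucc [c]). intros e He.
  econstructor; [repeat constructor; apply Hc, He|]. constructor.
Qed.

Lemma Rec_const k n : Rec k (fun _ => n).
Proof.
  induction n.
  - exists PZero. constructor.
  - now apply Rec_S.
Qed.

Lemma Rec_nth_tl k i g : Rec k (fun e => nth (S i) (g e) 0) ->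
  Rec k (fun e => nth i (tl (g e)) 0).
Proof. apply Rec_ext. intros. apply nth_tl. Qed.

Lemma Rec_prim k a B N : Rec k a ->
  Rec (S (S k)) (fun e => B (nth 0 e 0) (nth 1 e 0) (tl (tl e))) -> Rec k N ->
  Rec k (fun e => nat_rect (fun _ => nat) (a e) (fun n r => B n r e) (N e)).
Proof.
  intros [ca Ha] [cb Hb] HN.
  apply (Rec_bind k (fun e => nat_rect (fun _ => nat) (a (tl e)) (fun n r => B n r (tl e)) (nth 0 e 0)) N);
    [|exact HN].
  exists (PRec ca cb). intros e He. destruct e as [|n e]; [discriminate|].
  injection He as He. simpl. induction n; simpl.
  - constructor. auto.
  - econstructor; [exact IHn|].
    specialize (Hb (n :: nat_rect (fun _ => nat) (a e) (fun n r => B n r e) n :: e)).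
    simpl in Hb. apply Hb. now rewrite He.
Qed.

(** Here [g] may be defined in any way, even by choice; it only has to be the least zero of [f]. *)
Lemma Rec_mu k f g : Rec (S k) f ->
  (forall e, length e = k -> f (g e :: e) = 0 /\ forall m, m < g e -> f (m :: e) <> 0) ->
  Rec k g.
Proof.
  intros [c Hc] H. exists (PMu c). intros e He. destruct (H e He) as [H0 H1].
  constructor.
  - rewrite <- H0. apply Hc. simpl. now rewrite He.
  - intros m Hm. specialize (H1 m Hm).
    exists (pred (f (m :: e))). replace (S (pred (f (m :: e)))) with (f (m :: e)) by lia.
    apply Hc. simpl. now rewrite He.
Qed.

#[global] Hint Resolve Rec_var Rec_const Rec_S Rec_nth_tl : rc.
Ltac rc := auto 200 with rc nocore.

Lemma Rec_pred k a : Rec k a -> Rec k (fun e => pred (a e)).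
Proof.
  intros Ha. apply Rec_ext with
    (fun e => nat_rect (fun _ => nat) 0 (fun n _ => n) (a e)).
  - intros e _. destruct (a e); reflexivity.
  - apply (Rec_prim k (fun _ => 0) (fun n _ _ => n) a); rc.
Qed.
#[global] Hint Resolve Rec_pred : rc.

Lemma Rec_add k a b : Rec k a -> Rec k b -> Rec k (fun e => a e + b e).
Proof.
  intros Ha Hb. apply Rec_ext with
    (fun e => nat_rect (fun _ => nat) (b e) (fun _ r => S r) (a e)).
  - intros e _. induction (a e); simpl; auto.
  - apply (Rec_prim k b (fun _ r _ => S r) a); rc.
Qed.
#[global] Hint Resolve Rec_add : rc.

Lemma Rec_sub k a b : Rec k a -> Rec k b -> Rec k (fun e => a e - b e).
Proof.
  intros Ha Hb. apply Rec_ext with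
    (fun e => nat_rect (fun _ => nat) (a e) (fun _ r => pred r) (b e)).
  - intros e _. induction (b e); simpl; lia.
  - apply (Rec_prim k a (fun _ r _ => pred r) b); rc.
Qed.
#[global] Hint Resolve Rec_sub : rc.

Lemma Rec_mul k a b : Rec k a -> Rec k b -> Rec k (fun e => a e * b e).
Proof.
  apply (Rec_app2 k Nat.mul). apply Rec_ext with
    (fun e => nat_rect (fun _ => nat) 0 (fun _ r => nth 1 e 0 + r) (nth 0 e 0)).
  - intros e _. induction (nth 0 e 0); simpl; auto.
  - apply (Rec_prim 2 (fun _ => 0) (fun _ r e => nth 1 e 0 + r)); rc.
Qed.
#[global] Hint Resolve Rec_mul : rc.

Definition ifz (a b c : nat) : nat := match a with 0 => b | S _ => c end.

Lemma Rec_ifz k a b c : Rec k a -> Rec k b -> Rec k c ->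
  Rec k (fun e => ifz (a e) (b e) (c e)).
Proof.
  intros Ha Hb Hc. apply Rec_ext with (fun e => (1 - a e) * b e + (1 - (1 - a e)) * c e).
  - intros e _. unfold ifz. destruct (a e); simpl; lia.
  - rc.
Qed.
#[global] Hint Resolve Rec_ifz : rc.

(** * Coding of pairs and lists *)

Definition pfst z := fst (of_nat z).
Definition psnd z := snd (of_nat z).

Lemma pair_to_nat a b : pair a b = to_nat (a, b).
Proof.
  rewrite to_nat_spec2. unfold pair.
  replace ((a + b) * (a + b + 1)) with ((b + a) * S (b + a)) by ring. apply Nat.add_comm.
Qed.

Lemma pfst_pair a b : pfst (pair a b) = a.
Proof. unfold pfst. now rewrite pair_to_nat, cancel_of_to. Qed.

Lemma psnd_pair a b : psnd (pair a b) = b.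
Proof. unfold psnd. now rewrite pair_to_nat, cancel_of_to. Qed.

Lemma pair_surj z : pair (pfst z) (psnd z) = z.
Proof.
  rewrite pair_to_nat. unfold pfst, psnd. rewrite <- surjective_pairing. apply cancel_to_of.
Qed.

Lemma psnd_le z : psnd z <= z.
Proof.
  pose proof (to_nat_non_decreasing (pfst z) (psnd z)) as H.
  rewrite <- pair_to_nat, pair_surj in H. lia.
Qed.

Definition tri n := nat_rect (fun _ => nat) 0 (fun i r => S i + r) n.

Lemma tri_S n : tri (S n) = S n + tri n.
Proof. reflexivity. Qed.

Lemma tri_mono a b : a <= b -> tri a <= tri b.
Proof. induction 1; rewrite ?tri_S; lia. Qed.

Lemma pair_tri a b : pair a b = tri (a + b) + b.
Proof.
  rewrite pair_to_nat. unfold to_nat, tri, nat_rec. rewrite (Nat.add_comm b a). lia.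
Qed.

Lemma Rec_tri k a : Rec k a -> Rec k (fun e => tri (a e)).
Proof.
  intros Ha. unfold tri. apply (Rec_prim k (fun _ => 0) (fun i r _ => S i + r)); rc.
Qed.
#[global] Hint Resolve Rec_tri : rc.

Lemma Rec_pair k a b : Rec k a -> Rec k b -> Rec k (fun e => pair (a e) (b e)).
Proof.
  intros Ha Hb. apply Rec_ext with (fun e => tri (a e + b e) + b e).
  - intros. symmetry. apply pair_tri.
  - rc.
Qed.
#[global] Hint Resolve Rec_pair : rc.

(** Unpairing starts from the diagonal: the sum of the components of [z] is the least [d] with
    [z < tri (S d)]. *)
Lemma Rec_psum k a : Rec k a -> Rec k (fun e => pfst (a e) + psnd (a e)).
Proof.
  apply (Rec_app1 k (fun z => pfst z + psnd z)).
  apply Rec_mu with (fun e => (S (nth 1 e 0)) - tri (S (nth 0 e 0))).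
  - rc.
  - intros e _. change (nth 1 ((pfst (nth 0 e 0) + psnd (nth 0 e 0)) :: e) 0) with (nth 0 e 0).
    set (z := nth 0 e 0).
    assert (Hz : z = tri (pfst z + psnd z) + psnd z) by now rewrite <- pair_tri, pair_surj.
    split.
    + cbn [nth]. rewrite tri_S. lia.
    + intros m Hm. simpl nth. fold z. pose proof (tri_mono (S m) (pfst z + psnd z) Hm). lia.
Qed.
#[global] Hint Resolve Rec_psum : rc.

Lemma Rec_psnd k a : Rec k a -> Rec k (fun e => psnd (a e)).
Proof.
  intros Ha. apply Rec_ext with (fun e => a e - tri (pfst (a e) + psnd (a e))); [|rc].
  intros e _. pose proof (pair_tri (pfst (a e)) (psnd (a e))) as H.
  rewrite pair_surj in H. lia.
Qed.
#[global] Hint Resolve Rec_psnd : rc.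

Lemma Rec_pfst k a : Rec k a -> Rec k (fun e => pfst (a e)).
Proof.
  intros Ha. apply Rec_ext with (fun e => (pfst (a e) + psnd (a e)) - psnd (a e)); [|rc].
  intros e _. lia.
Qed.
#[global] Hint Resolve Rec_pfst : rc.

Definition cdrop i c := nat_rect (fun _ => nat) c (fun _ r => psnd (pred r)) i.
Definition cnth i c := pfst (pred (cdrop i c)).

Lemma cdrop_listcode i l : cdrop i (listcode l) = listcode (skipn i l).
Proof.
  revert l. induction i; intros l; [reflexivity|].
  unfold cdrop in *. simpl nat_rect. rewrite IHi.
  rewrite <- (Nat.add_1_l i), Nat.add_comm. revert l IHi. clear.
  intros l _. revert l. induction i; intros [|a l]; try reflexivity.
  - simpl. now rewrite psnd_pair.
  - simpl in *. apply IHi.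
Qed.

Lemma cnth_listcode i l : cnth i (listcode l) = nth i l 0.
Proof.
  unfold cnth. rewrite cdrop_listcode. revert l.
  induction i; intros [|a l]; simpl; auto. apply pfst_pair.
Qed.

Lemma listcode_surj c : exists l, listcode l = c.
Proof.
  induction c as [[|c] IH] using lt_wf_ind.
  - now exists [].
  - destruct (IH (psnd c)) as [l Hl]; [pose proof (psnd_le c); lia|].
    exists (pfst c :: l). simpl. now rewrite Hl, pair_surj.
Qed.

Lemma clen_ex c : exists n, cdrop n c = 0 /\ forall m, m < n -> cdrop m c <> 0.
Proof.
  destruct (listcode_surj c) as [l <-]. exists (length l). split.
  - now rewrite cdrop_listcode, skipn_all.
  - intros m Hm. rewrite cdrop_listcode. destruct (skipn m l) eqn:E; [|discriminate].
    apply (f_equal (@length nat)) in E. rewrite length_skipn in E. simpl in E. lia.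
Qed.

(** The length is the first index at which [cdrop] reaches 0. It is obtained by choice, and [Rec_mu]
    then shows that it is recursive. *)
Definition clen c := proj1_sig (constructive_indefinite_description _ (clen_ex c)).

Lemma clen_listcode l : clen (listcode l) = length l.
Proof.
  unfold clen. destruct constructive_indefinite_description as [n [H0 H1]]. simpl.
  assert (Hz : forall m, cdrop m (listcode l) = 0 <-> length l <= m).
  { intros m. rewrite cdrop_listcode. split; intros H.
    - destruct (skipn m l) eqn:E; [|discriminate].
      apply (f_equal (@length nat)) in E. rewrite length_skipn in E. simpl in E. lia.
    - now rewrite skipn_all2. }
  apply Hz in H0. destruct (Nat.eq_dec n (length l)); auto.
  exfalso. apply (H1 (length l)); [lia|]. now apply Hz.
Qed.

Lemma Rec_cdrop k a b : Rec k a -> Rec k b -> Rec k (fun e => cdrop (a e) (b e)).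
Proof.
  intros Ha Hb. apply (Rec_prim k b (fun _ r _ => psnd (pred r))); rc.
Qed.
#[global] Hint Resolve Rec_cdrop : rc.

Lemma Rec_cnth k a b : Rec k a -> Rec k b -> Rec k (fun e => cnth (a e) (b e)).
Proof. intros Ha Hb. unfold cnth. rc. Qed.
#[global] Hint Resolve Rec_cnth : rc.

Lemma Rec_clen k a : Rec k a -> Rec k (fun e => clen (a e)).
Proof.
  apply (Rec_app1 k clen). apply Rec_mu with (fun e => cdrop (nth 0 e 0) (nth 1 e 0)); [rc|].
  intros e _. simpl nth. unfold clen.
  destruct constructive_indefinite_description as [n Hn]. exact Hn.
Qed.
#[global] Hint Resolve Rec_clen : rc.

(* Code of the list [f 0; ...; f (m-1)], built from its end. *)
Definition cbuild (f : nat -> nat) m :=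
  nat_rect (fun _ => nat) 0 (fun t r => S (pair (f (m - S t)) r)) m.

Lemma cbuild_listcode f m : cbuild f m = listcode (map f (seq 0 m)).
Proof.
  unfold cbuild. enough (H : forall t, t <= m ->
    nat_rect (fun _ => nat) 0 (fun t r => S (pair (f (m - S t)) r)) t
      = listcode (map f (seq (m - t) t))).
  { rewrite H by lia. now rewrite Nat.sub_diag. }
  induction t; intros Ht; [reflexivity|]. simpl nat_rect. rewrite IHt by lia.
  simpl. now replace (S (m - S t)) with (m - t) by lia.
Qed.

Lemma Rec_cbuild k F a : Rec (S k) (fun e => F (nth 0 e 0) (tl e)) -> Rec k a ->
  Rec k (fun e => cbuild (fun j => F j e) (a e)).
Proof.
  intros HF Ha. unfold cbuild.
  apply (Rec_prim k (fun _ => 0) (fun t r e => S (pair (F (a e - S t) e) r))); [rc| |rc].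
  apply Rec_S, Rec_pair; [|rc].
  apply (Rec_bind (S (S k)) (fun d => F (nth 0 d 0) (tl (tl (tl d))))
    (fun e => a (tl (tl e)) - S (nth 0 e 0))).
  - apply (Rec_comp (S k) (S (S (S k))) (fun e => F (nth 0 e 0) (tl e))
      ((fun e => nth 0 e 0) :: map (fun i e => nth (3 + i) e 0) (seq 0 k))) in HF.
    + revert HF. apply Rec_ext. intros e He. simpl. rewrite map_map.
      do 3 (destruct e as [|? e]; [discriminate|]). simpl in *.
      injection He as He. rewrite <- He. now rewrite map_nth_seq.
    + simpl. now rewrite length_map, length_seq.
    + constructor; [apply Rec_var|apply Forall_vars].
  - apply Rec_sub; [|rc]. apply Rec_weaken with (f := fun e => a (tl e)), Rec_weaken, Ha.
Qed.

Lemma prefix_length (p : baire) L : length (prefix p L) = L.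
Proof. unfold prefix. now rewrite length_map, length_seq. Qed.

Lemma nth_map_seq (f : nat -> nat) m i : i < m -> nth i (map f (seq 0 m)) 0 = f i.
Proof.
  intros H. rewrite nth_indep with (d' := f 0) by now rewrite length_map, length_seq.
  rewrite map_nth, seq_nth; auto.
Qed.

Lemma nth_prefix (p : baire) L i : i < L -> nth i (prefix p L) 0 = p i.
Proof. apply nth_map_seq. Qed.

Lemma Rec_subst j k f gs : Rec (length gs + k) f -> Forall (Rec (j + k)) gs ->
  Rec (j + k) (fun e => f (map (fun g => g e) gs ++ skipn j e)).
Proof.
  intros Hf Hg.
  eapply Rec_ext; [|apply (Rec_comp _ (j + k) f (gs ++ map (fun i e => nth (j + i) e 0) (seq 0 k)) Hf)].
  - intros e He. cbn beta. rewrite map_app. do 2 f_equal. rewrite map_map.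
    assert (Hk : k = length (skipn j e)) by (rewrite length_skipn; lia).
    transitivity (map (fun i => nth i (skipn j e) 0) (seq 0 (length (skipn j e)))).
    + rewrite <- Hk. apply map_ext. intros i. now rewrite nth_skipn.
    + apply map_nth_seq.
  - now rewrite length_app, length_map, length_seq.
  - apply Forall_app. split; [exact Hg|apply Forall_vars].
Qed.

(** * Bounded search *)

Fixpoint bmu (f : nat -> nat) (N : nat) : nat :=
  match N with
  | 0 => 0
  | S N' => ifz (f (bmu f N')) (bmu f N') (S N')
  end.

Lemma bmu_spec f N : bmu f N <= N /\ (forall m, m < bmu f N -> f m <> 0) /\
  (f (bmu f N) = 0 \/ bmu f N = N).
Proof.
  induction N as [|N (H1 & H2 & H3)]; simpl.
  - repeat split; [lia|lia|now right].
  - destruct (f (bmu f N)) eqn:E; simpl.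
    + repeat split; [lia|auto|now left].
    + repeat split; [lia| |now right].
      destruct H3 as [H3|H3]; [lia|]. intros m Hm.
      destruct (Nat.eq_dec m (bmu f N)); [subst m; lia|]. apply H2. lia.
Qed.

Lemma bmu_least f N g : g <= N -> f g = 0 -> (forall m, m < g -> f m <> 0) -> bmu f N = g.
Proof.
  intros Hg H0 Hm. destruct (bmu_spec f N) as (H1 & H2 & H3).
  destruct (lt_eq_lt_dec (bmu f N) g) as [[H|H]|H]; auto.
  - destruct H3 as [H3|H3]; [|lia]. now apply Hm in H3.
  - now apply H2 in H0.
Qed.

Lemma Rec_bmu k F N : Rec (S k) (fun e => F (nth 0 e 0) (tl e)) -> Rec k N ->
  Rec k (fun e => bmu (fun n => F n e) (N e)).
Proof.
  intros HF HN. apply Rec_ext with (fun e => nat_rect (fun _ => nat) 0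
    (fun n r => ifz (F r e) r (S n)) (N e)).
  - intros e _. induction (N e); simpl; auto. now rewrite IHn.
  - apply (Rec_prim k (fun _ => 0) (fun n r e => ifz (F r e) r (S n))); [rc| |exact HN].
    apply Rec_ifz; [|rc|rc].
    apply (Rec_subst 2 k _ [fun e => nth 1 e 0]) in HF; [|auto using Rec_var].
    revert HF. apply Rec_ext. intros [|a [|b e]]; reflexivity.
Qed.

(** * Functions recursive in an oracle *)

(* [phi] receives the code of a finite part of the oracle and answers [0] as long
   as this part is too short, and the successor of the value afterwards. *)
Definition computes {X} (k : nat) (o : X -> baire) (F : X -> list nat -> nat) phi :=
  forall x e, length e = k ->
    (forall L, phi (listcode (prefix (o x) L) :: e) = 0 \/
               phi (listcode (prefix (o x) L) :: e) = S (F x e)) /\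
    exists L0, forall L, L0 <= L -> phi (listcode (prefix (o x) L) :: e) = S (F x e).

(** One [phi] serves all [x], which is the uniformity required of a reduction. Taking a subtype for
    [X] restricts a functional to its domain. *)
Definition RC {X} (k : nat) (o : X -> baire) (F : X -> list nat -> nat) : Prop :=
  exists phi, Rec (S k) phi /\ computes k o F phi.

Section RC.
Context {X : Type}.
Implicit Types (o : X -> baire) (F G : X -> list nat -> nat).

Lemma RC_ext k o F G : (forall x e, length e = k -> F x e = G x e) -> RC k o F -> RC k o G.
Proof.
  intros H (phi & H1 & H2). exists phi. split; auto. intros x e He.
  rewrite <- H by exact He. auto.
Qed.

Lemma RC_lift k o f : Rec k f -> RC k o (fun _ e => f e).
Proof.
  intros Hf. exists (fun d => S (f (tl d))). split.
  - now apply Rec_S, Rec_weaken.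
  - intros x e He. split; [auto|exists 0; auto].
Qed.

Lemma RC_oracle k o a : RC k o a -> RC k o (fun x e => o x (a x e)).
Proof.
  intros (phi & H1 & H2).
  exists (fun d => ifz (phi d) 0 (ifz (phi d - clen (nth 0 d 0)) (S (cnth (pred (phi d)) (nth 0 d 0))) 0)).
  split; [rc|]. intros x e He. destruct (H2 x e He) as [H3 [L0 H4]]. simpl nth. split.
  - intros L. rewrite clen_listcode, prefix_length.
    destruct (H3 L) as [-> | ->]; auto. cbn [ifz pred].
    destruct (S (a x e) - L) eqn:E; cbn [ifz]; auto.
    right. rewrite cnth_listcode, nth_prefix by lia. auto.
  - exists (max L0 (S (a x e))). intros L HL. rewrite clen_listcode, prefix_length, H4 by lia.
    cbn [ifz]. replace (S (a x e) - L) with 0 by lia. cbn [ifz pred].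
    rewrite cnth_listcode, nth_prefix by lia. auto.
Qed.

(** A single guard [psi] tells when the prefix is long enough for all arguments at once. *)
Lemma RC_list k o gs : Forall (RC k o) gs ->
  exists psi phis, Rec (S k) psi /\ Forall (Rec (S k)) phis /\ length phis = length gs /\
  forall x e, length e = k ->
    (forall L, psi (listcode (prefix (o x) L) :: e) <> 0 ->
       map (fun f => f (listcode (prefix (o x) L) :: e)) phis = map (fun g => g x e) gs) /\
    exists L0, forall L, L0 <= L -> psi (listcode (prefix (o x) L) :: e) <> 0.
Proof.
  induction 1 as [|g gs (phi & Hp & Hphi) _ (psi & phis & H1 & H2 & H3 & H4)].
  - exists (fun _ => 1), []. repeat split; auto using Rec_const.
    exists 0. intros. discriminate.
  - exists (fun d => psi d * phi d), ((fun d => pred (phi d)) :: phis). repeat split; simpl; auto.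
    + rc.
    + constructor; [rc|auto].
    + intros L HL. destruct (H4 x e H) as [H5 _]. destruct (Hphi x e H) as [H6 _].
      rewrite H5 by (intros E; now rewrite E in HL). f_equal.
      destruct (H6 L) as [E|E]; rewrite E in *; [lia|auto].
    + destruct (H4 x e H) as [_ [L1 H5]]. destruct (Hphi x e H) as [_ [L2 H6]].
      exists (max L1 L2). intros L HL. specialize (H5 L). rewrite H6 by lia.
      intros E. apply Nat.eq_mul_0 in E. destruct E as [E|E]; [|lia].
      apply H5; [lia|auto].
Qed.

Lemma RC_comp m k o F gs : RC m o F -> length gs = m -> Forall (RC k o) gs ->
  RC k o (fun x e => F x (map (fun g => g x e) gs)).
Proof.
  intros (phi & Hp & Hphi) Hm Hg. destruct (RC_list k o gs Hg) as (psi & phis & H1 & H2 & H3 & H4).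
  exists (fun d => ifz (psi d) 0 (phi (map (fun g => g d) ((fun d => nth 0 d 0) :: phis)))). split.
  - apply Rec_ifz; [auto|rc|]. apply Rec_comp with (S m); simpl; [auto|lia|]. constructor; [rc|auto].
  - intros x e He. destruct (H4 x e He) as [H5 [L1 H6]].
    destruct (Hphi x (map (fun g => g x e) gs)) as [H7 [L2 H8]]; [now rewrite length_map|].
    split.
    + intros L. destruct (psi _) eqn:E; simpl; auto. rewrite H5 by now rewrite E. apply H7.
    + exists (max L1 L2). intros L HL. specialize (H5 L). specialize (H6 L).
      destruct (psi _) eqn:E; simpl; [exfalso; apply H6; lia|].
      rewrite H5 by lia. apply H8. lia.
Qed.

Lemma uniform_bound (P : nat -> nat -> Prop) N :
  (forall m, m <= N -> exists L0, forall L, L0 <= L -> P m L) ->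
  exists L0, forall L, L0 <= L -> forall m, m <= N -> P m L.
Proof.
  induction N; intros H.
  - destruct (H 0 (le_n 0)) as [L0 H0]. exists L0. intros L HL m Hm.
    replace m with 0 by lia. auto.
  - destruct IHN as [L1 H1]; [auto|]. destruct (H (S N) (le_n _)) as [L2 H2].
    exists (max L1 L2). intros L HL m Hm.
    destruct (Nat.eq_dec m (S N)); [subst; apply H2; lia|apply H1; lia].
Qed.

Lemma RC_prim k o a B N : RC k o a ->
  RC (S (S k)) o (fun x e => B x (nth 0 e 0) (nth 1 e 0) (tl (tl e))) -> RC k o N ->
  RC k o (fun x e => nat_rect (fun _ => nat) (a x e) (fun n r => B x n r e) (N x e)).
Proof.
  intros (pa & Ha1 & Ha2) (pb & Hb1 & Hb2) (pN & HN1 & HN2).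
  exists (fun d => ifz (pN d) 0 (nat_rect (fun _ => nat) (pa d)
    (fun n r => ifz r 0 (pb (nth 0 d 0 :: n :: pred r :: tl d))) (pred (pN d)))).
  split.
  - apply Rec_ifz; [auto|rc|].
    apply (Rec_prim (S k) pa (fun n r d => ifz r 0 (pb (nth 0 d 0 :: n :: pred r :: tl d)))); [auto| |rc].
    apply Rec_ifz; [rc|rc|].
    apply (Rec_subst 3 k pb [fun e => nth 2 e 0; fun e => nth 0 e 0; fun e => pred (nth 1 e 0)]) in Hb1.
    + revert Hb1. apply Rec_ext. intros [|? [|? [|? e]]]; simpl; try discriminate. auto.
    + repeat constructor; rc.
  - intros x e He. destruct (HN2 x e He) as [HN3 [LN HN4]].
    set (R := fun n => nat_rect (fun _ => nat) (a x e) (fun n r => B x n r e) n).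
    set (R' := fun L n => nat_rect (fun _ => nat) (pa (listcode (prefix (o x) L) :: e))
       (fun n r => ifz r 0 (pb (listcode (prefix (o x) L) :: n :: pred r :: e))) n).
    assert (HB : forall n, _) by (intros n; refine (Hb2 x (n :: R n :: e) _); simpl; lia).
    simpl in HB.
    assert (HR : forall L n, R' L n = 0 \/ R' L n = S (R n)).
    { intros L n. induction n; simpl.
      - apply Ha2; auto.
      - fold (R' L n). destruct IHn as [-> | ->]; simpl; auto. apply HB. }
    assert (HR' : forall n, exists L0, forall L, L0 <= L -> R' L n = S (R n)).
    { induction n.
      - apply Ha2; auto.
      - destruct IHn as [L1 H1]. destruct (HB n) as [_ [L2 H2]].
        exists (max L1 L2). intros L HL. simpl. fold (R' L n). rewrite H1 by lia. simpl.
        apply H2. lia. }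
    split.
    + intros L. destruct (HN3 L) as [-> | ->]; simpl; auto. apply HR.
    + destruct (HR' (N x e)) as [L1 H1]. exists (max L1 LN). intros L HL.
      rewrite HN4 by lia. simpl. apply H1. lia.
Qed.

Lemma RC_mu k o F G : RC (S k) o F ->
  (forall x e, length e = k ->
     F x (G x e :: e) = 0 /\ forall m, m < G x e -> F x (m :: e) <> 0) ->
  RC k o G.
Proof.
  intros (phi & H1 & H2) H.
  set (val := fun d n => phi (nth 0 d 0 :: n :: tl d)).
  (* [pred] identifies the answer 0 (prefix too short) with the answer 1 (value 0), so the search
     stops at the first of either kind. The outer [ifz] then rejects the undecided case. *)
  set (srch := fun d => bmu (fun n => pred (val d n)) (clen (nth 0 d 0))).
  exists (fun d => ifz (val d (srch d)) 0 (ifz (pred (val d (srch d))) (S (srch d)) 0)).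
  assert (Hv : Rec (S (S k)) (fun e => val (tl e) (nth 0 e 0))).
  { pose proof (Rec_subst 2 k phi [fun e => nth 1 e 0; fun e => nth 0 e 0] H1) as Hs.
    assert (Hs' := Hs ltac:(repeat constructor; rc)). revert Hs'.
    apply Rec_ext. intros [|? [|? e]]; simpl; try discriminate. reflexivity. }
  assert (Hs : Rec (S k) srch).
  { apply (Rec_bmu (S k) (fun n d => pred (val d n))); rc. }
  assert (Hvs : Rec (S k) (fun d => val d (srch d))).
  { pose proof (Rec_bind (S k) _ srch Hv Hs) as Hb. exact Hb. }
  split; [rc|].
  intros x e He. destruct (H x e He) as [H3 H4].
  assert (HF : forall n, _) by (intros n; refine (H2 x (n :: e) _); simpl; lia).
  unfold srch, val. cbn [nth tl]. split.
  - intros L. rewrite clen_listcode, prefix_length.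
    set (f := fun n => pred (phi (listcode (prefix (o x) L) :: n :: e))).
    destruct (bmu_spec f L) as (_ & H5 & _). set (r := bmu f L) in *.
    destruct (HF r) as [H6 _]. destruct (H6 L) as [-> | ->]; simpl; auto.
    destruct (F x (r :: e)) eqn:E; simpl; auto. right. f_equal.
    destruct (lt_eq_lt_dec r (G x e)) as [[Hl|Hl]|Hl]; auto.
    + now apply H4 in Hl.
    + apply H5 in Hl. unfold f in Hl. destruct (HF (G x e)) as [H7 _].
      destruct (H7 L) as [E'|E']; rewrite E' in Hl; simpl in Hl; lia.
  - destruct (uniform_bound (fun m L => phi (listcode (prefix (o x) L) :: m :: e) = S (F x (m :: e))) (G x e))
      as [L1 HL1]; [intros m _; apply HF|].
    exists (max L1 (G x e)). intros L HL. rewrite clen_listcode, prefix_length.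
    rewrite (bmu_least _ L (G x e)); [|lia| |].
    + rewrite HL1, H3 by lia. reflexivity.
    + rewrite HL1, H3 by lia. reflexivity.
    + intros m Hm. rewrite HL1 by lia. simpl. auto.
Qed.

Lemma RC_trans k o o' F : RC k o' F -> RC 1 o (fun x e => o' x (nth 0 e 0)) -> RC k o F.
Proof.
  intros (phi & H1 & H2) (psi & G1 & G2).
  set (val := fun c j => psi [c; j]).
  (* The part of [o'] that is handed on ends at the first entry still undecided; the length of the
     given part of [o] bounds this search. *)
  set (len := fun c => bmu (val c) (clen c)).
  exists (fun d => phi (cbuild (fun j => pred (val (nth 0 d 0) j)) (len (nth 0 d 0)) :: tl d)).
  assert (Hv : forall m a b, Rec m a -> Rec m b -> Rec m (fun e => val (a e) (b e))).
  { intros m a b Ha Hb. apply (Rec_comp 2 m psi [a; b] G1); auto. }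
  assert (Hl : Rec (S k) (fun d => len (nth 0 d 0))).
  { apply (Rec_bmu (S k) (fun n d => val (nth 0 d 0) n)); [|rc]. apply Hv; rc. }
  split.
  - pose proof (Rec_subst 1 k phi [fun d => cbuild (fun j => pred (val (nth 0 d 0) j)) (len (nth 0 d 0))]) as Hs.
    eapply Rec_ext; [|apply Hs].
    + intros [|a e]; [discriminate|]. reflexivity.
    + exact H1.
    + constructor; auto. apply (Rec_cbuild (S k) (fun j d => pred (val (nth 0 d 0) j))); [|exact Hl].
      apply Rec_pred. apply Hv; rc.
  - intros x e He. destruct (H2 x e He) as [H3 [L0 H4]]. cbn [nth tl].
    assert (HV : forall j, _) by (intros j; refine (G2 x [j] _); reflexivity). simpl in HV.
    assert (Hc : forall L, let m := len (listcode (prefix (o x) L)) in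
      cbuild (fun j => pred (val (listcode (prefix (o x) L)) j)) m = listcode (prefix (o' x) m)).
    { intros L m. rewrite cbuild_listcode. f_equal. unfold prefix at 2. apply map_ext_in.
      intros j Hj. apply in_seq in Hj. unfold m, len in Hj.
      destruct (bmu_spec (val (listcode (prefix (o x) L))) (clen (listcode (prefix (o x) L)))) as (_ & H5 & _).
      specialize (H5 j ltac:(lia)). destruct (HV j) as [H6 _].
      unfold val in *. destruct (H6 L) as [E|E]; rewrite E in *; [lia|auto]. }
    split.
    + intros L. rewrite Hc. apply H3.
    + destruct (uniform_bound (fun j L => val (listcode (prefix (o x) L)) j <> 0) L0) as [L1 HL1].
      { intros j _. destruct (HV j) as [_ [L2 H5]]. exists L2. intros L HL. unfold val.
        rewrite H5 by lia. lia. }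
      exists (max L0 L1). intros L HL. rewrite Hc. apply H4. unfold len.
      destruct (bmu_spec (val (listcode (prefix (o x) L))) (clen (listcode (prefix (o x) L)))) as (_ & _ & H5).
      rewrite clen_listcode, prefix_length in *.
      destruct H5 as [H5|H5]; [|lia].
      destruct (le_lt_dec L0 (bmu (val (listcode (prefix (o x) L))) L)) as [?|Hlt]; auto.
      exfalso. revert H5. apply HL1; lia.
Qed.
End RC.

Lemma RC_map {X Y} (h : Y -> X) k o F :
  RC k o F -> RC k (fun y => o (h y)) (fun y e => F (h y) e).
Proof. intros (phi & H1 & H2). exists phi. split; auto. intros y. apply H2. Qed.

(** * Closure properties of computation with an oracle *)

Section RC_functions.
Context {X : Type}.
Implicit Types (o : X -> baire) (a b c : X -> list nat -> nat).

Lemma RC_var k o i : RC k o (fun _ e => nth i e 0).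
Proof. apply RC_lift. rc. Qed.

Lemma RC_const k o n : RC k o (fun _ _ => n).
Proof. apply (RC_lift k o (fun _ => n)). rc. Qed.

Lemma RC_nth_tl k o i g : RC k o (fun _ e => nth (S i) (g e) 0) ->
  RC k o (fun _ e => nth i (tl (g e)) 0).
Proof. apply RC_ext. intros. apply nth_tl. Qed.

Lemma RC_app1 k o G a : RC 1 o (fun x e => G x (nth 0 e 0)) ->
  RC k o a -> RC k o (fun x e => G x (a x e)).
Proof. intros HG Ha. apply (RC_comp 1 k o _ [a] HG); auto. Qed.

Lemma RC_app2 k o G a b : RC 2 o (fun x e => G x (nth 0 e 0) (nth 1 e 0)) ->
  RC k o a -> RC k o b -> RC k o (fun x e => G x (a x e) (b x e)).
Proof. intros HG Ha Hb. apply (RC_comp 2 k o _ [a; b] HG); auto. Qed.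

Lemma RC_app3 k o G a b c : RC 3 o (fun x e => G x (nth 0 e 0) (nth 1 e 0) (nth 2 e 0)) ->
  RC k o a -> RC k o b -> RC k o c -> RC k o (fun x e => G x (a x e) (b x e) (c x e)).
Proof. intros HG Ha Hb Hc. apply (RC_comp 3 k o _ [a; b; c] HG); auto. Qed.

Lemma RC_S k o a : RC k o a -> RC k o (fun x e => S (a x e)).
Proof. apply (RC_app1 k o (fun _ => S)), RC_lift. rc. Qed.
Lemma RC_pred k o a : RC k o a -> RC k o (fun x e => pred (a x e)).
Proof. apply (RC_app1 k o (fun _ => pred)), RC_lift. rc. Qed.
Lemma RC_add k o a b : RC k o a -> RC k o b -> RC k o (fun x e => a x e + b x e).
Proof. apply (RC_app2 k o (fun _ => Nat.add)), RC_lift. rc. Qed.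
Lemma RC_sub k o a b : RC k o a -> RC k o b -> RC k o (fun x e => a x e - b x e).
Proof. apply (RC_app2 k o (fun _ => Nat.sub)), RC_lift. rc. Qed.
Lemma RC_mul k o a b : RC k o a -> RC k o b -> RC k o (fun x e => a x e * b x e).
Proof. apply (RC_app2 k o (fun _ => Nat.mul)), RC_lift. rc. Qed.
Lemma RC_pair k o a b : RC k o a -> RC k o b -> RC k o (fun x e => pair (a x e) (b x e)).
Proof. apply (RC_app2 k o (fun _ => pair)), RC_lift. rc. Qed.
Lemma RC_pfst k o a : RC k o a -> RC k o (fun x e => pfst (a x e)).
Proof. apply (RC_app1 k o (fun _ => pfst)), RC_lift. rc. Qed.
Lemma RC_psnd k o a : RC k o a -> RC k o (fun x e => psnd (a x e)).
Proof. apply (RC_app1 k o (fun _ => psnd)), RC_lift. rc. Qed.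
Lemma RC_ifz k o a b c : RC k o a -> RC k o b -> RC k o c ->
  RC k o (fun x e => ifz (a x e) (b x e) (c x e)).
Proof. apply (RC_app3 k o (fun _ => ifz)), RC_lift. rc. Qed.

Lemma RC_weaken k o a : RC k o a -> RC (S k) o (fun x e => a x (tl e)).
Proof.
  intros Ha. eapply RC_ext; [|apply (RC_comp k (S k) o a (map (fun i _ e => nth (1 + i) e 0) (seq 0 k)) Ha)].
  - intros x [|n e] He; [discriminate|]. cbn beta. f_equal. rewrite map_map. simpl.
    injection He as <-. apply map_nth_seq.
  - now rewrite length_map, length_seq.
  - apply Forall_map, Forall_forall. intros. apply RC_var.
Qed.

Definition RCb k o (P : X -> list nat -> bool) := RC k o (fun x e => Nat.b2n (P x e)).

Lemma RC_if k o P a b : RCb k o P -> RC k o a -> RC k o b ->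
  RC k o (fun x e => if P x e then a x e else b x e).
Proof.
  intros HP Ha Hb. eapply RC_ext; [|apply (RC_ifz k o _ b a HP Hb Ha)].
  intros. cbn beta. destruct (P x e); reflexivity.
Qed.

Lemma RCb_ext k o P Q : (forall x e, length e = k -> P x e = Q x e) -> RCb k o P -> RCb k o Q.
Proof. intros H. apply RC_ext. intros. now rewrite H. Qed.

Lemma RCb_if k o P Q R : RCb k o P -> RCb k o Q -> RCb k o R ->
  RCb k o (fun x e => if P x e then Q x e else R x e).
Proof.
  intros HP HQ HR. eapply RC_ext; [|apply (RC_if k o P _ _ HP HQ HR)].
  intros. cbn beta. destruct (P x e); reflexivity.
Qed.

Lemma RCb_const k o (v : bool) : RCb k o (fun _ _ => v).
Proof. apply (RC_const k o (Nat.b2n v)). Qed.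

Lemma RCb_negb k o P : RCb k o P -> RCb k o (fun x e => negb (P x e)).
Proof. intros H. apply (RCb_if k o P (fun _ _ => false) (fun _ _ => true) H); apply RCb_const. Qed.

Lemma RCb_andb k o P Q : RCb k o P -> RCb k o Q -> RCb k o (fun x e => P x e && Q x e).
Proof. intros HP HQ. apply (RCb_if k o P Q (fun _ _ => false) HP HQ). apply RCb_const. Qed.

Lemma RCb_orb k o P Q : RCb k o P -> RCb k o Q -> RCb k o (fun x e => P x e || Q x e).
Proof. intros HP HQ. apply (RCb_if k o P (fun _ _ => true) Q HP); auto. apply RCb_const. Qed.

Lemma RCb_leb k o a b : RC k o a -> RC k o b -> RCb k o (fun x e => a x e <=? b x e).
Proof.
  intros Ha Hb. apply RC_ext with (fun x e => 1 - (a x e - b x e)).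
  - intros. destruct (Nat.leb_spec (a x e) (b x e)); unfold Nat.b2n; lia.
  - apply RC_sub; [apply RC_const|now apply RC_sub].
Qed.

Lemma RCb_ltb k o a b : RC k o a -> RC k o b -> RCb k o (fun x e => a x e <? b x e).
Proof. intros Ha Hb. apply RCb_leb; [now apply RC_S|auto]. Qed.

Lemma RCb_eqb k o a b : RC k o a -> RC k o b -> RCb k o (fun x e => a x e =? b x e).
Proof.
  intros Ha Hb. apply RCb_ext with (fun x e => (a x e <=? b x e) && (b x e <=? a x e)).
  - intros. destruct (Nat.leb_spec (a x e) (b x e)), (Nat.leb_spec (b x e) (a x e)),
      (Nat.eqb_spec (a x e) (b x e)); simpl; auto; lia.
  - apply RCb_andb; apply RCb_leb; auto.
Qed.

Lemma RCb_rec k o P B N : RCb k o P ->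
  RCb (S (S k)) o (fun x e => B x (nth 0 e 0) (nth 1 e 0 =? 1) (tl (tl e))) -> RC k o N ->
  RCb k o (fun x e => nat_rect (fun _ => bool) (P x e) (fun n r => B x n r e) (N x e)).
Proof.
  intros HP HB HN. eapply RC_ext; [|apply (RC_prim k o _ (fun x n r e => Nat.b2n (B x n (r =? 1) e)) N HP HB HN)].
  intros. cbn beta. induction (N x e); simpl; auto. rewrite IHn.
  do 2 f_equal. destruct (nat_rect (fun _ => bool) _ _ n); reflexivity.
Qed.
End RC_functions.

(** * Bounded quantifiers *)

Fixpoint bex (N : nat) (f : nat -> bool) : bool :=
  match N with 0 => false | S n => bex n f || f n end.
Definition ball (N : nat) (f : nat -> bool) : bool := negb (bex N (fun n => negb (f n))).
Definition bleast (N : nat) (f : nat -> bool) : nat := bmu (fun n => Nat.b2n (negb (f n))) N.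

Lemma bex_spec N f : bex N f = true <-> exists n, n < N /\ f n = true.
Proof.
  induction N; simpl.
  - split; [discriminate|]. intros (n & H & _). lia.
  - rewrite orb_true_iff, IHN. split.
    + intros [(n & H1 & H2)|H]; eauto.
    + intros (n & H1 & H2). destruct (Nat.eq_dec n N) as [->|]; auto.
      left. exists n. split; [lia|auto].
Qed.

Lemma ball_spec N f : ball N f = true <-> forall n, n < N -> f n = true.
Proof.
  unfold ball. rewrite negb_true_iff, <- not_true_iff_false, bex_spec. split.
  - intros H n Hn. destruct (f n) eqn:E; auto. exfalso. apply H. exists n. now rewrite E.
  - intros H (n & H1 & H2). rewrite H in H2 by auto. discriminate.
Qed.

Lemma bleast_spec N f : bleast N f <= N /\ (forall m, m < bleast N f -> f m = false) /\
  (f (bleast N f) = true \/ bleast N f = N).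
Proof.
  unfold bleast. destruct (bmu_spec (fun n => Nat.b2n (negb (f n))) N) as (H1 & H2 & H3).
  split; [auto|split].
  - intros m Hm. apply H2 in Hm. destruct (f m); auto. now destruct Hm.
  - destruct H3 as [H3|H3]; auto. left. destruct (f _); auto. discriminate.
Qed.

Section RC_bounded.
Context {X : Type}.
Implicit Types (o : X -> baire).

Lemma RCb_bex k o N F : RC k o N -> RCb (S k) o (fun x e => F x (nth 0 e 0) (tl e)) ->
  RCb k o (fun x e => bex (N x e) (fun n => F x n e)).
Proof.
  intros HN HF. eapply RCb_ext; [|apply (RCb_rec k o (fun _ _ => false) (fun x n r e => r || F x n e) N)].
  - intros. cbn beta. induction (N x e); simpl; auto. now rewrite IHn.
  - apply RCb_const.
  - apply RCb_orb.
    + apply RCb_eqb; [apply RC_var|apply RC_const].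
    + eapply RCb_ext; [|apply (RC_comp (S k) (S (S k)) o _
        ((fun _ e => nth 0 e 0) :: map (fun i _ e => nth (2 + i) e 0) (seq 0 k)) HF)].
      * intros x [|? [|? e]] He; try discriminate. cbn [map nth tl]. f_equal.
        rewrite map_map. injection He as He. simpl. rewrite <- He. apply map_nth_seq.
      * simpl. now rewrite length_map, length_seq.
      * constructor; [apply RC_var|]. apply Forall_map, Forall_forall. intros. apply RC_var.
  - exact HN.
Qed.

Lemma RCb_ball k o N F : RC k o N -> RCb (S k) o (fun x e => F x (nth 0 e 0) (tl e)) ->
  RCb k o (fun x e => ball (N x e) (fun n => F x n e)).
Proof.
  intros HN HF. apply RCb_negb, (RCb_bex k o N (fun x n e => negb (F x n e))); auto.
  now apply RCb_negb.
Qed.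

Lemma RC_bleast k o N F : RC k o N -> RCb (S k) o (fun x e => F x (nth 0 e 0) (tl e)) ->
  RC k o (fun x e => bleast (N x e) (fun n => F x n e)).
Proof.
  intros HN HF. unfold bleast.
  eapply RC_ext; [|apply (RC_prim k o (fun _ _ => 0) (fun x n r e => if F x r e then r else S n) N)].
  - intros. cbn beta. induction (N x e); simpl; auto. rewrite IHn. destruct (F x _ e); reflexivity.
  - apply RC_const.
  - apply RC_if; [|apply RC_var|apply RC_S, RC_var].
    eapply RCb_ext; [|apply (RC_comp (S k) (S (S k)) o _
        ((fun _ e => nth 1 e 0) :: map (fun i _ e => nth (2 + i) e 0) (seq 0 k)) HF)].
    * intros x [|? [|? e]] He; try discriminate. cbn [map nth tl]. f_equal.
      rewrite map_map. injection He as He. simpl. rewrite <- He. apply map_nth_seq.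
    * simpl. now rewrite length_map, length_seq.
    * constructor; [apply RC_var|]. apply Forall_map, Forall_forall. intros. apply RC_var.
  - exact HN.
Qed.
End RC_bounded.

#[global] Hint Resolve RC_var RC_const RC_nth_tl RC_S RC_pred RC_add RC_sub RC_mul RC_pair
  RC_pfst RC_psnd RC_ifz RC_oracle RC_if RCb_if RCb_const RCb_negb RCb_andb
  RCb_orb RCb_leb RCb_ltb RCb_eqb RCb_bex RCb_ball RC_bleast : rc.

(** * Sequences recursive in an oracle, and realizers *)

Definition RCS {X} (o q : X -> baire) : Prop := RC 1 o (fun x e => q x (nth 0 e 0)).

Section RCS.
Context {X : Type}.
Implicit Types (o p q : X -> baire).

Lemma RCS_refl o : RCS o o.
Proof. unfold RCS. rc. Qed.

Lemma RCS_trans o p q : RCS o p -> RCS p q -> RCS o q.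
Proof. intros H1 H2. exact (RC_trans 1 o p _ H2 H1). Qed.

Lemma RCS_app k o q a : RCS o q -> RC k o a -> RC k o (fun x e => q x (a x e)).
Proof. intros Hq Ha. apply (RC_app1 k o q); auto. Qed.

Lemma tuple_fst (p q : baire) m : tuple p q (2 * m) = p m.
Proof. unfold tuple. rewrite Nat.even_mul. simpl. f_equal. exact (Nat.div2_double m). Qed.

Lemma tuple_snd (p q : baire) m : tuple p q (S (2 * m)) = q m.
Proof.
  unfold tuple. rewrite Nat.even_succ, Nat.odd_mul. cbn [Nat.odd Nat.even negb andb].
  f_equal. apply Nat.div2_succ_double.
Qed.

Lemma RCS_fst o p q : RCS o (fun x => tuple (p x) (q x)) -> RCS o p.
Proof.
  intros H. unfold RCS. eapply RC_ext; [|apply (RCS_app 1 o _ (fun _ e => 2 * nth 0 e 0) H)].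
  - intros. apply tuple_fst.
  - rc.
Qed.

Lemma RCS_snd o p q : RCS o (fun x => tuple (p x) (q x)) -> RCS o q.
Proof.
  intros H. unfold RCS. eapply RC_ext; [|apply (RCS_app 1 o _ (fun _ e => S (2 * nth 0 e 0)) H)].
  - intros. apply tuple_snd.
  - rc.
Qed.

Lemma RC_div2 k o a : RC k o a -> RC k o (fun x e => Nat.div2 (a x e)).
Proof.
  intros Ha. apply RC_ext with (fun x e => bleast (a x e) (fun m => a x e <=? S (2 * m))).
  - intros x e _. set (n := a x e).
    destruct (bleast_spec n (fun m => n <=? S (2 * m))) as (H1 & H2 & H3).
    set (r := bleast _ _) in *.
    assert (Hr : n <= S (2 * r)) by (destruct H3 as [H3|H3]; [now apply Nat.leb_le|lia]).
    destruct r as [|r].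
    + destruct n as [|[|n]]; try reflexivity. lia.
    + specialize (H2 r (le_n _)). apply Nat.leb_gt in H2.
      assert (E : n = 2 * S r \/ n = S (2 * S r)) by lia. destruct E as [-> | ->].
      * symmetry. exact (Nat.div2_double (S r)).
      * symmetry. apply Nat.div2_succ_double.
  - apply RC_bleast; [auto|]. apply RCb_leb; [|rc]. now apply RC_weaken.
Qed.

Lemma RCb_even k o a : RC k o a -> RCb k o (fun x e => Nat.even (a x e)).
Proof.
  intros Ha. apply RCb_ext with (fun x e => a x e =? 2 * Nat.div2 (a x e)).
  - intros x e _. pose proof (Nat.div2_odd (a x e)) as H. rewrite <- Nat.negb_odd.
    destruct (Nat.odd (a x e)); simpl Nat.b2n in H.
    + apply Nat.eqb_neq. lia.
    + apply Nat.eqb_eq. lia.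
  - apply RCb_eqb; auto. apply RC_mul; [rc|]. now apply RC_div2.
Qed.

Lemma RCS_tuple o p q : RCS o p -> RCS o q -> RCS o (fun x => tuple (p x) (q x)).
Proof.
  intros Hp Hq. unfold RCS, tuple. apply RC_if.
  - apply RCb_even. rc.
  - apply (RCS_app 1 o p); auto. apply RC_div2. rc.
  - apply (RCS_app 1 o q); auto. apply RC_div2. rc.
Qed.

Lemma computable_Rec (alpha : nat -> nat) : computable alpha <-> Rec 1 (fun e => alpha (nth 0 e 0)).
Proof.
  split; intros [c Hc]; exists c.
  - intros [|n [|]] He; try discriminate. apply Hc.
  - intros n. apply (Hc [n]). reflexivity.
Qed.

(** The answers of [phi] need not persist for longer prefixes, but every nonzero answer is correct.
    Hence the first one, which [Phi] takes, is right. *)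
Lemma RCS_Phi_intro o q : RCS o q ->
  exists alpha, computable alpha /\ forall x, Phi alpha (o x) (q x).
Proof.
  intros (phi & H1 & H2). exists (fun m => phi [psnd m; pfst m]). split.
  - apply computable_Rec.
    apply (Rec_comp 2 1 phi [fun e => psnd (nth 0 e 0); fun e => pfst (nth 0 e 0)]); auto.
    repeat constructor; rc.
  - intros x n. destruct (H2 x [n] eq_refl) as [H3 [L0 H4]]. simpl in H3, H4.
    assert (Hk : exists k, phi [listcode (prefix (o x) k); n] <> 0 /\
      forall j, j < k -> phi [listcode (prefix (o x) j); n] = 0).
    { destruct (bmu_spec (fun j => 1 - phi [listcode (prefix (o x) j); n]) L0) as (_ & H5 & H6).
      exists (bmu (fun j => 1 - phi [listcode (prefix (o x) j); n]) L0). split.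
      - destruct H6 as [H6|H6]; [lia|]. rewrite H6, H4; lia.
      - intros j Hj. apply H5 in Hj. lia. }
    destruct Hk as (k & Hk1 & Hk2). exists k. rewrite psnd_pair, pfst_pair. repeat split; [lia| |].
    + intros j Hj. rewrite psnd_pair, pfst_pair. auto.
    + destruct (H3 k) as [E|E]; rewrite E in *; lia.
Qed.

(** From a prefix one tries the associate on all its initial parts and takes the first nonzero
    answer. *)
Lemma RCS_Phi_elim alpha o q : computable alpha -> (forall x, Phi alpha (o x) (q x)) -> RCS o q.
Proof.
  intros Ha H. apply computable_Rec in Ha.
  set (f := fun d j => alpha (pair (nth 1 d 0) (cbuild (fun i => cnth i (nth 0 d 0)) j))).
  exists (fun d => f d (bmu (fun j => 1 - f d j) (clen (nth 0 d 0)))). split.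
  - assert (Hf : Rec 3 (fun e => f (tl e) (nth 0 e 0))).
    { unfold f. apply (Rec_app1 3 alpha); auto. apply Rec_pair; [rc|].
      apply (Rec_cbuild 3 (fun i e => cnth i (nth 0 (tl e) 0))); rc. }
    apply (Rec_bind 2 _ (fun d => bmu (fun j => 1 - f d j) (clen (nth 0 d 0))) Hf).
    apply (Rec_bmu 2 (fun j d => 1 - f d j)); rc.
  - intros x e He. destruct e as [|n [|]]; try discriminate. cbn [nth].
    assert (Hf : forall L j, j <= L -> f [listcode (prefix (o x) L); n] j
                               = alpha (pair n (listcode (prefix (o x) j)))).
    { intros L j Hj. unfold f. cbn [nth]. do 2 f_equal. rewrite cbuild_listcode. f_equal.
      apply map_ext_in. intros i Hi. apply in_seq in Hi. rewrite cnth_listcode, nth_prefix; [auto|lia]. }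
    destruct (H x n) as (k & Hk1 & Hk2 & Hk3). split.
    + intros L. rewrite clen_listcode, prefix_length.
      set (g := fun j => 1 - f [listcode (prefix (o x) L); n] j).
      destruct (bmu_spec g L) as (H1 & H2 & H3). set (r := bmu g L) in *. rewrite Hf by auto.
      destruct (lt_eq_lt_dec r k) as [[Hl|Hl]|Hl].
      * rewrite Hk2 by auto. auto.
      * rewrite Hl in *. right. lia.
      * specialize (H2 k Hl). unfold g in H2. rewrite Hf in H2 by lia. lia.
    + exists k. intros L HL. rewrite clen_listcode, prefix_length.
      rewrite (bmu_least _ L k HL); rewrite ?Hf by auto; [lia|lia|].
      intros m Hm. rewrite Hf, Hk2 by lia. lia.
Qed.
End RCS.

Lemma RCS_map {X Y} (h : Y -> X) (o q : X -> baire) :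
  RCS o q -> RCS (fun y => o (h y)) (fun y => q (h y)).
Proof. exact (RC_map h 1 o _). Qed.

(** * Reductions in terms of recursive functionals *)

Lemma Phi_functional alpha p q1 q2 : Phi alpha p q1 -> Phi alpha p q2 -> q1 = q2.
Proof.
  intros H1 H2. apply functional_extensionality. intros n.
  destruct (H1 n) as (k1 & A1 & B1 & C1). destruct (H2 n) as (k2 & A2 & B2 & C2).
  destruct (lt_eq_lt_dec k1 k2) as [[H|H]|H].
  - rewrite B2 in A1 by auto. lia.
  - subst k2. congruence.
  - rewrite B1 in A2 by auto. lia.
Qed.

(** The oracles of [K] range over the pairs of an instance and a solution of its image, so [K] is
    unconstrained on all other pairs. *)
Lemma WRed_intro (f g : problem) (H : {p | pdom f p} -> baire)
  (K : {p | pdom f p} * baire -> baire) :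
  RCS (fun x => proj1_sig x) H ->
  (forall x, pdom g (H x)) ->
  RCS (fun y : {y : {p | pdom f p} * baire | g (H (fst y)) (snd y)} =>
         tuple (proj1_sig (fst (proj1_sig y))) (snd (proj1_sig y)))
      (fun y => K (proj1_sig y)) ->
  (forall x s, g (H x) s -> f (proj1_sig x) (K (x, s))) ->
  WRed f g.
Proof.
  intros HH Hdom HK Hcor.
  destruct (RCS_Phi_intro _ _ HH) as (aH & HaH1 & HaH2).
  destruct (RCS_Phi_intro _ _ HK) as (aK & HaK1 & HaK2).
  exists aK, aH. split; [auto|split; [auto|]]. intros G [HG1 HG2] p Hp.
  pose (x := exist (pdom f) p Hp). destruct (HG2 (H x) (Hdom x)) as (s & Hs1 & Hs2).
  exists (H x), s, (K (x, s)). repeat split; auto.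
  - apply (HaH2 x).
  - apply (HaK2 (exist (fun y => g (H (fst y)) (snd y)) (x, s) Hs2)).
  - apply (Hcor x s Hs2).
Qed.

Lemma choice_fun {A B} (R : A -> B -> Prop) :
  (forall a, exists b, R a b) -> exists f, forall a, R a (f a).
Proof.
  intros H. exists (fun a => proj1_sig (constructive_indefinite_description _ (H a))).
  intros a. apply proj2_sig.
Qed.

(** Every solution of an instance is the value of some realizer, so quantifying over realizers
    amounts to quantifying over solutions. The instance [r] does not depend on the realizer because
    [Phi] is functional. *)
Lemma WRed_elim (f g : problem) : WRed f g -> exists alphaK alphaH,
  computable alphaK /\ computable alphaH /\
  forall p, pdom f p -> exists r, Phi alphaH p r /\ pdom g r /\
    forall s, g r s -> exists t, Phi alphaK (tuple p s) t /\ f p t.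
Proof.
  intros (aK & aH & HK & HH & H). exists aK, aH. split; [auto|split; [auto|]].
  intros p Hp.
  (* A choice function on the domain of [g], altered at [r0] so that it returns [s0]. *)
  assert (Hreal : forall r0 s0, g r0 s0 -> exists G, realizer g G /\
     (forall r s, G r s -> g r s) /\ G r0 s0).
  { intros r0 s0 H0.
    destruct (choice_fun (fun (r : {r | pdom g r}) s => g (proj1_sig r) s)) as [c Hc].
    { intros [r Hr]. exact Hr. }
    exists (fun r s => (r = r0 /\ s = s0) \/ (r <> r0 /\ exists Hr, s = c (exist _ r Hr))).
    repeat split.
    - intros r s1 s2 [[-> ->]|[Hn1 [Hr1 ->]]] [[E ->]|[Hn2 [Hr2 ->]]]; auto; try congruence.
      now rewrite (proof_irrelevance _ Hr1 Hr2).
    - intros r Hr. destruct (classic (r = r0)) as [->|Hn].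
      + exists s0. split; auto.
      + exists (c (exist _ r Hr)). split; [right; eauto|apply (Hc (exist _ r Hr))].
    - intros r s [[-> ->]|[Hn [Hr ->]]]; auto. apply (Hc (exist _ r Hr)).
    - now left. }
  assert (Hreal' : exists G, realizer g G /\ forall r s, G r s -> g r s).
  { destruct (classic (exists r0 s0, g r0 s0)) as [(r0 & s0 & H0)|Hn].
    - destruct (Hreal r0 s0 H0) as (G & HG1 & HG2 & _). eauto.
    - exists (fun _ _ => False). repeat split; try tauto. intros r [s Hs]. exfalso. eauto. }
  destruct Hreal' as (G & HG1 & HG2). destruct (H G HG1 p Hp) as (r & s & t & H1 & H2 & _).
  exists r. split; [auto|split; [exists s; auto|]].
  intros s' Hs'. destruct (Hreal r s' Hs') as (G' & HG1' & HG2' & HG3').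
  destruct (H G' HG1' p Hp) as (r' & s'' & t' & H1' & H2' & H3' & H4').
  rewrite (Phi_functional _ _ _ _ H1' H1) in H2'.
  destruct HG1' as [HF _]. rewrite (HF _ _ _ H2' HG3') in H3'. eauto.
Qed.

Lemma WRed_refl f : WRed f f.
Proof.
  apply (WRed_intro f f (fun x => proj1_sig x) snd).
  - apply RCS_refl.
  - intros x. apply proj2_sig.
  - eapply RCS_snd, RCS_refl.
  - auto.
Qed.

Lemma WRed_trans f g h : WRed f g -> WRed g h -> WRed f h.
Proof.
  intros H1 H2. apply WRed_elim in H1, H2.
  destruct H1 as (K1 & H1 & cK1 & cH1 & R1), H2 as (K2 & H2 & cK2 & cH2 & R2).
  assert (E1 : forall x : {p | pdom f p}, exists rr, Phi H1 (proj1_sig x) (fst rr) /\ Phi H2 (fst rr) (snd rr) /\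
     pdom h (snd rr) /\ (forall s, h (snd rr) s -> exists ut,
       Phi K2 (tuple (fst rr) s) (fst ut) /\ Phi K1 (tuple (proj1_sig x) (fst ut)) (snd ut) /\ f (proj1_sig x) (snd ut))).
  { intros [p Hp]. destruct (R1 p Hp) as (r1 & A1 & A2 & A3). destruct (R2 r1 A2) as (r2 & B1 & B2 & B3).
    exists (r1, r2). simpl. repeat split; auto. intros s Hs.
    destruct (B3 s Hs) as (u & C1 & C2). destruct (A3 u C2) as (t & D1 & D2). now exists (u, t). }
  apply choice_fun in E1. destruct E1 as [rr Hrr].
  assert (E2 : forall xs : {p | pdom f p} * baire, exists ut, h (snd (rr (fst xs))) (snd xs) ->
       Phi K2 (tuple (fst (rr (fst xs))) (snd xs)) (fst ut) /\
       Phi K1 (tuple (proj1_sig (fst xs)) (fst ut)) (snd ut) /\ f (proj1_sig (fst xs)) (snd ut)).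
  { intros [x s]. destruct (classic (h (snd (rr x)) s)) as [Hs|Hs].
    - destruct (Hrr x) as (_ & _ & _ & Hx). destruct (Hx s Hs) as [ut Hut]. now exists ut.
    - exists (s, s). now intros. }
  apply choice_fun in E2. destruct E2 as [ut Hut].
  assert (Hr1 : RCS (fun x => proj1_sig x) (fun x => fst (rr x))).
  { apply (RCS_Phi_elim H1); auto. intros x. apply Hrr. }
  apply (WRed_intro f h (fun x => snd (rr x)) (fun xs => snd (ut xs))).
  - eapply RCS_trans; [exact Hr1|]. apply (RCS_Phi_elim H2); auto. intros x. apply Hrr.
  - intros x. apply Hrr.
  - set (o := fun y : {y : {p | pdom f p} * baire | h (snd (rr (fst y))) (snd y)} => _).
    assert (Hp : RCS o (fun y => proj1_sig (fst (proj1_sig y)))) by (eapply RCS_fst, RCS_refl).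
    assert (Hs : RCS o (fun y => snd (proj1_sig y))) by (eapply RCS_snd, RCS_refl).
    assert (Hu : RCS o (fun y => fst (ut (proj1_sig y)))).
    { eapply RCS_trans with (p := fun y => tuple (fst (rr (fst (proj1_sig y)))) (snd (proj1_sig y))).
      - apply RCS_tuple; auto. eapply RCS_trans; [exact Hp|].
        apply (RCS_map (fun y : {y : {p | pdom f p} * baire | h (snd (rr (fst y))) (snd y)} => fst (proj1_sig y)) _ _ Hr1).
      - apply (RCS_Phi_elim K2); auto. intros [y Hy]. apply (Hut y Hy). }
    eapply RCS_trans; [apply RCS_tuple; [exact Hp|exact Hu]|].
    apply (RCS_Phi_elim K1); auto. intros [y Hy]. apply (Hut y Hy).
  - intros x s Hs. apply (Hut (x, s) Hs).
Qed.

Lemma WEquiv_refl f : WEquiv f f.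
Proof. split; apply WRed_refl. Qed.

Lemma WEquiv_sym f g : WEquiv f g -> WEquiv g f.
Proof. now intros []. Qed.

Lemma WEquiv_trans f g h : WEquiv f g -> WEquiv g h -> WEquiv f h.
Proof. intros [A B] [C D]. split; eapply WRed_trans; eauto. Qed.

(** * Iterated limits *)

Fixpoint LimIt (k : nat) : problem :=
  match k with
  | 0 => IdP
  | S k => CompP (LimIt k) LimP
  end.

Lemma LimP_functional p q1 q2 : LimP p q1 -> LimP p q2 -> q1 = q2.
Proof.
  intros H1 H2. apply functional_extensionality. intros n.
  destruct (H1 n) as [N1 A1], (H2 n) as [N2 A2].
  rewrite <- (A1 (max N1 N2)), <- (A2 (max N1 N2)) by lia. reflexivity.
Qed.

(** Since [lim] is single-valued, the domain condition of [CompP] follows from its second half. *)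
Lemma LimIt_S k p r : LimIt (S k) p r <-> exists q, LimP p q /\ LimIt k q r.
Proof.
  split.
  - intros [_ H]. exact H.
  - intros (q & H1 & H2). split; [|eauto]. intros q' H1'.
    rewrite (LimP_functional _ _ _ H1' H1). now exists r.
Qed.

(** Associativity: [LimIt] puts the additional limit first, whereas constructions append it at the
    end. *)
Lemma LimIt_snoc k p q r : LimIt k p q -> LimP q r -> LimIt (S k) p r.
Proof.
  revert p. induction k; intros p H1 H2.
  - simpl in H1. unfold IdP in H1. subst. apply LimIt_S. exists r. split; [auto|reflexivity].
  - apply LimIt_S in H1. destruct H1 as (p' & H3 & H4). apply LimIt_S. exists p'. eauto.
Qed.

Lemma LimIt_functional k p q1 q2 : LimIt k p q1 -> LimIt k p q2 -> q1 = q2.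
Proof.
  revert p. induction k; intros p H1 H2.
  - simpl in *. unfold IdP in *. congruence.
  - apply LimIt_S in H1, H2. destruct H1 as (r1 & A1 & B1), H2 as (r2 & A2 & B2).
    rewrite (LimP_functional _ _ _ A1 A2) in B1. eauto.
Qed.

(** The normal form of a computation with [k] limits: recursive preprocessing, then the limits, and
    nothing after them. *)
Definition LimC {X} (k : nat) (o F : X -> baire) : Prop :=
  exists r, RCS o r /\ forall x, LimIt k (r x) (F x).

(* A recursive functional commutes with [lim] when the [i]-th approximation of its
   value is computed from the [i]-th approximation of its argument, with a search
   bounded by [i]. *)
Lemma lim_absorb {X} (o r q t : X -> baire) :
  RCS o r -> (forall x, LimP (r x) (q x)) -> RCS (fun x => tuple (o x) (q x)) t ->
  exists r', RCS o r' /\ forall x, LimP (r' x) (t x).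
Proof.
  intros Hr Hq (phi & H1 & H2).
  set (a := fun x i => tuple (o x) (fun j => r x (pair j i))).
  set (G := fun x i n j => phi [cbuild (a x i) j; n]).
  set (J := fun x i n => bleast i (fun j => negb (G x i n j =? 0))).
  exists (fun x m => pred (G x (psnd m) (pfst m) (J x (psnd m) (pfst m)))). split.
  - assert (HG : forall k i n j, RC k o i -> RC k o n -> RC k o j ->
      RC k o (fun x e => G x (i x e) (n x e) (j x e))).
    { intros k i n j. apply (RC_app3 k o G). unfold G.
      apply (RC_comp 2 3 o (fun _ e => phi e)
        [fun x e => cbuild (a x (nth 0 e 0)) (nth 2 e 0); fun _ e => nth 1 e 0]);
        [now apply RC_lift|reflexivity|].
      repeat constructor; [|rc].
      apply (RC_prim 3 o (fun _ _ => 0) (fun x t r e => S (pair (a x (nth 0 e 0) (nth 2 e 0 - S t)) r)));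
        [rc| |rc].
      apply RC_S, RC_pair; [|rc]. unfold a, tuple. apply RC_if.
      + apply RCb_even. rc.
      + apply (RC_oracle 5 o). apply RC_div2. rc.
      + apply (RCS_app 5 o r); auto. apply RC_pair; [|rc]. apply RC_div2. rc. }
    apply RC_pred, HG; [rc|rc|]. unfold J. apply RC_bleast; [rc|].
    apply RCb_negb, RCb_eqb; [|rc]. apply HG; rc.
  - intros x n. destruct (H2 x [n] eq_refl) as [H3 [L0 HL]]. simpl in H3, HL.
    set (P := fun j => negb (phi [listcode (prefix (tuple (o x) (q x)) j); n] =? 0)).
    destruct (bleast_spec L0 P) as (B1 & B2 & B3). set (j0 := bleast L0 P) in *.
    assert (Hj0 : P j0 = true).
    { destruct B3 as [B3|B3]; auto. unfold P. rewrite B3, HL by auto. reflexivity. }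
    destruct (uniform_bound (fun j i => a x i j = tuple (o x) (q x) j) j0) as [N HN].
    { intros j _. destruct (Hq x (Nat.div2 j)) as [M HM]. exists M. intros i Hi.
      unfold a, tuple. destruct (Nat.even j); auto. }
    exists (max j0 N). intros i Hi. rewrite psnd_pair, pfst_pair.
    assert (HG : forall j, j <= j0 -> G x i n j = phi [listcode (prefix (tuple (o x) (q x)) j); n]).
    { intros j Hj. unfold G. rewrite cbuild_listcode. do 3 f_equal. apply map_ext_in.
      intros j' Hj'. apply in_seq in Hj'. apply HN; lia. }
    replace (J x i n) with j0.
    + rewrite HG by auto. unfold P in Hj0. apply negb_true_iff, Nat.eqb_neq in Hj0.
      destruct (H3 j0) as [E|E]; rewrite E in *; [lia|reflexivity].
    + symmetry. unfold J, bleast. apply bmu_least; [lia| |].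
      * rewrite HG by auto. fold (P j0). now rewrite Hj0.
      * intros m Hm. rewrite HG by lia. fold (P m). rewrite B2 by auto. discriminate.
Qed.

(** The first limit [q] joins the oracle, and by induction the postprocessing moves inside the other
    [k] limits. What remains to be done with [q] is then recursive, and [lim_absorb] moves it inside
    the first limit. *)
Lemma LimC_absorb {X} k (o s t : X -> baire) :
  LimC k o s -> RCS (fun x => tuple (o x) (s x)) t -> LimC k o t.
Proof.
  revert o s t. induction k; intros o s t (r & Hr & Hs) Ht.
  - exists t. split; [|reflexivity]. eapply RCS_trans; [|exact Ht].
    apply RCS_tuple; [apply RCS_refl|].
    replace s with r; [auto|]. apply functional_extensionality. intros x. symmetry. apply Hs.
  - assert (Hq : forall x, exists q, LimP (r x) q /\ LimIt k q (s x)) by (intros x; apply LimIt_S, Hs).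
    apply choice_fun in Hq. destruct Hq as [q Hq].
    set (o' := fun x => tuple (o x) (q x)).
    assert (Ho : RCS o' o) by (eapply RCS_fst, RCS_refl).
    destruct (IHk o' s t) as (q' & Hq1 & Hq2).
    + exists q. split; [eapply RCS_snd, RCS_refl|apply Hq].
    + eapply RCS_trans; [|exact Ht]. apply RCS_tuple.
      * eapply RCS_trans; [eapply RCS_fst, RCS_refl|exact Ho].
      * eapply RCS_snd, RCS_refl.
    + destruct (lim_absorb o r q q') as (r' & Hr1 & Hr2); auto; [apply Hq|].
      exists r'. split; auto. intros x. apply LimIt_S. exists (q' x). auto.
Qed.

Lemma LimC_lim {X} k (o s g t : X -> baire) :
  LimC k o s -> RCS (fun x => tuple (o x) (s x)) g -> (forall x, LimP (g x) (t x)) ->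
  LimC (S k) o t.
Proof.
  intros Hs Hg Ht. destruct (LimC_absorb k o s g Hs Hg) as (r & Hr1 & Hr2).
  exists r. split; auto. intros x. eapply LimIt_snoc; eauto.
Qed.

Lemma LimC_WRed k (f : problem) (K : {p | pdom f p} -> baire) :
  LimC k (fun x => proj1_sig x) K -> (forall x, f (proj1_sig x) (K x)) -> WRed f (LimIt k).
Proof.
  intros (r & H1 & H2) HK. apply (WRed_intro f (LimIt k) r snd); auto.
  - intros x. exists (K x). auto.
  - eapply RCS_snd, RCS_refl.
  - intros x s Hs. simpl. rewrite (LimIt_functional _ _ _ _ Hs (H2 x)). auto.
Qed.

(** Three functionals disturb the chain of limits: [K1] and [H2] after the first limit, and [K2] at
    the end. All are absorbed. *)
Lemma CompP_LimIt k f g : WRed f (LimIt k) -> WRed g LimP -> WRed (CompP f g) (LimIt (S k)).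
Proof.
  intros Hf Hg. apply WRed_elim in Hf, Hg.
  destruct Hf as (K2 & H2 & cK2 & cH2 & R2), Hg as (K1 & H1 & cK1 & cH1 & R1).
  assert (E : forall x : {p | pdom (CompP f g) p}, exists z : baire * baire * baire * (baire * baire * baire),
    let '((r1, q1, u), (r2, s2, t)) := z in
    Phi H1 (proj1_sig x) r1 /\ LimP r1 q1 /\ Phi K1 (tuple (proj1_sig x) q1) u /\
    Phi H2 u r2 /\ LimIt k r2 s2 /\ Phi K2 (tuple u s2) t /\ CompP f g (proj1_sig x) t).
  { intros [p Hp]. cbn [proj1_sig]. destruct Hp as [t0 [Hd [q0 [Hq0 _]]]].
    destruct (R1 p (ex_intro _ q0 Hq0)) as (r1 & A1 & [q1 A2] & A3).
    destruct (A3 q1 A2) as (u & A4 & A5).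
    destruct (R2 u (Hd u A5)) as (r2 & B1 & [s2 B2] & B3).
    destruct (B3 s2 B2) as (t & B4 & B5).
    exists ((r1, q1, u), (r2, s2, t)). simpl. repeat split; auto. exists u. auto. }
  apply choice_fun in E. destruct E as [z Hz].
  apply (LimC_WRed (S k) (CompP f g) (fun x => snd (snd (z x)))).
  - set (o := fun x : {p | pdom (CompP f g) p} => proj1_sig x).
    set (q1 := fun x => snd (fst (fst (z x)))).
    set (o1 := fun x => tuple (o x) (q1 x)).
    assert (Ho : RCS o1 o) by (eapply RCS_fst, RCS_refl).
    assert (Hu : RCS o1 (fun x => snd (fst (z x)))).
    { apply (RCS_Phi_elim K1); auto. intros x. specialize (Hz x). unfold o1, q1.
      destruct (z x) as [[[r1' q1'] u] [[r2 s2] t]]. apply Hz. }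
    destruct (LimC_absorb k o1 (fun x => snd (fst (snd (z x)))) (fun x => snd (snd (z x))))
      as (q' & Q1 & Q2).
    + exists (fun x => fst (fst (snd (z x)))). split.
      * eapply RCS_trans; [exact Hu|]. apply (RCS_Phi_elim H2); auto. intros x. specialize (Hz x).
        destruct (z x) as [[[r1' q1'] u] [[r2 s2] t]]. apply Hz.
      * intros x. specialize (Hz x). destruct (z x) as [[[r1' q1'] u] [[r2 s2] t]]. apply Hz.
    + eapply RCS_trans; [apply RCS_tuple|].
      * eapply RCS_trans; [eapply RCS_fst, RCS_refl|exact Hu].
      * eapply RCS_snd, RCS_refl.
      * apply (RCS_Phi_elim K2); auto. intros x. specialize (Hz x).
        destruct (z x) as [[[r1' q1'] u] [[r2 s2] t]]. apply Hz.
    + destruct (lim_absorb o (fun x => fst (fst (fst (z x)))) q1 q') as (r' & Hr1 & Hr2); auto.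
      * apply (RCS_Phi_elim H1); auto. intros x. specialize (Hz x).
        destruct (z x) as [[[r1' q1'] u] [[r2 s2] t]]. apply Hz.
      * intros x. specialize (Hz x). unfold q1.
        destruct (z x) as [[[r1' q1'] u] [[r2 s2] t]]. apply Hz.
      * exists r'. split; auto. intros x. apply LimIt_S. eauto.
  - intros x. specialize (Hz x). destruct (z x) as [[[r1' q1'] u] [[r2 s2] t]]. apply Hz.
Qed.

(** The representatives [f0] and [g0] of the composition are arbitrary, which is why [CompP_LimIt]
    assumes reductions only. The other direction applies maximality to [LimIt k] and [LimP]. *)
Lemma IsLimIter_LimIt L : IsLimIter L -> forall k, WEquiv (L k) (LimIt k).
Proof.
  intros [H0 HS]. induction k.
  - exact H0.
  - destruct (HS k) as [(f0 & g0 & Hf & Hg & Hh) Hmax]. split.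
    + eapply WRed_trans; [apply Hh|]. apply CompP_LimIt.
      * eapply WRed_trans; [apply Hf|apply IHk].
      * apply Hg.
    + apply (Hmax (LimIt k) LimP); [now apply WEquiv_sym|apply WEquiv_refl].
Qed.

(** * Games on difference sets *)

(* Words are represented by their number under [wordOfNat]. *)
Definition ch (N : nat) (b : bool) : nat := 2 * N + 1 + Nat.b2n b.

Lemma ch_gt N b : N < ch N b.
Proof. unfold ch. lia. Qed.

Lemma testbit_lt C M : Nat.testbit C M = true -> M < C.
Proof.
  intros H. destruct (le_lt_dec C M) as [Hle|]; auto. exfalso.
  rewrite Nat.bits_above_log2 in H; [discriminate|].
  destruct C; [simpl in *; now rewrite Nat.bits_0 in H|]. pose proof (Nat.log2_lt_lin (S C)). lia.
Qed.

Definition least (P : nat -> Prop) : nat :=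
  match excluded_middle_informative (exists C, P C) with
  | left H => proj1_sig (constructive_indefinite_description _
      (dec_inh_nat_subset_has_unique_least_element P (fun C => classic (P C)) H))
  | right _ => 0
  end.

Lemma least_spec P : (exists C, P C) -> P (least P) /\ forall C, P C -> least P <= C.
Proof.
  intros H. unfold least. destruct excluded_middle_informative; [|contradiction].
  destruct constructive_indefinite_description as [C HC]. apply HC.
Qed.

Lemma least_none P : ~ (exists C, P C) -> least P = 0.
Proof. intros H. unfold least. destruct excluded_middle_informative; [contradiction|auto]. Qed.

(** Whether the least entered index [beta] puts a play into the difference set of [m] open sets
    depends on the parity of [m - beta]. Raising the level by one thus exchanges the players; at the
    top level [n] the player is [A]. *)
Definition dplayer (n : nat) (A : bool) (j : nat) : bool := if Nat.even (n + j) then A else negb A.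

Lemma dplayer_S n A j : dplayer n A (S j) = negb (dplayer n A j).
Proof.
  unfold dplayer. rewrite Nat.add_succ_r, Nat.even_succ, <- Nat.negb_even.
  destruct (Nat.even (n + j)), A; reflexivity.
Qed.

Lemma dplayer_n n A : dplayer n A n = A.
Proof. unfold dplayer. now rewrite Nat.even_add, eqb_reflx. Qed.

Lemma bool_neq_trans (a b c : bool) : a <> b -> b <> c -> a = c.
Proof. destruct a, b, c; congruence. Qed.

(* [E i] are the positions at which one of [U_0, ..., U_i] is known to be entered.
   In the game of level [j] the player [D j] aims at the difference set of
   [U_0, ..., U_(j-1)]; [T j] is the target of this player at level [j + 1]: the set
   [U_j] is entered at a position from which [D j] does not win at level [j].
   [W j], the winning region of [D j], is given by finite certificates. *)
Section Levels.
Variables (n : nat) (own : nat -> bool) (A : bool) (E W : nat -> nat -> bool).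
Let D := dplayer n A.

Definition target j N := E j N && negb (W j N).
Definition certStep j C N :=
  target j N ||
  (if eqb (own N) (D (S j)) then Nat.testbit C (ch N false) || Nat.testbit C (ch N true)
   else Nat.testbit C (ch N false) && Nat.testbit C (ch N true)).
(** The bits of [C] form a finite set of positions. No ranks are needed to exclude endless
    postponement: children have larger numbers, so a play cannot stay in a finite set and has to
    meet the target. *)
Definition cert j C := ball C (fun M => negb (Nat.testbit C M) || certStep j C M).

Hypothesis E_mono : forall i N, E i N = true -> E (S i) N = true.
Hypothesis E_child : forall i N b, E i N = true -> E i (ch N b) = true.
Hypothesis W_0 : forall N, W 0 N = false.
Hypothesis W_S : forall j N, j < n ->
  W (S j) N = true <-> exists C, Nat.testbit C N = true /\ cert j C = true.

Lemma cert_iff j C : cert j C = true <->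
  forall M, Nat.testbit C M = true -> certStep j C M = true.
Proof.
  unfold cert. rewrite ball_spec. split.
  - intros H M HM. specialize (H M (testbit_lt _ _ HM)). rewrite HM in H. exact H.
  - intros H M _. destruct (Nat.testbit C M) eqn:HM; simpl; auto.
Qed.

Lemma certStep_incl j C C' N : (forall M, Nat.testbit C M = true -> Nat.testbit C' M = true) ->
  certStep j C N = true -> certStep j C' N = true.
Proof.
  intros H. unfold certStep. destruct (target j N); auto. simpl.
  destruct (eqb _ _); rewrite ?orb_true_iff, ?andb_true_iff; intuition.
Qed.

Lemma W_intro j C N : j < n -> cert j C = true -> certStep j C N = true -> W (S j) N = true.
Proof.
  intros Hj HC HN. apply W_S; auto. exists (Nat.setbit C N). split.
  - apply Nat.setbit_eq.
  - assert (Hs : forall M, Nat.testbit C M = true -> Nat.testbit (Nat.setbit C N) M = true).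
    { intros M HM. now rewrite Nat.setbit_eqb, HM, orb_true_r. }
    apply cert_iff. intros M HM. apply (certStep_incl j C); auto.
    rewrite Nat.setbit_eqb in HM. apply orb_prop in HM. destruct HM as [HM|HM].
    + apply Nat.eqb_eq in HM. now subst M.
    + now apply cert_iff.
Qed.

(** The fixed point equation of reachability. Finite branching enters where the certificates of both
    children are merged by [lor]. *)
Lemma W_iff j N : j < n -> W (S j) N = true <->
  target j N = true \/ (own N = D (S j) /\ exists b, W (S j) (ch N b) = true) \/
  (own N <> D (S j) /\ forall b, W (S j) (ch N b) = true).
Proof.
  intros Hj. split.
  - intros H. apply W_S in H; auto. destruct H as (C & H1 & H2).
    assert (H3 := proj1 (cert_iff _ _) H2 N H1). unfold certStep in H3.
    apply orb_prop in H3. destruct H3 as [H3|H3]; auto.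
    destruct (eqb (own N) (D (S j))) eqn:Eo; [apply eqb_prop in Eo|apply eqb_false_iff in Eo]; right.
    + left. split; auto. apply orb_prop in H3. destruct H3; [exists false|exists true]; apply W_S; eauto.
    + right. split; auto. apply andb_prop in H3. intros []; apply W_S; auto; exists C; tauto.
  - intros [H|[[Ho [b Hb]]|[Ho Hb]]].
    + apply (W_intro j 0); auto. unfold certStep. now rewrite H.
    + apply W_S in Hb; auto. destruct Hb as (C & H1 & H2). apply (W_intro j C); auto.
      unfold certStep. rewrite Ho, eqb_reflx. destruct b; rewrite H1, ?orb_true_r; auto.
    + destruct (proj1 (W_S _ _ Hj) (Hb false)) as (C & H1 & H2).
      destruct (proj1 (W_S _ _ Hj) (Hb true)) as (C' & H1' & H2').
      apply (W_intro j (Nat.lor C C')); auto.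
      * apply cert_iff. intros M HM. rewrite Nat.lor_spec in HM. apply orb_prop in HM.
        destruct HM as [HM|HM]; [apply (certStep_incl j C)|apply (certStep_incl j C')];
          try (now apply cert_iff); intros M' HM'; rewrite Nat.lor_spec, HM', ?orb_true_r; auto.
      * unfold certStep. apply eqb_false_iff in Ho. rewrite Ho, !Nat.lor_spec, H1, H1', !orb_true_r. auto.
Qed.

(** Leastness of the fixed point, by induction from the large numbers in a certificate down to the
    small ones. *)
Lemma W_ind j (P : nat -> Prop) : j < n ->
  (forall N, target j N = true -> P N) ->
  (forall N, own N = D (S j) -> (exists b, P (ch N b)) -> P N) ->
  (forall N, own N <> D (S j) -> (forall b, P (ch N b)) -> P N) ->
  forall N, W (S j) N = true -> P N.
Proof.
  intros Hj HT HO HX N HN. apply W_S in HN; auto. destruct HN as (C & H1 & H2).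
  enough (H : forall m N, C - N <= m -> Nat.testbit C N = true -> P N) by (apply (H C); [lia|auto]).
  clear N H1. induction m; intros N Hm HN; [apply testbit_lt in HN; lia|].
  assert (H3 := proj1 (cert_iff _ _) H2 N HN). unfold certStep in H3. apply testbit_lt in HN.
  assert (Hlt : forall b, C - ch N b <= m) by (intros b; pose proof (ch_gt N b); lia).
  apply orb_prop in H3. destruct H3 as [H3|H3]; auto.
  destruct (eqb (own N) (D (S j))) eqn:Eo; [apply eqb_prop in Eo|apply eqb_false_iff in Eo].
  - apply HO; auto. apply orb_prop in H3. destruct H3; eauto.
  - apply HX; auto. apply andb_prop in H3. intros []; apply IHm; auto; tauto.
Qed.

Lemma notW_step j N : j <= n -> W j N = false ->
  (own N = D j -> forall b, W j (ch N b) = false) /\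
  (own N <> D j -> exists b, W j (ch N b) = false).
Proof.
  intros Hj H. destruct j.
  - split; intros; [|exists true]; auto.
  - assert (H' : W (S j) N <> true) by now rewrite H. rewrite W_iff in H' by auto. split.
    + intros Ho b. apply not_true_iff_false. intros Hb. apply H'. eauto.
    + intros Ho. destruct (W (S j) (ch N false)) eqn:E0; [|eauto].
      destruct (W (S j) (ch N true)) eqn:E1; [|eauto].
      exfalso. apply H'. right. right. split; auto. now intros [].
Qed.

(** In the target the move comes from the level below: the player has to keep the opponent out of
    [W j], and the children remain in the target because entered sets stay entered. *)
Lemma W_step j N : j <= n -> W j N = true ->
  (own N = D j -> exists b, W j (ch N b) = true) /\
  (own N <> D j -> forall b, W j (ch N b) = true).
Proof.
  intros Hj H. destruct j; [now rewrite W_0 in H|].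
  assert (H' := H). rewrite W_iff in H' by auto.
  destruct H' as [HT|[[Ho Hb]|[Ho Hb]]]; [|tauto|tauto].
  unfold target in HT. apply andb_prop in HT. destruct HT as [HE Hn].
  apply negb_true_iff in Hn. destruct (notW_step j N) as [S1 S2]; [lia|auto|].
  assert (HT : forall b, W j (ch N b) = false -> W (S j) (ch N b) = true).
  { intros b Hb. apply W_iff; [lia|]. left. unfold target. now rewrite E_child, Hb. }
  unfold D in *. rewrite dplayer_S in *. split.
  - intros Ho. destruct S2 as [b Hb]; [rewrite Ho; apply no_fixpoint_negb|]. eauto.
  - intros Ho b. apply HT, S1. destruct (own N), (dplayer n A j); simpl in *; congruence.
Qed.

(** Once one of [U_0, ..., U_j] is entered, level [j + 1] is level [j] with the roles exchanged. Two
    simultaneous wins would persist along suitable moves up to the target, where they contradict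
    each other. *)
Lemma W_E j N : j < n -> E j N = true -> W (S j) N = negb (W j N).
Proof.
  intros Hj HE. destruct (W j N) eqn:HW; simpl.
  - apply not_true_iff_false. intros H. revert N H HE HW.
    apply (W_ind j (fun N => E j N = true -> W j N = true -> False)); auto.
    + intros N HT _ HW. unfold target in HT. rewrite HW, andb_false_r in HT. discriminate.
    + intros N Ho [b Hb] HE HW. apply Hb; [now apply E_child|].
      apply W_step in HW; [|lia]. apply HW. rewrite Ho. unfold D. rewrite dplayer_S. apply no_fixpoint_negb.
    + intros N Ho Hb HE HW. apply W_step in HW; [|lia]. destruct HW as [HW _].
      destruct HW as [b HW]; [|apply (Hb b); auto].
      unfold D in *. rewrite dplayer_S in Ho. destruct (own N), (dplayer n A j); simpl in *; congruence.
  - apply W_iff; auto. left. unfold target. now rewrite HE, HW.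
Qed.

(** * Strategies at the current level *)

Definition level N := bleast n (fun j => E j N).
Definition leastCert j N : nat := least (fun C => Nat.testbit C N && cert j C = true).

Lemma leastCert_spec j N : j < n -> W (S j) N = true ->
  Nat.testbit (leastCert j N) N = true /\ cert j (leastCert j N) = true /\
  forall C, Nat.testbit C N = true -> cert j C = true -> leastCert j N <= C.
Proof.
  intros Hj H. apply W_S in H; auto. unfold leastCert.
  destruct (least_spec (fun C => Nat.testbit C N && cert j C = true)) as [H1 H2].
  - destruct H as [C [A1 A2]]. exists C. now rewrite A1, A2.
  - apply andb_prop in H1. repeat split; try apply H1. intros C A1 A2. apply H2. now rewrite A1, A2.
Qed.

(* The owner follows a least certificate if the position is won at its level, and
   otherwise leaves the winning region of the opponent alone. *)
Definition move N : bool :=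
  let j := level N in
  if eqb (own N) (D j) then negb (Nat.testbit (leastCert (pred j) N) (ch N false))
  else W j (ch N false).

(** Determinacy is built in: the opponent of [A] wins exactly where [A] does not. *)
Definition wins (P : bool) N : Prop := W n N = eqb P A.

Lemma E_le i i' N : i <= i' -> E i N = true -> E i' N = true.
Proof. induction 1; auto. Qed.

Lemma level_spec N : level N <= n /\ (forall i, i < level N -> E i N = false) /\
  (forall i, level N <= i -> i < n -> E i N = true).
Proof.
  unfold level. destruct (bleast_spec n (fun j => E j N)) as (H1 & H2 & H3). repeat split; auto.
  intros i Hi Hn. destruct H3 as [H3|H3]; [|lia]. now apply (E_le _ i) in H3.
Qed.

(** By [W_E] each step from [j] up to [n] negates both sides of the equation. *)
Lemma wins_level P N j : j <= n -> (forall i, j <= i -> i < n -> E i N = true) ->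
  wins P N <-> W j N = eqb P (D j).
Proof.
  intros Hj HE. unfold wins. rewrite <- (dplayer_n n A) at 1. fold D.
  enough (H : forall d, j + d <= n -> W (j + d) N = eqb P (D (j + d)) <-> W j N = eqb P (D j)).
  { specialize (H (n - j)). replace (j + (n - j)) with n in H by lia. auto. }
  induction d; intros Hd; [now rewrite Nat.add_0_r|].
  rewrite <- IHd by lia. rewrite Nat.add_succ_r. rewrite W_E by (try apply HE; lia).
  unfold D. rewrite dplayer_S. destruct (W (j + d) N), P, (dplayer n A (j + d)); simpl; intuition congruence.
Qed.

Lemma wins_step_other P N b : wins P N -> own N <> P -> wins P (ch N b).
Proof.
  unfold wins. intros H Ho. assert (HD : D n = A) by apply dplayer_n.
  destruct (eqb P A) eqn:EP.
  - apply eqb_prop in EP. rewrite EP, <- HD in Ho. now apply (W_step n).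
  - apply eqb_false_iff in EP. apply (notW_step n); auto. rewrite HD.
    now apply bool_neq_trans with P.
Qed.

Lemma wins_step P N : wins P N -> own N = P -> wins P (ch N (move N)).
Proof.
  intros H Ho. destruct (level_spec N) as (H1 & H2 & H3).
  apply (wins_level P N (level N)) in H; auto.
  apply (wins_level P (ch N (move N)) (level N)); auto.
  unfold move. rewrite Ho. set (j := level N) in *. destruct (eqb P (D j)) eqn:EP.
  - destruct j as [|j]; [now rewrite W_0 in H|]. simpl pred.
    destruct (leastCert_spec j N) as (C1 & C2 & _); auto.
    assert (C3 := proj1 (cert_iff _ _) C2 N C1). unfold certStep in C3.
    assert (HT : target j N = false) by (unfold target; rewrite H2; auto).
    rewrite HT, Ho, EP in C3. simpl in C3.
    apply W_S; auto. exists (leastCert j N). split; auto.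
    destruct (Nat.testbit (leastCert j N) (ch N false)) eqn:E0; auto.
  - destruct (W j (ch N false)) eqn:E0; auto.
    apply (notW_step j N) in H; auto. destruct H as [_ H].
    destruct H as [[] Hb]; auto; [|congruence]. rewrite Ho. now apply eqb_false_iff.
Qed.

Lemma nonincreasing_stable (f : nat -> nat) m0 : (forall m, m0 <= m -> f (S m) <= f m) ->
  exists m1, m0 <= m1 /\ forall m, m1 <= m -> f m = f m1.
Proof.
  remember (f m0) as v eqn:Hv. revert m0 Hv. induction v as [v IH] using lt_wf_ind.
  intros m0 Hv Hf. destruct (classic (exists m, m0 <= m /\ f m < v)) as [(m & Hm & Hlt)|Hn].
  - destruct (IH (f m) Hlt m eq_refl) as (m1 & H1 & H2); [intros; apply Hf; lia|].
    exists m1. split; [lia|auto].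
  - exists m0. split; auto. intros m Hm.
    assert (H : ~ f m < v) by (intros H; apply Hn; eauto).
    enough (f m <= f m0) by lia. clear H. induction Hm; auto. specialize (Hf m Hm). lia.
Qed.

(** The level along the play settles at some [beta]. If [P] were [D beta], it would keep following
    certificates for a target that is never met, which is impossible. So [P] is the opponent of
    [D beta], the player favoured by the parity of [beta]. *)
Lemma wins_play P (y : nat -> nat) (b : nat -> bool) m0 :
  (forall m, y (S m) = ch (y m) (b m)) ->
  (forall m, m0 <= m -> own (y m) = P -> b m = move (y m)) ->
  wins P (y m0) ->
  exists beta, beta <= n /\ P <> D beta /\ (beta < n -> exists m, E beta (y m) = true) /\
    forall gamma, gamma < beta -> forall m, E gamma (y m) = false.
Proof.
  intros Hy Hb Hw.
  assert (Hwm : forall m, m0 <= m -> wins P (y m)).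
  { induction 1 as [|m Hm IH]; auto. rewrite Hy. destruct (bool_dec (own (y m)) P) as [Ho|Ho].
    - rewrite Hb by auto. now apply wins_step.
    - now apply wins_step_other. }
  assert (HE : forall i m m', m <= m' -> E i (y m) = true -> E i (y m') = true).
  { induction 1; auto. intros. rewrite Hy. auto. }
  destruct (nonincreasing_stable (fun m => level (y m)) m0) as (m1 & Hm1 & Hlev).
  { intros m _. destruct (level_spec (y m)) as (L1 & L2 & L3), (level_spec (y (S m))) as (L4 & L5 & L6).
    destruct (le_lt_dec (level (y (S m))) (level (y m))); auto. exfalso.
    specialize (L5 (level (y m)) ltac:(auto)). rewrite Hy, E_child in L5; [discriminate|]. apply L3; lia. }
  set (beta := level (y m1)) in *. destruct (level_spec (y m1)) as (L1 & L2 & L3). fold beta in L1, L2, L3.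
  assert (HnE : forall gamma, gamma < beta -> forall m, E gamma (y m) = false).
  { intros gamma Hg m. apply not_true_iff_false. intros H. apply (HE gamma m (max m m1)) in H; [|lia].
    destruct (level_spec (y (max m m1))) as (_ & L5 & _). rewrite L5 in H; [discriminate|].
    now rewrite Hlev by lia. }
  exists beta. repeat split; auto; [|intros; exists m1; auto].
  intros HP.
  assert (HW : forall m, m1 <= m -> W beta (y m) = true).
  { intros m Hm. destruct (level_spec (y m)) as (L4 & _ & L6). rewrite Hlev in L4, L6 by auto.
    apply (wins_level P (y m) beta) in L6; auto. rewrite <- HP, eqb_reflx in L6. apply L6, Hwm. lia. }
  destruct beta as [|j] eqn:Ebeta; [specialize (HW m1 (le_n _)); now rewrite W_0 in HW|].
  (* A certificate for a position outside the target also contains the next position, because the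
     owner follows it and the other player cannot leave it. *)
  assert (Hc : forall m, m1 <= m -> leastCert j (y (S m)) <= leastCert j (y m)).
  { intros m Hm. destruct (leastCert_spec j (y m)) as (C1 & C2 & _); auto.
    destruct (leastCert_spec j (y (S m))) as (_ & _ & C3); auto.
    apply C3; auto. assert (C4 := proj1 (cert_iff _ _) C2 _ C1). unfold certStep in C4.
    assert (HT : target j (y m) = false) by (unfold target; rewrite HnE; auto).
    rewrite HT in C4. simpl in C4. rewrite Hy. destruct (eqb (own (y m)) (D (S j))) eqn:Eo.
    - apply eqb_prop in Eo. rewrite Hb by (try congruence; lia). unfold move.
      rewrite Hlev, Eo, eqb_reflx by auto. simpl pred.
      destruct (Nat.testbit (leastCert j (y m)) (ch (y m) false)) eqn:E0; auto.
    - apply andb_prop in C4. destruct (b m); apply C4. }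
  assert (Hc' : forall m, m1 <= m -> leastCert j (y m) <= leastCert j (y m1)).
  { induction 1; auto. specialize (Hc m H). lia. }
  assert (Hge : forall m, m <= y m).
  { induction m; [lia|]. rewrite Hy. pose proof (ch_gt (y m) (b m)). lia. }
  (* At time [M] the number of the position is at least the bound on the certificate, yet it must be
     one of its bits. *)
  set (M := max m1 (leastCert j (y m1))).
  destruct (leastCert_spec j (y M)) as (C1 & _); [auto|apply HW; lia|].
  apply testbit_lt in C1. specialize (Hc' M ltac:(lia)). specialize (Hge M). lia.
Qed.
End Levels.

(** * Computing the winning regions with iterated limits *)

Fixpoint bsum (N : nat) (f : nat -> nat) : nat :=
  match N with 0 => 0 | S n => bsum n f + f n end.

Definition parent (N : nat) := Nat.div2 (pred N).
Definition ancestor (N t : nat) := nat_rect (fun _ => nat) N (fun _ M => parent M) t.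

Lemma testbit_div2 C M : Nat.testbit C M = negb (Nat.even (nat_rect (fun _ => nat) C (fun _ r => Nat.div2 r) M)).
Proof.
  revert C. induction M; intros C; simpl.
  - symmetry. apply Nat.negb_even.
  - rewrite IHM. do 2 f_equal. clear. induction M; simpl; congruence.
Qed.

Section RC_more.
Context {X : Type}.
Implicit Types (o : X -> baire).

Lemma RC_bsum k o N F : RC k o N -> RC (S k) o (fun x e => F x (nth 0 e 0) (tl e)) ->
  RC k o (fun x e => bsum (N x e) (fun n => F x n e)).
Proof.
  intros HN HF. eapply RC_ext; [|apply (RC_prim k o (fun _ _ => 0) (fun x n r e => r + F x n e) N)].
  - intros. cbn beta. induction (N x e); simpl; auto.
  - rc.
  - apply RC_add; [rc|].
    eapply RC_ext; [|apply (RC_comp (S k) (S (S k)) o _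
        ((fun _ e => nth 0 e 0) :: map (fun i _ e => nth (2 + i) e 0) (seq 0 k)) HF)].
    * intros x [|? [|? e]] He; try discriminate. cbn [map nth tl]. f_equal.
      rewrite map_map. injection He as He. simpl. rewrite <- He. apply map_nth_seq.
    * simpl. now rewrite length_map, length_seq.
    * constructor; [rc|]. apply Forall_map, Forall_forall. intros. rc.
  - exact HN.
Qed.

Lemma RCb_weaken k o P : RCb k o P -> RCb (S k) o (fun x e => P x (tl e)).
Proof. exact (RC_weaken k o _). Qed.

Lemma RC_b2n k o P : RCb k o P -> RC k o (fun x e => Nat.b2n (P x e)).
Proof. auto. Qed.

Lemma RC_pow2 k o a : RC k o a -> RC k o (fun x e => 2 ^ a x e).
Proof.
  intros Ha. eapply RC_ext; [|apply (RC_prim k o (fun _ _ => 1) (fun _ _ r _ => r + r) a)].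
  - intros x e _. cbn beta. induction (a x e); simpl; auto. rewrite IHn. lia.
  - rc.
  - rc.
  - exact Ha.
Qed.

Lemma RC_ancestor k o a b : RC k o a -> RC k o b -> RC k o (fun x e => ancestor (a x e) (b x e)).
Proof.
  intros Ha Hb. apply (RC_prim k o a (fun _ _ r _ => parent r) b); auto.
  apply RC_div2. rc.
Qed.

Lemma RCb_testbit k o a b : RC k o a -> RC k o b -> RCb k o (fun x e => Nat.testbit (a x e) (b x e)).
Proof.
  intros Ha Hb. eapply RCb_ext; [intros; symmetry; apply testbit_div2|].
  apply RCb_negb, RCb_even, (RC_prim k o a (fun _ _ r _ => Nat.div2 r) b); auto.
  apply RC_div2. rc.
Qed.

Lemma RCb_eqbool k o P Q : RCb k o P -> RCb k o Q -> RCb k o (fun x e => Bool.eqb (P x e) (Q x e)).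
Proof.
  intros HP HQ. apply RCb_ext with (fun x e => if P x e then Q x e else negb (Q x e)).
  - intros. destruct (P x e), (Q x e); reflexivity.
  - rc.
Qed.

Lemma RC_ch k o a P : RC k o a -> RCb k o P -> RC k o (fun x e => ch (a x e) (P x e)).
Proof. intros Ha HP. unfold ch. apply RC_add; [rc|exact HP]. Qed.

Lemma RCb_dplayer k o n A j : RCb k o A -> RC k o j ->
  RCb k o (fun x e => dplayer n (A x e) (j x e)).
Proof.
  intros HA Hj. unfold dplayer. apply RCb_if; [|rc|rc]. apply RCb_even. rc.
Qed.
End RC_more.

#[global] Hint Resolve RC_weaken RCb_weaken RC_bsum RC_b2n RC_pow2 RC_ancestor RC_div2 RCb_even RCb_testbit RCb_eqbool
  RC_ch RCb_dplayer : rc.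

(* The sequence [q] holds a name of a game in its row [0], and in row [j + 1] the
   winning regions of level [j] for all thresholds [r]. *)
Definition gdata (q : baire) y := q (pair 0 y).
Definition outcomes q := gdata q (pair 0 0).
Definition gown q N : bool := gdata q (pair 1 N) =? 1.
Definition gpref q a b : bool := gdata q (pair 2 (pair a b)) =? 1.
Definition grank q a := bsum (outcomes q) (fun b => Nat.b2n (gpref q b a)).
Definition gmask q r := bsum (outcomes q) (fun a => if r <=? grank q a then 2 ^ a else 0).
Definition gname q r m := gdata q (pair (4 + pair 1 (gmask q r)) m).
Definition gA q r : bool := gname q r 0 =? 0.
(** The number [N] also bounds the stage [j] of the enumeration, which makes this decidable. A word
    listed late is noticed only at later positions, but numbers of positions grow along every
    play. *)
Definition gE q r i N : bool :=
  bex (S i) (fun i' => bex (S N) (fun j => bex (S N) (fun t =>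
    gname q r (1 + pair i' j) =? S (ancestor N t)))).
Definition gW (q : baire) r j N : bool := q (pair (S j) (pair r N)) =? 1.
Definition gcert n q r j C := cert n (gown q) (gA q r) (gE q r) (gW q r) j C.

Notation RCi k F := (RC k (fun q : baire => q) F).
Notation RCbi k F := (RCb k (fun q : baire => q) F).

Lemma RC_gdata k a : RCi k a -> RCi k (fun q e => gdata q (a q e)).
Proof. intros Ha. apply (RC_oracle k (fun q : baire => q)). rc. Qed.
#[global] Hint Resolve RC_gdata : rc.

Lemma RC_outcomes k : RCi k (fun q e => outcomes q).
Proof. unfold outcomes. rc. Qed.
#[global] Hint Resolve RC_outcomes : rc.

Lemma RCb_gown k a : RCi k a -> RCbi k (fun q e => gown q (a q e)).
Proof. intros. unfold gown. rc. Qed.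

Lemma RCb_gpref k a b : RCi k a -> RCi k b -> RCbi k (fun q e => gpref q (a q e) (b q e)).
Proof. intros. unfold gpref. rc. Qed.
#[global] Hint Resolve RCb_gown RCb_gpref : rc.

Lemma RC_grank k a : RCi k a -> RCi k (fun q e => grank q (a q e)).
Proof. apply (RC_app1 k _ grank). unfold grank. rc. Qed.
#[global] Hint Resolve RC_grank : rc.

Lemma RC_gmask k a : RCi k a -> RCi k (fun q e => gmask q (a q e)).
Proof. apply (RC_app1 k _ gmask). unfold gmask. rc. Qed.
#[global] Hint Resolve RC_gmask : rc.

Lemma RC_gname k a b : RCi k a -> RCi k b -> RCi k (fun q e => gname q (a q e) (b q e)).
Proof. intros. unfold gname. rc. Qed.
#[global] Hint Resolve RC_gname : rc.

Lemma RCb_gA k a : RCi k a -> RCbi k (fun q e => gA q (a q e)).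
Proof. intros. unfold gA. rc. Qed.

Lemma RCb_gE k a b c : RCi k a -> RCi k b -> RCi k c ->
  RCbi k (fun q e => gE q (a q e) (b q e) (c q e)).
Proof.
  apply (RC_app3 k _ (fun q r i N => Nat.b2n (gE q r i N))).
  unfold gE. apply RC_b2n. rc.
Qed.

Lemma RCb_gW k a b c : RCi k a -> RCi k b -> RCi k c ->
  RCbi k (fun q e => gW q (a q e) (b q e) (c q e)).
Proof.
  intros. unfold gW. apply RCb_eqb; [|rc]. apply (RC_oracle k (fun q : baire => q)). rc.
Qed.
#[global] Hint Resolve RCb_gA RCb_gE RCb_gW : rc.

Lemma RCb_gcert n k a b c : RCi k a -> RCi k b -> RCi k c ->
  RCbi k (fun q e => gcert n q (a q e) (b q e) (c q e)).
Proof.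
  apply (RC_app3 k _ (fun q r j C => Nat.b2n (gcert n q r j C))).
  unfold gcert, cert, certStep, target. apply RC_b2n. rc.
Qed.
#[global] Hint Resolve RCb_gcert : rc.

Definition nextRow n j (q : baire) : baire := fun y =>
  if pfst y =? S (S j) then
    if excluded_middle_informative (exists C, Nat.testbit C (psnd (psnd y)) = true /\
         gcert n q (pfst (psnd y)) j C = true) then 1 else 0
  else q y.

Definition nextRowApprox n j (q : baire) : baire := fun m =>
  let y := pfst m in
  if pfst y =? S (S j) then
    Nat.b2n (bex (psnd m) (fun C => Nat.testbit C (psnd (psnd y)) && gcert n q (pfst (psnd y)) j C))
  else q y.

Lemma RCS_nextRowApprox n j : RCS (fun q : baire => q) (nextRowApprox n j).
Proof.
  unfold RCS, nextRowApprox. apply RC_if; [rc| |].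
  - apply RC_b2n. rc.
  - apply (RC_oracle 1 (fun q : baire => q)). rc.
Qed.

(** A search for a certificate up to a growing bound changes its answer at most once, so one limit
    decides existence. *)
Lemma nextRow_lim n j q : LimP (nextRowApprox n j q) (nextRow n j q).
Proof.
  intros y. unfold nextRowApprox, nextRow.
  destruct excluded_middle_informative as [(C & H1 & H2)|H].
  - exists (S C). intros i Hi. rewrite pfst_pair, psnd_pair. destruct (_ =? _); auto.
    replace (bex _ _) with true; auto. symmetry. apply bex_spec. exists C. split; [lia|].
    now rewrite H1, H2.
  - exists 0. intros i _. rewrite pfst_pair, psnd_pair. destruct (_ =? _); auto.
    replace (bex _ _) with false; auto. symmetry. apply not_true_iff_false. intros Hb.
    apply bex_spec in Hb. destruct Hb as (C & _ & HC). apply andb_prop in HC. eauto.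
Qed.

(** All earlier rows are copied through each limit, since the moves consult the winning regions of
    every level. *)
Fixpoint table (n j : nat) (p : baire) : baire :=
  match j with
  | 0 => fun y => if pfst y =? 0 then p (psnd y) else 0
  | S j => nextRow n j (table n j p)
  end.

Lemma LimC_table n j : LimC j (fun p : baire => p) (table n j).
Proof.
  induction j.
  - exists (table n 0). split; [|reflexivity]. unfold RCS, table. apply RC_if; [rc| |rc].
    apply (RC_oracle 1 (fun q : baire => q)). rc.
  - apply (LimC_lim j _ _ (fun p => nextRowApprox n j (table n j p)) _ IHj).
    + eapply RCS_trans; [eapply RCS_snd, RCS_refl|].
      apply (RCS_map (table n j) _ _ (RCS_nextRowApprox n j)).
    + intros p. apply nextRow_lim.
Qed.

Lemma table_data n j p y : gdata (table n j p) y = p y.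
Proof.
  unfold gdata. induction j.
  - simpl. now rewrite pfst_pair, psnd_pair.
  - simpl. unfold nextRow. rewrite pfst_pair. simpl. exact IHj.
Qed.

Lemma table_row n i j p r N : i <= j -> gW (table n j p) r i N = gW (table n i p) r i N.
Proof.
  induction 1; auto. rewrite <- IHle. simpl. unfold gW, nextRow at 1. rewrite pfst_pair.
  destruct (Nat.eqb_spec (S i) (S (S m))); [lia|]. reflexivity.
Qed.

Lemma gdata_ext q q' : (forall y, gdata q y = gdata q' y) -> forall r,
  gown q = gown q' /\ gA q r = gA q' r /\ gE q r = gE q' r.
Proof.
  intros H r. assert (E : gdata q = gdata q') by (apply functional_extensionality; auto).
  unfold gown, gA, gE, gname, gmask, grank, gpref, outcomes. now rewrite E.
Qed.

Lemma table_W_0 n j p r N : gW (table n j p) r 0 N = false.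
Proof. rewrite table_row by lia. unfold gW. simpl. now rewrite pfst_pair. Qed.

Lemma table_W_S n p r j N : j < n -> gW (table n n p) r (S j) N = true <->
  exists C, Nat.testbit C N = true /\ gcert n (table n n p) r j C = true.
Proof.
  intros Hj. rewrite table_row by lia.
  assert (HC : forall C, gcert n (table n n p) r j C = gcert n (table n j p) r j C).
  { intros C. unfold gcert.
    destruct (gdata_ext (table n n p) (table n j p)) with (r := r) as (E1 & E2 & E3);
      [intros; now rewrite !table_data|].
    rewrite E1, E2, E3. unfold cert, certStep, target.
    f_equal. apply functional_extensionality. intros M. now rewrite table_row by lia. }
  unfold gW. simpl table. unfold nextRow. rewrite pfst_pair, Nat.eqb_refl, !psnd_pair, pfst_pair.
  destruct excluded_middle_informative as [H|H].
  - split; auto. intros _. destruct H as [C HH]. exists C. now rewrite HC.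
  - split; [discriminate|]. intros [C HH]. exfalso. apply H. exists C. now rewrite <- HC.
Qed.

(** * The equilibrium *)

(* Player 1 ([true]) wants thresholds as large as possible, player 2 as small as possible. *)
Definition threshold q (P : bool) t := if P then outcomes q - t else t.
Definition gwins n q P r N : bool := Bool.eqb (gW q r n N) (Bool.eqb P (gA q r)).
Definition best n q P N := bleast (outcomes q) (fun t => gwins n q P (threshold q P t) N).
Definition gmove n q r N : bool := move n (gown q) (gA q r) (gE q r) (gW q r) N.
Definition gstrategy n q N : bool :=
  gmove n q (threshold q (gown q N) (best n q (gown q N) N)) N.

Lemma RCb_gwins n k P a b : RCbi k P -> RCi k a -> RCi k b ->
  RCbi k (fun q e => gwins n q (P q e) (a q e) (b q e)).
Proof. intros. unfold gwins. rc. Qed.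

Lemma RC_threshold k P a : RCbi k P -> RCi k a -> RCi k (fun q e => threshold q (P q e) (a q e)).
Proof. intros. unfold threshold. rc. Qed.
#[global] Hint Resolve RCb_gwins RC_threshold : rc.

Lemma RC_best n k P a : RCbi k P -> RCi k a -> RCi k (fun q e => best n q (P q e) (a q e)).
Proof. intros. unfold best. rc. Qed.
#[global] Hint Resolve RC_best : rc.

(** The guard restricts the search to the levels [j < n], where [table_W_S] guarantees that a won
    position has a certificate. *)
Definition gcode n q r j N : nat :=
  if n <=? j then 0 else leastCert n (gown q) (gA q r) (gE q r) (gW q r) j N.

Lemma RC_gcode n : RC 3 (table n n)
  (fun p e => gcode n (table n n p) (nth 0 e 0) (nth 1 e 0) (nth 2 e 0)).
Proof.
  (* Where there is nothing to find, the condition holds at once and the search returns 0, the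
     default value of [least]. *)
  apply RC_mu with (F := fun p e => let q := table n n p in
    Nat.b2n (negb ((n <=? nth 2 e 0) || negb (gW q (nth 1 e 0) (S (nth 2 e 0)) (nth 3 e 0)) ||
      (Nat.testbit (nth 0 e 0) (nth 3 e 0) && gcert n q (nth 1 e 0) (nth 2 e 0) (nth 0 e 0))))).
  - apply (RC_map (table n n) 4 (fun q : baire => q) (fun q e =>
      Nat.b2n (negb ((n <=? nth 2 e 0) || negb (gW q (nth 1 e 0) (S (nth 2 e 0)) (nth 3 e 0)) ||
      (Nat.testbit (nth 0 e 0) (nth 3 e 0) && gcert n q (nth 1 e 0) (nth 2 e 0) (nth 0 e 0)))))).
    apply RC_b2n. rc.
  - intros p [|r [|j [|N [|]]]] He; try discriminate. cbn [nth]. clear He. unfold gcode.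
    destruct (Nat.leb_spec n j) as [Hj|Hj]; [split; [reflexivity|lia]|]. cbn [orb].
    set (q := table n n p).
    destruct (gW q r (S j) N) eqn:HW; cbn [orb negb].
    + destruct (leastCert_spec n (gown q) (gA q r) (gE q r) (gW q r)) with (j := j) (N := N) as (H1 & H2 & H3); auto.
      { intros j' N' Hj'. apply table_W_S, Hj'. }
      split.
      * unfold gcert. now rewrite H1, H2.
      * intros m Hm. destruct (Nat.testbit m N) eqn:E1; [|discriminate].
        destruct (gcert n q r j m) eqn:E2; [|discriminate]. specialize (H3 m E1 E2). lia.
    + split; [reflexivity|]. intros m Hm. unfold leastCert in Hm. rewrite least_none in Hm; [lia|].
      intros [C HC]. apply andb_prop in HC.
      enough (gW q r (S j) N = true) by congruence. apply table_W_S; eauto.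
Qed.

Lemma RCS_gstrategy n : 1 <= n ->
  RCS (table n n) (fun p N => Nat.b2n (gstrategy n (table n n p) N)).
Proof.
  intros Hn. unfold RCS, gstrategy.
  assert (Hm : RC 2 (table n n) (fun p e => Nat.b2n (gmove n (table n n p) (nth 0 e 0) (nth 1 e 0)))).
  { set (lev := fun q r N => level n (gE q r) N).
    assert (Hlev : RCi 2 (fun q e => lev q (nth 0 e 0) (nth 1 e 0))) by (unfold lev, level; rc).
    apply RCb_ext with (fun p e => let q := table n n p in let r := nth 0 e 0 in let N := nth 1 e 0 in
      if Bool.eqb (gown q N) (dplayer n (gA q r) (lev q r N))
      then negb (Nat.testbit (gcode n q r (pred (lev q r N)) N) (ch N false))
      else gW q r (lev q r N) (ch N false)).
    - intros p e _. unfold gmove, move, lev. cbv zeta. unfold gcode.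
      destruct (Nat.leb_spec n (pred (level n (gE (table n n p) (nth 0 e 0)) (nth 1 e 0)))) as [H|H]; auto.
      exfalso. unfold level in H.
      pose proof (proj1 (bleast_spec n (fun j => gE (table n n p) (nth 0 e 0) j (nth 1 e 0)))). lia.
    - cbv zeta. apply RCb_if.
      + apply (RC_map (table n n) 2 (fun q : baire => q) (fun q e => Nat.b2n (Bool.eqb (gown q (nth 1 e 0))
          (dplayer n (gA q (nth 0 e 0)) (lev q (nth 0 e 0) (nth 1 e 0)))))).
        apply RC_b2n. rc.
      + apply RCb_negb, RCb_testbit; [|rc].
        apply (RC_app3 2 _ (fun p r j N => gcode n (table n n p) r j N)); [apply RC_gcode|rc| |rc].
        apply (RC_map (table n n) 2 (fun q : baire => q) (fun q e => pred (lev q (nth 0 e 0) (nth 1 e 0)))). rc.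
      + apply (RC_map (table n n) 2 (fun q : baire => q) (fun q e => Nat.b2n
          (gW q (nth 0 e 0) (lev q (nth 0 e 0) (nth 1 e 0)) (ch (nth 1 e 0) false)))).
        apply RC_b2n. rc. }
  apply (RC_app2 1 _ (fun p r N => Nat.b2n (gmove n (table n n p) r N))); [exact Hm| |rc].
  apply (RC_map (table n n) 1 (fun q : baire => q) (fun q e =>
    threshold q (gown q (nth 0 e 0)) (best n q (gown q (nth 0 e 0)) (nth 0 e 0)))).
  rc.
Qed.

(** * Words and plays *)

Lemma of_succ_nat_ch N b :
  Pos.of_succ_nat (ch N b) = if b then xI (Pos.of_succ_nat N) else xO (Pos.of_succ_nat N).
Proof.
  apply Pos2Nat.inj. rewrite SuccNat2Pos.id_succ. unfold ch.
  destruct b; rewrite ?Pos2Nat.inj_xI, ?Pos2Nat.inj_xO, SuccNat2Pos.id_succ; simpl; lia.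
Qed.

Lemma wordOfNat_ch N b : wordOfNat (ch N b) = wordOfNat N ++ [b].
Proof. unfold wordOfNat. rewrite of_succ_nat_ch. destruct b; reflexivity. Qed.

Definition wcode (w : list bool) : nat := fold_left ch w 0.

Lemma wcode_snoc w b : wcode (w ++ [b]) = ch (wcode w) b.
Proof. unfold wcode. now rewrite fold_left_app. Qed.

Lemma wordOfNat_wcode w : wordOfNat (wcode w) = w.
Proof.
  induction w as [|b w IH] using rev_ind; [reflexivity|].
  now rewrite wcode_snoc, wordOfNat_ch, IH.
Qed.

Lemma nat_ch N : N = 0 \/ exists M b, M < N /\ N = ch M b.
Proof.
  destruct N as [|N]; auto. right. exists (Nat.div2 N), (Nat.odd N).
  pose proof (Nat.div2_odd N). unfold ch. lia.
Qed.

Lemma wcode_wordOfNat N : wcode (wordOfNat N) = N.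
Proof.
  induction N as [N IH] using lt_wf_ind. destruct (nat_ch N) as [->|(M & b & Hlt & ->)]; [reflexivity|].
  now rewrite wordOfNat_ch, wcode_snoc, IH.
Qed.

Lemma prefix_S {A} (x : nat -> A) m : prefix x (S m) = prefix x m ++ [x m].
Proof. unfold prefix. now rewrite seq_S, map_app. Qed.

Lemma length_prefix {A} (x : nat -> A) m : length (prefix x m) = m.
Proof. unfold prefix. now rewrite length_map, length_seq. Qed.

Lemma nth_prefix_bool (x : cantor) m i : i < m -> nth i (prefix x m) false = x i.
Proof.
  intros H. unfold prefix. rewrite nth_indep with (d' := x 0) by now rewrite length_map, length_seq.
  rewrite map_nth, seq_nth; auto.
Qed.

Definition position (x : cantor) m := wcode (prefix x m).

Lemma position_S x m : position x (S m) = ch (position x m) (x m).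
Proof. unfold position. now rewrite prefix_S, wcode_snoc. Qed.

Lemma wordOfNat_position x m : wordOfNat (position x m) = prefix x m.
Proof. apply wordOfNat_wcode. Qed.

Lemma isPrefix_iff w x : isPrefix w x <-> w = prefix x (length w).
Proof.
  split.
  - intros H. apply nth_ext with false false; [now rewrite length_prefix|].
    intros i Hi. rewrite nth_prefix_bool by auto. auto.
  - intros H i Hi. rewrite H at 1. now apply nth_prefix_bool.
Qed.

Lemma length_run s lam m : length (run s lam m) = m.
Proof. induction m; auto. simpl. rewrite length_app, IHm. simpl. lia. Qed.

Lemma prefix_play s lam m : prefix (play s lam) m = run s lam m.
Proof.
  induction m; [reflexivity|]. rewrite prefix_S, IHm. simpl. f_equal. f_equal.
  unfold play. simpl. rewrite app_nth2; rewrite length_run; [|lia]. now rewrite Nat.sub_diag.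
Qed.

Lemma play_eq s lam m : play s lam m =
  if m <? length lam then nth m lam false else s (prefix (play s lam) m).
Proof.
  rewrite prefix_play. unfold play. simpl. rewrite app_nth2; rewrite length_run; [|lia].
  now rewrite Nat.sub_diag.
Qed.

Definition extends (x : cantor) (lam : list bool) := prefix x (length lam) = lam.

Lemma extends_play s lam : extends (play s lam) lam.
Proof.
  symmetry. apply isPrefix_iff. intros i Hi. rewrite play_eq.
  destruct (Nat.ltb_spec i (length lam)); [auto|lia].
Qed.

Lemma play_unique s lam x : extends x lam ->
  (forall m, length lam <= m -> x m = s (prefix x m)) -> play s lam = x.
Proof.
  intros Hx Hs. enough (H : forall m, prefix (play s lam) m = prefix x m).
  { apply functional_extensionality. intros m. rewrite <- (nth_prefix_bool x (S m) m) by lia.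
    rewrite <- H. symmetry. apply nth_prefix_bool. lia. }
  induction m; [reflexivity|]. rewrite !prefix_S, IHm. do 2 f_equal. rewrite play_eq.
  destruct (Nat.ltb_spec m (length lam)) as [Hm|Hm].
  - rewrite <- Hx. now apply nth_prefix_bool.
  - rewrite IHm. symmetry. auto.
Qed.

(** A deviation matters only through the play it produces, so plays can replace deviating
    profiles. *)
Lemma NashAt_iff G s lam : NashAt G s lam <->
  forall i x, (i = 1 \/ i = 2) -> extends x lam ->
    (forall m, length lam <= m -> g_turn G (prefix x m) <> i -> x m = s (prefix x m)) ->
    g_pref G i (g_val G (play s lam)) (g_val G x) = false.
Proof.
  split.
  - intros H i x Hi Hx Hs.
    (* The deviation moves along [x] as long as the history lies on [x], and like [s] elsewhere. *)
    set (s' := fun w => if excluded_middle_informative (length lam <= length w /\ w = prefix x (length w))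
                        then x (length w) else s w).
    rewrite <- (play_unique s' lam x Hx).
    + apply H; auto. intros w Hw. unfold s'. destruct excluded_middle_informative as [[H1 H2]|]; auto.
      rewrite H2 at 2. apply Hs; auto. now rewrite <- H2.
    + intros m Hm. unfold s'. rewrite length_prefix.
      destruct excluded_middle_informative; tauto.
  - intros H i s' Hi Hs. apply H; auto; [apply extends_play|].
    intros m Hm Ht. rewrite <- Hs by auto. rewrite play_eq.
    destruct (Nat.ltb_spec m (length lam)); [lia|auto].
Qed.

Lemma parent_ch N b : parent (ch N b) = N.
Proof.
  unfold parent, ch. destruct b; simpl Nat.b2n.
  - replace (pred (2 * N + 1 + 1)) with (S (2 * N)) by lia. apply Nat.div2_succ_double.
  - replace (pred (2 * N + 1 + 0)) with (2 * N) by lia. apply Nat.div2_double.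
Qed.

Lemma ancestor_S N t : ancestor N (S t) = ancestor (parent N) t.
Proof. unfold ancestor. induction t; simpl in *; congruence. Qed.

Lemma ancestor_position x m t : t <= m -> ancestor (position x m) t = position x (m - t).
Proof.
  revert m. induction t; intros m Ht.
  - now rewrite Nat.sub_0_r.
  - destruct m; [lia|]. rewrite ancestor_S, position_S, parent_ch, IHt by lia. reflexivity.
Qed.

Lemma position_ge x m : m <= position x m.
Proof.
  induction m; [lia|]. rewrite position_S. pose proof (ch_gt (position x m) (x m)). lia.
Qed.

Lemma InD_min n U beta x : beta <= n -> (beta < n -> U beta x) ->
  (forall gamma, gamma < beta -> ~ U gamma x) ->
  InD n U x <-> Nat.odd beta <> Nat.odd n.
Proof.
  intros Hb HU HnU. split.
  - intros (b & Hb1 & Hb2 & Hb3 & Hb4). enough (b = beta) by congruence.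
    destruct (lt_eq_lt_dec b beta) as [[Hlt|]|Hlt]; auto; exfalso.
    + apply (HnU b Hlt), Hb2. lia.
    + apply (Hb3 beta Hlt), HU. lia.
  - intros H. exists beta. auto.
Qed.

(** * Correctness of the equilibrium *)

Lemma bsum_le N f g : (forall n, n < N -> f n <= g n) -> bsum N f <= bsum N g.
Proof.
  induction N; intros H; simpl; auto. pose proof (H N). specialize (IHN ltac:(auto)). lia.
Qed.

Lemma bsum_lt N f g a : (forall n, n < N -> f n <= g n) -> a < N -> f a < g a -> bsum N f < bsum N g.
Proof.
  induction N; intros H Ha Hlt; [lia|]. simpl. pose proof (H N ltac:(lia)).
  destruct (Nat.eq_dec a N) as [->|Hn].
  - pose proof (bsum_le N f g ltac:(auto)). lia.
  - specialize (IHN ltac:(auto) ltac:(lia) Hlt). lia.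
Qed.

Lemma bsum_ones N : bsum N (fun _ => 1) = N.
Proof. induction N; simpl; lia. Qed.

Lemma bsum_mask (P : nat -> bool) N : let c := bsum N (fun a => if P a then 2 ^ a else 0) in
  c < 2 ^ N /\ forall a, a < N -> Nat.testbit c a = P a.
Proof.
  induction N as [|N [IH1 IH2]]; simpl bsum; [split; [simpl; lia|lia]|].
  set (c := bsum N _) in *. clearbody c. split.
  - rewrite Nat.pow_succ_r'. destruct (P N); lia.
  - intros a Ha. destruct (Nat.eq_dec a N) as [->|Hn].
    + destruct (P N) eqn:E.
      * rewrite Nat.testbit_true. replace (c + 2 ^ N) with (c + 1 * 2 ^ N) by lia.
        rewrite Nat.div_add by (apply Nat.pow_nonzero; lia). now rewrite Nat.div_small by auto.
      * rewrite Nat.add_0_r, Nat.testbit_false. now rewrite Nat.div_small by auto.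
    + rewrite <- (IH2 a) by lia. destruct (P N); [|now rewrite Nat.add_0_r].
      rewrite !Nat.testbit_eqb. f_equal.
      replace (2 ^ N) with (2 ^ (N - a - 1) * 2 * 2 ^ a).
      * rewrite Nat.div_add by (apply Nat.pow_nonzero; lia). apply Nat.Div0.mod_add.
      * rewrite <- Nat.mul_assoc, <- Nat.pow_succ_r', <- Nat.pow_add_r. f_equal. lia.
Qed.

Section Equilibrium.
Variables (n : nat) (p : baire) (G : game).
Hypothesis (Hn : 1 <= n) (Hwf : game_wf G) (Hname : GameName n p G).
Let q := table n n p.
Let k := g_k G.

Lemma q_data y : gdata q y = p y.
Proof. apply table_data. Qed.

Lemma q_outcomes : outcomes q = k.
Proof. unfold outcomes. rewrite q_data. apply Hname. Qed.

Lemma q_own w : gown q (wcode w) = (g_turn G w =? 1).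
Proof.
  unfold gown. rewrite q_data. destruct Hname as (_ & H & _).
  now rewrite H, wordOfNat_wcode.
Qed.

Lemma q_own_player w P : gown q (wcode w) = P <-> g_turn G w = if P then 1 else 2.
Proof.
  rewrite q_own. destruct (proj1 Hwf w) as [-> | ->], P; simpl; split; congruence.
Qed.

Lemma q_pref a b : a < k -> b < k -> gpref q a b = g_pref G 1 a b.
Proof.
  intros Ha Hb. unfold gpref. rewrite q_data. destruct Hname as (_ & _ & H & _).
  change 2 with (1 + 1). rewrite H by auto. now destruct (g_pref G 1 a b).
Qed.

Lemma grank_lt a b : a < k -> b < k -> g_pref G 1 a b = true -> grank q a < grank q b.
Proof.
  intros Ha Hb Hab. unfold grank. rewrite q_outcomes.
  destruct (proj1 (proj2 (proj2 Hwf))) as (Hirr & Htr & _).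
  apply bsum_lt with a; auto.
  - intros c Hc. rewrite !q_pref by auto. destruct (g_pref G 1 c a) eqn:E; [|simpl; lia].
    now rewrite (Htr c a b).
  - rewrite !q_pref, Hab by auto. rewrite Hirr by auto. simpl. lia.
Qed.

Lemma grank_bound a : a < k -> grank q a < k.
Proof.
  intros Ha. unfold grank. rewrite q_outcomes. rewrite <- (bsum_ones k) at 2.
  destruct (proj1 (proj2 (proj2 Hwf))) as (Hirr & _).
  apply bsum_lt with a; auto.
  - intros c _. destruct (gpref q c a); simpl; lia.
  - rewrite q_pref, Hirr by auto. simpl. lia.
Qed.

Definition reaches r x := r <= grank q (g_val G x).

Lemma val_lt x : g_val G x < k.
Proof. apply Hwf. Qed.

Lemma inMask_gmask r x : inMask k (gmask q r) (g_val G x) <-> reaches r x.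
Proof.
  unfold inMask, reaches, gmask. rewrite q_outcomes.
  rewrite (proj2 (bsum_mask (fun a => r <=? grank q a) k) _ (val_lt x)), Nat.leb_le.
  pose proof (val_lt x). tauto.
Qed.

Lemma gname_spec r : GammaName n (gname q r) (reaches r).
Proof.
  assert (H : GammaName n (fun j => p (pair (4 + pair 1 (gmask q r)) j))
      (fun x => inMask (g_k G) (gmask q r) (g_val G x))).
  { assert (Hm := bsum_mask (fun a => r <=? grank q a) k). unfold gmask. rewrite q_outcomes.
    apply Hname; [auto|apply Hm|].
    intros a b Ha Hb HT Hab. rewrite (proj2 Hm) in HT |- * by auto.
    apply Nat.leb_le in HT. apply Nat.leb_le. pose proof (grank_lt a b Ha Hb Hab). lia. }
  replace (gname q r) with (fun j => p (pair (4 + pair 1 (gmask q r)) j)).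
  - unfold GammaName in *. destruct H as [[H1 H2]|[H1 H2]]; [left|right]; split; auto;
      intros x; rewrite <- H2; symmetry; apply inMask_gmask.
  - apply functional_extensionality. intros j. unfold gname. now rewrite q_data.
Qed.

Let U r i := OpenOf (fun j => gname q r (1 + pair i j)).

Lemma reaches_iff r x : reaches r x <-> if gA q r then InD n (U r) x else ~ InD n (U r) x.
Proof.
  unfold gA. destruct (gname_spec r) as [[H1 H2]|[H1 H2]]; rewrite H1; apply H2.
Qed.

Lemma gE_spec r i N : gE q r i N = true <->
  exists i' j t, i' <= i /\ j <= N /\ t <= N /\ gname q r (1 + pair i' j) = S (ancestor N t).
Proof.
  unfold gE. rewrite bex_spec. split.
  - intros (i' & Hi & H). apply bex_spec in H. destruct H as (j & Hj & H).
    apply bex_spec in H. destruct H as (t & Ht & H). apply Nat.eqb_eq in H.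
    exists i', j, t. repeat split; auto; lia.
  - intros (i' & j & t & Hi & Hj & Ht & H). exists i'. split; [lia|].
    apply bex_spec. exists j. split; [lia|]. apply bex_spec. exists t. split; [lia|].
    now apply Nat.eqb_eq.
Qed.

Lemma gE_mono r i N : gE q r i N = true -> gE q r (S i) N = true.
Proof.
  rewrite !gE_spec. intros (i' & j & t & Hi & H). exists i', j, t. split; [lia|auto].
Qed.

Lemma gE_child r i N b : gE q r i N = true -> gE q r i (ch N b) = true.
Proof.
  rewrite !gE_spec. intros (i' & j & t & Hi & Hj & Ht & H). exists i', j, (S t).
  rewrite ancestor_S, parent_ch. pose proof (ch_gt N b). repeat split; auto; lia.
Qed.

Lemma gE_open r i x : (exists m, gE q r i (position x m) = true) <-> exists i', i' <= i /\ U r i' x.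
Proof.
  split.
  - intros (m & H). apply gE_spec in H. destruct H as (i' & j & t & Hi & _ & _ & H).
    exists i'. split; auto. exists j, (ancestor (position x m) t). split; auto.
    apply isPrefix_iff. destruct (le_lt_dec t m) as [Ht|Ht].
    + rewrite ancestor_position, wordOfNat_position by auto. now rewrite length_prefix.
    + replace t with (m + (t - m)) by lia. generalize (t - m). intros d.
      assert (Hz : ancestor (position x m) (m + d) = 0).
      { induction d; [rewrite Nat.add_0_r, ancestor_position, Nat.sub_diag by auto; reflexivity|].
        rewrite Nat.add_succ_r. unfold ancestor in *. simpl. now rewrite IHd. }
      now rewrite Hz.
  - intros (i' & Hi & j & c & H1 & H2). apply isPrefix_iff in H2.
    set (l := length (wordOfNat c)) in *. exists (max l j). apply gE_spec.
    exists i', j, (max l j - l). pose proof (position_ge x (max l j)).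
    rewrite ancestor_position by lia. replace (max l j - (max l j - l)) with l by lia.
    unfold position at 3. rewrite <- H2, wcode_wordOfNat. repeat split; auto; lia.
Qed.

Definition goal (P : bool) r x := if P then reaches r x else ~ reaches r x.

Lemma gwins_iff P r N : gwins n q P r N = true <-> wins n (gA q r) (gW q r) P N.
Proof. unfold gwins, wins. apply eqb_true_iff. Qed.

Lemma gwins_negb P r N : gwins n q (negb P) r N = negb (gwins n q P r N).
Proof. unfold gwins. destruct (gW q r n N), P, (gA q r); reflexivity. Qed.

Lemma q_W_S r j N : j < n -> gW q r (S j) N = true <->
  exists C, Nat.testbit C N = true /\ cert n (gown q) (gA q r) (gE q r) (gW q r) j C = true.
Proof. apply table_W_S. Qed.

Lemma gwins_goal P r x m0 : gwins n q P r (position x m0) = true ->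
  (forall m, m0 <= m -> gown q (position x m) = P -> x m = gmove n q r (position x m)) ->
  goal P r x.
Proof.
  intros Hw Hx. apply gwins_iff in Hw.
  destruct (wins_play n (gown q) (gA q r) (gE q r) (gW q r) (gE_mono r) (gE_child r)
    (fun N => table_W_0 n n p r N) (q_W_S r) P (position x) x m0) as (beta & Hb & HP & HU & HnU); auto.
  { intros m. apply position_S. }
  assert (HU' : beta < n -> U r beta x).
  { intros Hlt. destruct (proj1 (gE_open r beta x) (HU Hlt)) as (i & Hi & Hix).
    destruct (Nat.eq_dec i beta) as [->|]; auto. exfalso.
    destruct (proj2 (gE_open r i x) (ex_intro _ i (conj (le_n i) Hix))) as [m Hm].
    rewrite HnU in Hm by lia. discriminate. }
  assert (HnU' : forall gamma, gamma < beta -> ~ U r gamma x).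
  { intros g Hg Hgx. destruct (proj2 (gE_open r g x) (ex_intro _ g (conj (le_n g) Hgx))) as [m Hm].
    rewrite HnU in Hm by lia. discriminate. }
  assert (HD := InD_min n (U r) beta x Hb HU' HnU').
  assert (HR := reaches_iff r x). rewrite <- !Nat.negb_even in HD.
  unfold goal. unfold dplayer in HP. rewrite Nat.even_add in HP.
  destruct P, (gA q r), (Nat.even n), (Nat.even beta); simpl in *; intuition congruence.
Qed.

Lemma gwins_step P r N b : gwins n q P r N = true ->
  (gown q N = P -> b = gmove n q r N) -> gwins n q P r (ch N b) = true.
Proof.
  rewrite !gwins_iff. intros Hw Hb. destruct (bool_dec (gown q N) P) as [Ho|Ho].
  - rewrite Hb by auto.
    exact (wins_step n (gown q) (gA q r) (gE q r) (gW q r) (gE_mono r) (gE_child r)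
      (fun N => table_W_0 n n p r N) (q_W_S r) P N Hw Ho).
  - exact (wins_step_other n (gown q) (gA q r) (gE q r) (gW q r) (gE_child r)
      (fun N => table_W_0 n n p r N) (q_W_S r) P N b Hw Ho).
Qed.

(** Used to refute a win for a goal that no outcome satisfies. *)
Lemma gwins_exists P r lam : gwins n q P r (wcode lam) = true -> exists x, goal P r x.
Proof.
  intros H. set (x := play (fun w => gmove n q r (wcode w)) lam). exists x.
  apply gwins_goal with (length lam).
  - unfold position, x. now rewrite extends_play.
  - intros m Hm _. unfold x at 1. rewrite play_eq.
    destruct (Nat.ltb_spec m (length lam)); [lia|]. reflexivity.
Qed.

Lemma best_spec P lam : let t := best n q P (wcode lam) in
  t <= k /\ gwins n q P (threshold q P t) (wcode lam) = true /\
  forall t', gwins n q P (threshold q P t') (wcode lam) = true -> t <= t'.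
Proof.
  intros t. unfold t, best. rewrite q_outcomes.
  destruct (bleast_spec k (fun t => gwins n q P (threshold q P t) (wcode lam))) as (H1 & H2 & H3).
  split; auto. split.
  (* The default [t = k] is always won: it asks player 1 for rank at least 0 and player 2 for rank
     below [k]. Otherwise the opponent would win an impossible goal. *)
  - destruct H3 as [H3|H3]; auto. rewrite H3. unfold threshold. rewrite q_outcomes.
    apply not_false_iff_true. intros HF.
    rewrite <- negb_true_iff, <- gwins_negb in HF. apply gwins_exists in HF. destruct HF as [x Hx].
    destruct P; simpl in Hx; unfold reaches in Hx.
    + lia.
    + pose proof (grank_bound _ (val_lt x)). lia.
  - intros t' Ht'. destruct (le_lt_dec (bleast k (fun t => gwins n q P (threshold q P t) (wcode lam))) t'); auto.
    apply H2 in l. congruence.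
Qed.

Let s : profile := fun w => gstrategy n q (wcode w).

(** If [P] follows [s], a threshold won once remains won, so the best one can only improve along the
    play. It becomes constant eventually; from then on [s] plays for one fixed threshold and
    [gwins_goal] applies. *)
Lemma guarantee P lam x : extends x lam ->
  (forall m, length lam <= m -> gown q (position x m) = P -> x m = s (prefix x m)) ->
  goal P (threshold q P (best n q P (wcode lam))) x.
Proof.
  intros Hx Hs. set (f := fun m => best n q P (position x m)).
  destruct (nonincreasing_stable f (length lam)) as (m1 & Hm1 & Hst).
  { intros m Hm. unfold f. destruct (best_spec P (prefix x (S m))) as (_ & _ & H). apply H.
    fold (position x (S m)). rewrite position_S. apply gwins_step; [apply best_spec|].
    intros Ho. rewrite Hs by auto. unfold s, gstrategy. fold (position x m). now rewrite Ho. }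
  assert (Hg : goal P (threshold q P (f m1)) x).
  { apply gwins_goal with m1; [apply best_spec|]. intros m Hm Ho. rewrite Hs by (auto; lia).
    unfold s, gstrategy. fold (position x m). rewrite Ho. fold (f m). now rewrite Hst. }
  assert (Hle : f m1 <= best n q P (wcode lam)).
  { replace (wcode lam) with (position x (length lam)) by (unfold position; now rewrite Hx).
    fold (f (length lam)). clear Hst Hg. induction Hm1 as [|m Hm IH]; auto.
    transitivity (f m); auto.
    unfold f. destruct (best_spec P (prefix x (S m))) as (_ & _ & H). apply H.
    fold (position x (S m)). rewrite position_S. apply gwins_step; [apply best_spec|].
    intros Ho. rewrite Hs by auto. unfold s, gstrategy. fold (position x m). now rewrite Ho. }
  unfold goal, reaches, threshold in *. destruct P; lia.
Qed.

Lemma strategy_IsSPE : IsSPE G s.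
Proof.
  intros lam. apply NashAt_iff. intros i x Hi Hx Hs.
  set (y := play s lam).
  assert (Hy : forall P, goal P (threshold q P (best n q P (wcode lam))) y).
  { intros P. apply guarantee; [apply extends_play|]. intros m Hm _. unfold y at 1. rewrite play_eq.
    destruct (Nat.ltb_spec m (length lam)); [lia|reflexivity]. }
  assert (Hy1 := Hy true). assert (Hy2 := Hy false). simpl in Hy1, Hy2. unfold reaches in Hy1, Hy2.
  set (t1 := best n q true (wcode lam)) in *. set (t2 := best n q false (wcode lam)) in *.
  (* By determinacy the two guarantees are adjacent: the play of [s] has rank exactly [k - t1], and
     a deviating player is still bounded by the guarantee of the other. *)
  assert (Ht : t2 <= S (k - t1)).
  { destruct (best_spec false lam) as (B1 & _ & B2). fold t2 in B1, B2. destruct t2 as [|t]; [lia|].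
    destruct (best_spec true lam) as (_ & _ & B3). fold t1 in B3.
    specialize (B3 (k - t)). unfold threshold in B3. rewrite q_outcomes in B3.
    replace (k - (k - t)) with t in B3 by lia.
    destruct (gwins n q true t (wcode lam)) eqn:E; [specialize (B3 eq_refl); lia|].
    change true with (negb false) in E. rewrite gwins_negb, negb_false_iff in E.
    specialize (B2 t E). lia. }
  unfold threshold in *. rewrite q_outcomes in *.
  assert (Hx' : forall P : bool, (if P then i = 2 else i = 1) -> goal P (threshold q P (best n q P (wcode lam))) x).
  { intros P HP. apply guarantee; auto. intros m Hm Ho. apply Hs; auto.
    apply q_own_player in Ho. rewrite Ho. destruct P; lia. }
  apply not_true_iff_false. intros Hpref. destruct Hi as [-> | ->].
  - specialize (Hx' false eq_refl). simpl in Hx'. unfold reaches in Hx'. fold t2 in Hx'.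
    apply grank_lt in Hpref; try apply val_lt. lia.
  - specialize (Hx' true eq_refl). simpl in Hx'. unfold reaches in Hx'. fold t1 in Hx'. rewrite q_outcomes in Hx'.
    destruct Hwf as (_ & _ & _ & H2). rewrite H2 in Hpref by apply val_lt.
    apply grank_lt in Hpref; try apply val_lt. lia.
Qed.
End Equilibrium.

Lemma SPEP_strategy n p G : 1 <= n -> game_wf G -> GameName n p G ->
  SPEP n p (fun N => Nat.b2n (gstrategy n (table n n p) N)).
Proof.
  intros Hn Hwf HG. exists G. split; [auto|split; [auto|]].
  exists (fun w => gstrategy n (table n n p) (wcode w)). split.
  - intros N. now rewrite wcode_wordOfNat.
  - now apply strategy_IsSPE.
Qed.

Lemma SPEP_WRed_LimIt n : 1 <= n -> WRed (SPEP n) (LimIt n).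
Proof.
  intros Hn. apply (LimC_WRed n (SPEP n)
    (fun x N => Nat.b2n (gstrategy n (table n n (proj1_sig x)) N))).
  - destruct (LimC_absorb n (fun p : baire => p) (table n n)
      (fun p N => Nat.b2n (gstrategy n (table n n p) N))) as (r & H1 & H2).
    + apply LimC_table.
    + eapply RCS_trans; [eapply RCS_snd, RCS_refl|now apply RCS_gstrategy].
    + exists (fun x => r (proj1_sig x)). split; [|auto].
      exact (RCS_map (fun x : {p | pdom (SPEP n) p} => proj1_sig x) _ _ H1).
  - intros [p Hp]. cbn [proj1_sig]. destruct Hp as [r (G & H1 & H2 & _)]. now apply SPEP_strategy with G.
Qed.

(** * A game deciding quantified statements *)

(* State of a partial play [0^z 1 b 0^m1 1 0^m2 1 ...]: the number [c] of ones, the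
   number [u] of zeros after the last one, the number [z], the current point [x] and
   lower bound [i] obtained from the numbers [m1, m2, ...] chosen so far, and the
   flag [l] of the plays with [b = 0]. *)
Definition mk c u z x i l := pair c (pair u (pair z (pair x (pair i l)))).
Definition sc s := pfst s.
Definition su s := pfst (psnd s).
Definition sz s := pfst (psnd (psnd s)).
Definition sx s := pfst (psnd (psnd (psnd s))).
Definition si s := pfst (psnd (psnd (psnd (psnd s)))).
Definition sl s := psnd (psnd (psnd (psnd (psnd s)))).

Lemma mkE c u z x i l : sc (mk c u z x i l) = c /\ su (mk c u z x i l) = u /\
  sz (mk c u z x i l) = z /\ sx (mk c u z x i l) = x /\ si (mk c u z x i l) = i /\
  sl (mk c u z x i l) = l.
Proof. unfold sc, su, sz, sx, si, sl, mk. now rewrite ?psnd_pair, ?pfst_pair. Qed.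

Ltac mks := repeat match goal with
  | |- context [mk ?c ?u ?z ?x ?i ?l] =>
    let H := fresh in let m := fresh "m" in
    pose proof (mkE c u z x i l) as H; set (m := mk c u z x i l) in *; clearbody m;
    destruct H as (? & ? & ? & ? & ? & ?)
  end.

Definition step s (b : bool) : nat :=
  if sl s =? 1 then s else
  if b then
    if sc s =? 0 then mk 1 0 (su s) (pfst (su s)) (pfst (psnd (su s))) 0
    else if sc s =? 1 then mk 2 0 (sz s) (sx s) (si s) 0
    else mk (S (sc s)) 0 (sz s) (pair (sx s) (si s + pfst (su s))) (psnd (su s)) 0
  else if sc s =? 1 then mk 1 (su s) (sz s) (sx s) (si s) 1
  else mk (sc s) (S (su s)) (sz s) (sx s) (si s) 0.

Definition state (w : list bool) : nat := fold_left step w (mk 0 0 0 0 0 0).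

Lemma state_snoc w b : state (w ++ [b]) = step (state w) b.
Proof. unfold state. now rewrite fold_left_app. Qed.

Definition turnOf s : nat := if (2 <=? sc s) && negb (Nat.even (sc s)) then 2 else 1.

(** Entering [U_0] favours player 1 iff [n] is odd. The test is turned accordingly, so that for
    every [n] a completed play is won by player 1 iff [p x <> v]. *)
Definition check n (p : baire) s : bool :=
  let e := p (sx s) =? psnd (psnd (sz s)) in if Nat.odd n then negb e else e.

(* The words enumerated in [U_beta] for the set of outcomes with mask [c]. The masks
   [4] = {2} and [6] = {1, 2} are named by difference sets, their complements [3] and
   [1] with the same open sets, and [0] and [7] with empty ones; [2] and [5] are upper
   sets for neither player. Adding the plays with [b = 0] to [U_(n-1)] turns a name
   for [4] into one for [6]. *)
Definition listed n (p : baire) c beta s : bool :=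
  negb (c =? 0) && negb (c =? 7) &&
  ((sl s =? 0) && (sc s =? n - beta + 2) && (negb (beta =? 0) || check n p s) ||
   ((c =? 6) || (c =? 1)) && (S beta =? n) && (sl s =? 1)).

Definition depth N := bleast N (fun t => ancestor N t =? 0).
(** The bits of the word are read off the ancestors of its number, since [ch N b] is even exactly
    for [b = true]. *)
Definition stateOf N := nat_rect (fun _ => nat) (mk 0 0 0 0 0 0)
  (fun t r => step r (Nat.even (ancestor N (depth N - S t)))) (depth N).

Lemma depth_position x m : depth (position x m) = m.
Proof.
  unfold depth, bleast. apply bmu_least.
  - apply position_ge.
  - rewrite ancestor_position, Nat.sub_diag by auto. reflexivity.
  - intros t Ht. rewrite ancestor_position by lia. pose proof (position_ge x (m - t)).
    destruct (Nat.eqb_spec (position x (m - t)) 0); [lia|discriminate].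
Qed.

Lemma even_ch N b : Nat.even (ch N b) = b.
Proof.
  unfold ch. rewrite !Nat.even_add, Nat.even_mul. destruct b; reflexivity.
Qed.

Lemma stateOf_position x m : stateOf (position x m) = state (prefix x m).
Proof.
  unfold stateOf. rewrite depth_position.
  enough (H : forall t, t <= m -> nat_rect (fun _ => nat) (mk 0 0 0 0 0 0)
     (fun t r => step r (Nat.even (ancestor (position x m) (m - S t)))) t = state (prefix x t)) by auto.
  induction t; intros Ht; [reflexivity|]. rewrite prefix_S, state_snoc, <- IHt by lia. simpl. f_equal.
  rewrite ancestor_position by lia. replace (m - (m - S t)) with (S t) by lia.
  rewrite position_S. apply even_ch.
Qed.

Lemma stateOf_word N : stateOf N = state (wordOfNat N).
Proof.
  set (w := wordOfNat N). set (x := fun i => nth i w false).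
  assert (Hw : w = prefix x (length w)) by (apply isPrefix_iff; intros i _; reflexivity).
  rewrite Hw, <- stateOf_position. f_equal. unfold position. rewrite <- Hw. symmetry. apply wcode_wordOfNat.
Qed.

(** Stage [j] of the enumeration of [U_beta] can only list the word number [j] itself. The name of
    an upper set depends on its mask alone, so the player is dropped by [psnd]. *)
Definition gameName n (p : baire) : baire := fun m =>
  let a := pfst m in let b := psnd m in
  if a =? 0 then 3
  else if a =? 1 then turnOf (stateOf b)
  else if a =? 2 then (if pfst b <? psnd b then 1 else 0)
  else if a =? 3 then (if psnd b <? pfst b then 1 else 0)
  else let c := psnd (a - 4) in
    if b =? 0 then (if (c =? 7) || (c =? 1) || (c =? 3) then 1 else 0)
    else let beta := pfst (pred b) in let j := psnd (pred b) in
      if listed n p c beta (stateOf j) then S j else 0.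

Lemma RC_mk k a b c d e f : RCi k a -> RCi k b -> RCi k c -> RCi k d -> RCi k e -> RCi k f ->
  RCi k (fun q v => mk (a q v) (b q v) (c q v) (d q v) (e q v) (f q v)).
Proof. intros. unfold mk. rc. Qed.
Lemma RC_sc k a : RCi k a -> RCi k (fun q v => sc (a q v)).
Proof. intros. unfold sc. rc. Qed.
Lemma RC_su k a : RCi k a -> RCi k (fun q v => su (a q v)).
Proof. intros. unfold su. rc. Qed.
Lemma RC_sz k a : RCi k a -> RCi k (fun q v => sz (a q v)).
Proof. intros. unfold sz. rc. Qed.
Lemma RC_sx k a : RCi k a -> RCi k (fun q v => sx (a q v)).
Proof. intros. unfold sx. rc. Qed.
Lemma RC_si k a : RCi k a -> RCi k (fun q v => si (a q v)).
Proof. intros. unfold si. rc. Qed.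
Lemma RC_sl k a : RCi k a -> RCi k (fun q v => sl (a q v)).
Proof. intros. unfold sl. rc. Qed.
#[global] Hint Resolve RC_mk RC_sc RC_su RC_sz RC_sx RC_si RC_sl : rc.

Lemma RC_step k a P : RCi k a -> RCbi k P -> RCi k (fun q v => step (a q v) (P q v)).
Proof. intros. unfold step. rc. Qed.
#[global] Hint Resolve RC_step : rc.

Lemma RC_stateOf k a : RCi k a -> RCi k (fun q v => stateOf (a q v)).
Proof.
  apply (RC_app1 k _ (fun _ => stateOf)). unfold stateOf.
  assert (Hd : forall m b, RCi m b -> RCi m (fun q v => depth (b q v))).
  { intros m b. apply (RC_app1 m _ (fun _ => depth)). unfold depth. rc. }
  apply (RC_prim 1 _ (fun _ _ => mk 0 0 0 0 0 0)
    (fun _ t r v => step r (Nat.even (ancestor (nth 0 v 0) (depth (nth 0 v 0) - S t))))); [rc| |apply Hd; rc].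
  apply RC_step; [rc|]. apply RCb_even, RC_ancestor; [rc|]. apply RC_sub; [|rc]. apply Hd. rc.
Qed.
#[global] Hint Resolve RC_stateOf : rc.

Lemma RCb_listed n k a b c : RCi k a -> RCi k b -> RCi k c ->
  RCbi k (fun q v => listed n q (a q v) (b q v) (c q v)).
Proof.
  intros. unfold listed, check.
  assert (RCi k (fun q v => q (sx (c q v)))) by (apply (RC_oracle k (fun q : baire => q)); rc).
  rc.
Qed.
#[global] Hint Resolve RCb_listed : rc.

Lemma RCS_gameName n : RCS (fun p : baire => p) (gameName n).
Proof. unfold RCS, gameName, turnOf. cbv zeta. rc. Qed.

(** * States along a play *)

Definition stateAt (y : cantor) m := state (prefix y m).

Lemma stateAt_S y m : stateAt y (S m) = step (stateAt y m) (y m).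
Proof. unfold stateAt. now rewrite prefix_S, state_snoc. Qed.

Lemma step_left s b : sl s = 1 -> step s b = s.
Proof. unfold step. now intros ->. Qed.

Lemma step_false s : sl s = 0 -> 2 <= sc s ->
  step s false = mk (sc s) (S (su s)) (sz s) (sx s) (si s) 0.
Proof. unfold step. intros -> H. destruct (Nat.eqb_spec (sc s) 1); [lia|reflexivity]. Qed.

Lemma step_true s : sl s = 0 -> 2 <= sc s ->
  step s true = mk (S (sc s)) 0 (sz s) (pair (sx s) (si s + pfst (su s))) (psnd (su s)) 0.
Proof.
  unfold step. intros -> H. destruct (Nat.eqb_spec (sc s) 0); [lia|].
  destruct (Nat.eqb_spec (sc s) 1); [lia|reflexivity].
Qed.

Lemma step_range s b : (sl s = 0 \/ sl s = 1 /\ sc s = 1) ->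
  (sl (step s b) = 0 \/ sl (step s b) = 1 /\ sc (step s b) = 1) /\
  sc s <= sc (step s b) <= S (sc s).
Proof.
  intros [H|[H1 H2]].
  - unfold step. rewrite H. cbn [Nat.eqb].
    destruct b; [|destruct (Nat.eqb_spec (sc s) 1) as [E|E]; mks; lia].
    destruct (Nat.eqb_spec (sc s) 0) as [E|E]; [mks; lia|].
    destruct (Nat.eqb_spec (sc s) 1) as [E'|E']; mks; lia.
  - rewrite step_left by auto. lia.
Qed.

Lemma stateAt_range y m : sl (stateAt y m) = 0 \/ sl (stateAt y m) = 1 /\ sc (stateAt y m) = 1.
Proof.
  induction m.
  - left. unfold stateAt. simpl. apply mkE.
  - rewrite stateAt_S. now apply step_range.
Qed.

Lemma sc_step y m : sc (stateAt y m) <= sc (stateAt y (S m)) <= S (sc (stateAt y m)).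
Proof. rewrite stateAt_S. apply step_range, stateAt_range. Qed.

Lemma sc_mono y m m' : m <= m' -> sc (stateAt y m) <= sc (stateAt y m').
Proof. induction 1; auto. pose proof (sc_step y m0). lia. Qed.

Lemma sc_reached y m c : c <= sc (stateAt y m) -> exists m', m' <= m /\ sc (stateAt y m') = c.
Proof.
  induction m; intros H.
  - exists 0. assert (E : sc (stateAt y 0) = 0) by apply (proj1 (mkE 0 0 0 0 0 0)). lia.
  - destruct (le_lt_dec c (sc (stateAt y m))) as [Hle|Hlt].
    + destruct (IHm Hle) as (m' & H1 & H2). eauto.
    + exists (S m). pose proof (sc_step y m). split; [auto|lia].
Qed.

Lemma left_persists y m m' : m <= m' -> sl (stateAt y m) = 1 -> stateAt y m' = stateAt y m.
Proof.
  induction 1; auto. intros Hl. rewrite stateAt_S, IHle by auto. now apply step_left.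
Qed.

Lemma not_left y m0 : sl (stateAt y m0) = 0 -> 2 <= sc (stateAt y m0) -> forall m, sl (stateAt y m) = 0.
Proof.
  intros H0 H1 m. destruct (stateAt_range y m) as [H|[H2 H3]]; auto.
  destruct (le_lt_dec m m0) as [Hle|Hlt].
  - apply (left_persists y m m0) in H2; auto. rewrite <- H2. auto.
  - pose proof (sc_mono y m0 m ltac:(lia)). lia.
Qed.

Lemma same_point y m m' : m <= m' -> (forall j, sl (stateAt y j) = 0) -> 2 <= sc (stateAt y m) ->
  sc (stateAt y m') = sc (stateAt y m) ->
  sx (stateAt y m') = sx (stateAt y m) /\ sz (stateAt y m') = sz (stateAt y m).
Proof.
  intros Hle Hl Hc. induction Hle as [|m' Hle IH]; auto. intros He.
  pose proof (sc_mono y m m' Hle). pose proof (sc_step y m').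
  destruct IH as [<- <-]; [lia|]. rewrite stateAt_S in *. destruct (y m').
  - exfalso. rewrite step_true in He by (auto; lia). revert He. mks. lia.
  - rewrite step_false by (auto; lia). mks. auto.
Qed.

Lemma firstn_prefix {A} (y : nat -> A) m M : m <= M -> firstn m (prefix y M) = prefix y m.
Proof.
  intros H. unfold prefix. rewrite firstn_map. f_equal.
  replace M with (m + (M - m)) by lia. rewrite seq_app, firstn_app, length_seq, Nat.sub_diag.
  rewrite firstn_all2 by now rewrite length_seq. simpl. apply app_nil_r.
Qed.

Lemma extends_app y a b : extends y (a ++ b) ->
  forall j, j <= length b -> prefix y (length a + j) = a ++ firstn j b.
Proof.
  unfold extends. rewrite length_app. intros H j Hj.
  rewrite <- (firstn_prefix y _ (length a + length b)) by lia.
  rewrite H, firstn_app. rewrite firstn_all2 by lia. do 2 f_equal. lia.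
Qed.

Lemma extends_app_l y a b : extends y (a ++ b) -> extends y a.
Proof.
  intros H. apply extends_app with (j := 0) in H; [|lia].
  now rewrite Nat.add_0_r, app_nil_r in H.
Qed.

Lemma extends_snoc y a b : extends y (a ++ [b]) -> extends y a /\ y (length a) = b.
Proof.
  intros H. split; [now apply extends_app_l in H|].
  assert (Ha := extends_app_l _ _ _ H). unfold extends in *.
  rewrite length_app in H. simpl in H. rewrite Nat.add_1_r, prefix_S, Ha in H.
  apply app_inj_tail in H. apply H.
Qed.

(** The first component of [m] says how far above the bound [i] the next argument lies; the second
    is the lower bound handed to the opponent. Negation replaces universal quantifiers, which fits
    the exchange of turns. *)
Fixpoint Q (p : baire) (v k : nat) (s : bool) (x i : nat) : Prop :=
  match k with
  | 0 => if s then p x = v else p x <> v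
  | S k => exists m, ~ Q p v k (negb s) (pair x (i + pfst m)) (psnd m)
  end.

Lemma LimIt_S_snoc k p r : LimIt (S k) p r -> exists q, LimIt k p q /\ LimP q r.
Proof.
  revert p. induction k; intros p H; apply LimIt_S in H; destruct H as (q & H1 & H2).
  - exists p. split; [reflexivity|]. simpl in H2. unfold IdP in H2. now subst.
  - destruct (IHk q H2) as (q' & H3 & H4). exists q'. split; auto. apply LimIt_S. eauto.
Qed.

(** That [q (x, j)] equals [v] means that from some stage on no approximation differs from [v]. This
    stage and [j] form one witness, and the rest is the negation of a statement one level lower. *)
Lemma Q_limit k p q v : LimIt k p q -> forall s x i,
  Q p v (S k) s x i <-> exists j, i <= j /\ if s then q (pair x j) = v else q (pair x j) <> v.
Proof.
  revert q. induction k; intros q Hq s x i.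
  - simpl in Hq. unfold IdP in Hq. subst q. simpl. split.
    + intros (m & Hm). exists (i + pfst m). split; [lia|]. destruct s; simpl in *; auto. now apply NNPP.
    + intros (j & Hj & H). exists (pair (j - i) 0). rewrite pfst_pair.
      replace (i + (j - i)) with j by lia. destruct s; simpl; auto.
  - apply LimIt_S_snoc in Hq. destruct Hq as (q' & H1 & H2). specialize (IHk q' H1).
    change (Q p v (S (S k)) s x i) with
      (exists m, ~ Q p v (S k) (negb s) (pair x (i + pfst m)) (psnd m)).
    split.
    + intros (m & Hm). exists (i + pfst m). split; [lia|]. rewrite IHk in Hm.
      destruct (H2 (pair x (i + pfst m))) as [N HN].
      rewrite <- (HN (max N (psnd m))) by lia.
      destruct s; simpl in Hm; [|intros E; apply Hm; exists (max N (psnd m)); split; [lia|auto]].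
      apply NNPP. intros E. apply Hm. exists (max N (psnd m)). split; [lia|auto].
    + intros (j & Hj & H). destruct (H2 (pair x j)) as [N HN].
      exists (pair (j - i) N). rewrite IHk, pfst_pair, psnd_pair.
      replace (i + (j - i)) with j by lia. intros (j' & Hj' & H'). rewrite HN in H' by auto.
      destruct s; simpl in *; contradiction.
Qed.

(** * Who wins a play *)

Section Arena.
Variables (n : nat) (p : baire).
Hypothesis Hn : 1 <= n.

Definition listedSet c beta (x : cantor) := exists m, listed n p c beta (stateAt x m) = true.
Definition wonByFirst x := InD n (listedSet 4) x.
Definition leftPlay x := exists m, sl (stateAt x m) = 1.
Definition payoff x : nat :=
  if excluded_middle_informative (wonByFirst x) then 2
  else if excluded_middle_informative (leftPlay x) then 1 else 0.
Definition wonBy (P : bool) y := if P then wonByFirst y else ~ wonByFirst y /\ ~ leftPlay y.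

Lemma listed_iff beta s : listed n p 4 beta s = true <->
  sl s = 0 /\ sc s = n - beta + 2 /\ (beta = 0 -> check n p s = true).
Proof.
  unfold listed. cbn [Nat.eqb negb andb orb].
  rewrite orb_false_r, !andb_true_iff, !Nat.eqb_eq, orb_true_iff, negb_true_iff, Nat.eqb_neq.
  destruct (Nat.eq_dec beta 0); intuition.
Qed.

Section Word.
Variables (y : cantor) (w : list bool) (c u z x i : nat).
Hypotheses (Hc : 2 <= c) (Hw : state w = mk c u z x i 0) (Hy : extends y w).

Lemma stateAt_word : stateAt y (length w) = mk c u z x i 0.
Proof. unfold stateAt. now rewrite Hy. Qed.

Lemma word_sc : sc (stateAt y (length w)) = c.
Proof. rewrite stateAt_word. apply mkE. Qed.

Lemma word_sl m : sl (stateAt y m) = 0.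
Proof.
  apply (not_left y (length w)); [|now rewrite word_sc]. rewrite stateAt_word. apply mkE.
Qed.

Lemma word_not_left : ~ leftPlay y.
Proof. intros [m Hm]. rewrite word_sl in Hm. discriminate. Qed.

Lemma word_listed beta : 1 <= beta -> n - beta + 2 <= c -> listedSet 4 beta y.
Proof.
  intros H1 H2. destruct (sc_reached y (length w) (n - beta + 2)) as (m & _ & Hm); [now rewrite word_sc|].
  exists m. apply listed_iff. repeat split; auto using word_sl. lia.
Qed.

Lemma word_listed_inv beta : listedSet 4 beta y -> exists m, sc (stateAt y m) = n - beta + 2 /\
  (beta = 0 -> check n p (stateAt y m) = true).
Proof. intros [m Hm]. apply listed_iff in Hm. exists m. tauto. Qed.

(** With [c] ones the least entered index is [n + 2 - c] ([n] if none is entered), so its parity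
    makes the player who is to move, player 1 for even [c], the loser. *)
Lemma wonByFirst_stuck : c < n + 2 -> (forall m, sc (stateAt y m) <= c) ->
  wonByFirst y <-> Nat.odd c = true.
Proof.
  intros Hlt Hm. unfold wonByFirst. rewrite (InD_min n _ (n + 2 - c)); [|lia| |].
  - assert (E : n + 2 = (n + 2 - c) + c) by lia. apply (f_equal Nat.odd) in E.
    rewrite !Nat.odd_add in E. replace (Nat.odd 2) with false in E by reflexivity.
    destruct (Nat.odd n), (Nat.odd c), (Nat.odd (n + 2 - c)); simpl in E; intuition congruence.
  - intros H. apply word_listed; lia.
  - intros g Hg Hl. apply word_listed_inv in Hl. destruct Hl as (m & H1 & _). specialize (Hm m). lia.
Qed.

(** More ones may follow, but [U_0] is tested at exactly [n + 2] ones, where the point no longer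
    changes. The least index is therefore 0 or 1. *)
Lemma wonByFirst_done : c = n + 2 ->
  wonByFirst y <-> (if check n p (stateAt y (length w)) then Nat.odd n else Nat.even n) = true.
Proof.
  intros Hcn. unfold wonByFirst.
  assert (Hch : forall m, sc (stateAt y m) = c -> check n p (stateAt y m) = check n p (stateAt y (length w))).
  { intros m Hm. assert (Hs := word_sc). unfold check.
    destruct (le_lt_dec m (length w)) as [Hle|Hlt].
    - destruct (same_point y m (length w)) as [-> ->]; auto using word_sl; lia.
    - destruct (same_point y (length w) m) as [-> ->]; auto using word_sl; lia. }
  destruct (check n p (stateAt y (length w))) eqn:E.
  - rewrite (InD_min n _ 0); [|lia| |intros; lia].
    + cbn [Nat.odd Nat.even negb]. destruct (Nat.odd n); intuition congruence.
    + intros _. exists (length w). apply listed_iff. repeat split; auto using word_sl.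
      rewrite word_sc. lia.
  - rewrite (InD_min n _ 1); [|lia| |].
    + rewrite <- (Nat.negb_even n). cbn [Nat.odd Nat.even negb]. destruct (Nat.even n); simpl; intuition congruence.
    + intros H. apply word_listed; lia.
    + intros g Hg Hl. apply word_listed_inv in Hl. destruct Hl as (m & H1 & H2).
      specialize (H2 ltac:(lia)). rewrite Hch in H2 by lia. congruence.
Qed.
End Word.

Definition player (P : bool) : nat := if P then 1 else 2.

(** The plays from [w] that player [P] can bring about by deviating from [s]. *)
Definition follows (s : profile) (P : bool) (w : list bool) (y : cantor) :=
  extends y w /\ forall m, length w <= m ->
    turnOf (stateAt y m) <> player P -> y m = s (prefix y m).

Lemma turnOf_mk c u z x i l : 2 <= c -> turnOf (mk c u z x i l) = player (Nat.even c).
Proof.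
  intros Hc. unfold turnOf. rewrite (proj1 (mkE c u z x i l)).
  destruct (Nat.leb_spec 2 c); [|lia]. unfold player. now destruct (Nat.even c).
Qed.

Lemma state_zeros w c z x i j : 2 <= c -> state w = mk c 0 z x i 0 ->
  state (w ++ repeat false j) = mk c j z x i 0.
Proof.
  intros Hc Hw. induction j; [now rewrite app_nil_r|].
  simpl repeat. rewrite repeat_cons, app_assoc, state_snoc, IHj.
  destruct (mkE c j z x i 0) as (E1 & E2 & E3 & E4 & E5 & E6). rewrite step_false by lia.
  now rewrite E1, E2, E3, E4, E5.
Qed.

Lemma state_pick w c z x i j : 2 <= c -> state w = mk c 0 z x i 0 ->
  state (w ++ repeat false j ++ [true]) = mk (S c) 0 z (pair x (i + pfst j)) (psnd j) 0.
Proof.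
  intros Hc Hw. rewrite app_assoc, state_snoc, (state_zeros w c z x i j) by auto.
  destruct (mkE c j z x i 0) as (E1 & E2 & E3 & E4 & E5 & E6). rewrite step_true by lia.
  now rewrite E1, E2, E3, E4, E5.
Qed.

Lemma firstn_pick j m : j <= m -> firstn j (repeat false m ++ [true]) = repeat false j.
Proof.
  revert m. induction j; intros [|m] H; try lia; auto. simpl. f_equal. apply IHj. lia.
Qed.

(** A play is extended backwards by one completed number; [s] must have chosen this number unless it
    belongs to [P]. *)
Lemma follows_pick s P w y c z x i m : 2 <= c -> state w = mk c 0 z x i 0 ->
  follows s P (w ++ repeat false m ++ [true]) y ->
  (Nat.even c <> P -> (forall j, j < m -> s (w ++ repeat false j) = false) /\
     s (w ++ repeat false m) = true) ->
  follows s P w y.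
Proof.
  intros Hc Hw [H1 H2] Hs. split; [now apply extends_app_l in H1|].
  intros m' Hm' Ht. destruct (le_lt_dec (length (w ++ repeat false m ++ [true])) m') as [|Hlt]; auto.
  rewrite !length_app, repeat_length in Hlt. simpl in Hlt.
  set (j := m' - length w). assert (Hj : j <= m) by lia. replace m' with (length w + j) in * by lia.
  assert (Hp : prefix y (length w + j) = w ++ repeat false j).
  { rewrite (extends_app _ _ _ H1), firstn_pick; auto. rewrite length_app, repeat_length. simpl. lia. }
  unfold stateAt in Ht. rewrite Hp, (state_zeros w c z x i j), turnOf_mk in Ht by auto.
  destruct Hs as [S1 S2]; [intros E; apply Ht; now rewrite E|].
  rewrite Hp. assert (Hp' := extends_app _ _ _ H1 (S j)).
  rewrite Nat.add_succ_r, prefix_S, Hp in Hp'.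
  rewrite length_app, repeat_length in Hp'. specialize (Hp' ltac:(simpl; lia)).
  destruct (Nat.eq_dec j m) as [->|Hne].
  - rewrite S2. rewrite firstn_all2 in Hp' by (rewrite length_app, repeat_length; simpl; lia).
    rewrite app_assoc in Hp'. apply app_inj_tail in Hp'. apply Hp'.
  - rewrite S1 by lia. rewrite firstn_pick in Hp' by lia. simpl repeat in Hp'.
    rewrite repeat_cons, app_assoc in Hp'. apply app_inj_tail in Hp'. apply Hp'.
Qed.

(** Against the fixed profile [s] the player favoured by [Q] needs a single winning play. Its own
    numbers are witnesses, and those of the opponent are read off [s]. *)
Lemma reach k : forall c w z x i s, c + k = n + 2 -> 2 <= c -> state w = mk c 0 z x i 0 ->
  let v := psnd (psnd z) in
  (Q p v k (negb (Nat.even c)) x i -> exists y, follows s (Nat.even c) w y /\ wonBy (Nat.even c) y) /\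
  (~ Q p v k (negb (Nat.even c)) x i ->
     exists y, follows s (negb (Nat.even c)) w y /\ wonBy (negb (Nat.even c)) y).
Proof.
  induction k; intros c w z x i s Hck Hc Hw v.
  - assert (Hcn : c = n + 2) by lia.
    set (y := play s w). assert (Hy : extends y w) by apply extends_play.
    assert (Hf : forall P, follows s P w y).
    { intros P. split; auto. intros m Hm _. unfold y at 1. rewrite play_eq.
      destruct (Nat.ltb_spec m (length w)); [lia|reflexivity]. }
    assert (HW := wonByFirst_done y w c 0 z x i Hc Hw Hy Hcn).
    assert (HL := word_not_left y w c 0 z x i Hc Hw Hy).
    rewrite (stateAt_word y w c 0 z x i Hw Hy) in HW.
    assert (Hev : Nat.even c = Nat.even n) by (rewrite Hcn, Nat.even_add; now destruct (Nat.even n)).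
    assert (HQ : check n p (mk c 0 z x i 0) = true <-> ~ Q p v 0 (negb (Nat.even c)) x i).
    { unfold check. destruct (mkE c 0 z x i 0) as (_ & _ & -> & -> & _ & _). fold v.
      rewrite Hev, <- Nat.negb_even. simpl Q.
      destruct (Nat.even n); simpl; destruct (Nat.eqb_spec (p x) v); simpl; intuition congruence. }
    rewrite <- Nat.negb_even in HW. split; intros H.
    + exists y. split; auto.
      destruct (check n p (mk c 0 z x i 0)); [exfalso; now apply HQ|].
      rewrite Hev. destruct (Nat.even n); simpl; [tauto|split; auto]. intros H'. apply HW in H'. discriminate.
    + exists y. split; auto. rewrite (proj2 HQ H) in HW.
      rewrite Hev. destruct (Nat.even n); simpl; simpl in HW; [split; auto|tauto].
      intros H'. apply HW in H'. discriminate.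
  - assert (Hpick : forall m, _) by (intros m;
      refine (IHk (S c) (w ++ repeat false m ++ [true]) z (pair x (i + pfst m)) (psnd m) s _ _ _);
      [lia|lia|now apply state_pick]).
    cbv zeta in Hpick. fold v in Hpick. rewrite Nat.even_succ, <- Nat.negb_even, negb_involutive in Hpick.
    split.
    + intros [m Hm]. rewrite negb_involutive in Hm. destruct (Hpick m) as [_ H].
      destruct (H Hm) as (y & H1 & H2). exists y. split; auto.
      apply (follows_pick s _ w y c z x i m); auto. congruence.
    + intros HQ. simpl in HQ. rewrite negb_involutive in HQ.
      assert (HQ' : forall m, Q p v k (Nat.even c) (pair x (i + pfst m)) (psnd m)).
      { intros m. apply NNPP. intros H. apply HQ. eauto. }
      destruct (classic (exists m, s (w ++ repeat false m) = true)) as [Hex|Hno].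
      * destruct (dec_inh_nat_subset_has_unique_least_element _ (fun m => classic _) Hex) as (m & [M1 M2] & _).
        destruct (Hpick m) as [H _]. destruct (H (HQ' m)) as (y & H1 & H2). exists y. split; auto.
        apply (follows_pick s _ w y c z x i m); auto. intros _. split; auto.
        intros j Hj. apply not_true_iff_false. intros E. apply M2 in E. lia.
      (* Here [s] never completes its number; the play continues with zeros and the player to move
         loses by being stuck. *)
      * set (y := fun m => nth m w false).
        assert (Hp : forall j, prefix y (length w + j) = w ++ repeat false j).
        { intros j. symmetry. replace (length w + j) with (length (w ++ repeat false j))
            by now rewrite length_app, repeat_length.
          apply isPrefix_iff. intros m Hm. unfold y. destruct (le_lt_dec (length w) m) as [Hle|Hlt].
          - rewrite (nth_overflow w) by auto. rewrite app_nth2 by auto. apply nth_repeat.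
          - now rewrite app_nth1. }
        assert (Hy : extends y w) by (unfold extends; rewrite <- (Nat.add_0_r (length w)), Hp; apply app_nil_r).
        exists y. split.
        -- split; auto. intros m Hm _. replace m with (length w + (m - length w)) by lia.
           rewrite Hp. unfold y. rewrite nth_overflow by lia. symmetry. apply not_true_iff_false. eauto.
        -- assert (HL := word_not_left y w c 0 z x i Hc Hw Hy).
           assert (HW := wonByFirst_stuck y w c 0 z x i Hc Hw Hy ltac:(lia)).
           rewrite <- Nat.negb_even in HW. destruct HW as [HW1 HW2].
           { intros m. transitivity (sc (stateAt y (length w + m))); [apply sc_mono; lia|].
             unfold stateAt. rewrite Hp, (state_zeros w c z x i m) by auto. apply Nat.eq_le_incl, mkE. }
           destruct (Nat.even c); simpl in *; [split; auto|auto].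
           intros H. apply HW1 in H. discriminate.
Qed.

Lemma no_sets (U : nat -> cantor -> Prop) x : (forall beta, ~ U beta x) -> ~ InD n U x.
Proof. intros H. rewrite (InD_min n U n); auto. intros Hlt. lia. Qed.

Lemma leftPlay_not_won x : leftPlay x -> ~ wonByFirst x.
Proof.
  intros [m0 Hm0]. apply no_sets. intros beta [m Hm]. apply listed_iff in Hm. destruct Hm as (H1 & H2 & _).
  destruct (stateAt_range x m0) as [E|[_ E]]; [lia|].
  destruct (le_lt_dec m m0) as [Hle|Hlt].
  - pose proof (sc_mono x m m0 Hle). lia.
  - rewrite (left_persists x m0 m) in H1 by (auto; lia). lia.
Qed.

(** A play with [b = 0] meets none of the sets for mask 4, so its least index becomes [n - 1], of
    the parity opposite to [n]. For all other plays nothing changes. *)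
Lemma listed6 x : InD n (listedSet 6) x <-> wonByFirst x \/ leftPlay x.
Proof.
  assert (H6 : forall beta s, listed n p 6 beta s = true <->
    listed n p 4 beta s = true \/ (S beta = n /\ sl s = 1)).
  { intros beta s. unfold listed. cbn [Nat.eqb negb andb orb].
    rewrite orb_false_r, orb_true_iff, (andb_true_iff (S beta =? n)), !Nat.eqb_eq. reflexivity. }
  destruct (classic (leftPlay x)) as [HL|HL].
  - split; [auto|]. intros _. rewrite (InD_min n _ (n - 1)); [|lia| |].
    + replace (Nat.odd n) with (Nat.odd (S (n - 1))) by (f_equal; lia).
      rewrite Nat.odd_succ, <- Nat.negb_odd. destruct (Nat.odd (n - 1)); discriminate.
    + intros _. destruct HL as [m Hm]. exists m. apply H6. right. split; [lia|auto].
    + intros g Hg [m Hm]. apply H6 in Hm. destruct Hm as [Hm|[Hm _]]; [|lia].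
      apply listed_iff in Hm. destruct Hm as (H1 & H2 & _). destruct HL as [m0 Hm0].
      destruct (stateAt_range x m0) as [E|[_ E]]; [lia|].
      destruct (le_lt_dec m m0) as [Hle|Hlt].
      * pose proof (sc_mono x m m0 Hle). lia.
      * rewrite (left_persists x m0 m) in H1 by (auto; lia). lia.
  - assert (HU : forall beta, listedSet 6 beta x <-> listedSet 4 beta x).
    { intros beta. unfold listedSet. split; intros [m Hm]; exists m; apply H6 || apply H6 in Hm; auto.
      destruct Hm as [|[_ Hm]]; auto. exfalso. apply HL. now exists m. }
    unfold wonByFirst. split.
    + intros (b & B1 & B2 & B3 & B4). left. exists b. repeat split; auto.
      * intros Hb. apply HU; auto.
      * intros g Hg. rewrite <- HU. auto.
    + intros [(b & B1 & B2 & B3 & B4)|]; [|contradiction]. exists b. repeat split; auto.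
      * intros Hb. apply HU; auto.
      * intros g Hg. rewrite HU. auto.
Qed.

Lemma payoff_cases x : (wonByFirst x /\ payoff x = 2) \/ (~ wonByFirst x /\ leftPlay x /\ payoff x = 1) \/
  (~ wonByFirst x /\ ~ leftPlay x /\ payoff x = 0).
Proof.
  unfold payoff. destruct (excluded_middle_informative (wonByFirst x)); auto.
  destruct (excluded_middle_informative (leftPlay x)); auto.
Qed.

(** * The name of the game *)

Lemma OpenOf_states (P : nat -> bool) x :
  OpenOf (fun j => if P (stateOf j) then S j else 0) x <-> exists m, P (stateAt x m) = true.
Proof.
  split.
  - intros (j & c & H1 & H2). destruct (P (stateOf j)) eqn:E; [|discriminate]. injection H1 as <-.
    apply isPrefix_iff in H2. exists (length (wordOfNat j)). unfold stateAt.
    now rewrite <- H2, <- stateOf_word.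
  - intros [m Hm]. exists (position x m), (position x m). rewrite stateOf_word, wordOfNat_position.
    fold (stateAt x m). rewrite Hm. split; auto. apply isPrefix_iff. now rewrite length_prefix.
Qed.

Lemma InD_ext m U V x : (forall beta, U beta x <-> V beta x) -> InD m U x <-> InD m V x.
Proof.
  intros H. unfold InD. split; intros (b & B1 & B2 & B3 & B4); exists b; repeat split; auto;
    try (intros; apply H; auto); intros g Hg Hu; apply H in Hu; now apply (B3 g).
Qed.

Definition tag c : nat := if (c =? 7) || (c =? 1) || (c =? 3) then 1 else 0.

Lemma GammaName_gameName i c (S : cantor -> Prop) :
  (GammaName n (fun j => gameName n p (pair (4 + pair i c) j)) S <->
   ((tag c = 0 /\ forall x, S x <-> InD n (listedSet c) x) \/
    (tag c = 1 /\ forall x, S x <-> ~ InD n (listedSet c) x))).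
Proof.
  assert (H0 : gameName n p (pair (4 + pair i c) 0) = tag c).
  { unfold gameName. rewrite pfst_pair, psnd_pair. cbn [Nat.add Nat.eqb Nat.sub].
    now rewrite Nat.sub_0_r, psnd_pair. }
  assert (HU : forall beta x, OpenOf (fun j => gameName n p (pair (4 + pair i c) (1 + pair beta j))) x <->
     listedSet c beta x).
  { intros beta x. unfold listedSet. rewrite <- (OpenOf_states (listed n p c beta)).
    replace (fun j => gameName n p (pair (4 + pair i c) (1 + pair beta j))) with
      (fun j => if listed n p c beta (stateOf j) then Datatypes.S j else 0); [reflexivity|].
    apply functional_extensionality. intros j. unfold gameName. rewrite pfst_pair, psnd_pair.
    cbn [Nat.add Nat.eqb Nat.sub pred]. now rewrite Nat.sub_0_r, !psnd_pair, pfst_pair. }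
  unfold GammaName. cbv zeta. rewrite H0.
  assert (HI : forall x, InD n (fun i0 => OpenOf (fun j => gameName n p (pair (4 + pair i c) (1 + pair i0 j)))) x
    <-> InD n (listedSet c) x) by (intros x; apply InD_ext; intros beta; apply HU).
  split; (intros [[H1 H2]|[H1 H2]]; [left|right]; split; auto; intros x; rewrite H2, HI; reflexivity).
Qed.

Lemma gameName_pref i a b : i = 1 \/ i = 2 ->
  gameName n p (pair (1 + i) (pair a b)) = if (if i =? 1 then a <? b else b <? a) then 1 else 0.
Proof.
  intros [-> | ->]; unfold gameName; now rewrite pfst_pair, psnd_pair, pfst_pair, psnd_pair.
Qed.

Definition arena : game :=
  mkGame 3 (fun w => turnOf (state w)) (fun i a b => if i =? 1 then a <? b else b <? a) payoff.

Lemma arena_wf : game_wf arena.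
Proof.
  repeat split; simpl.
  - intros w. unfold turnOf. destruct (_ && _); auto.
  - intros x. destruct (payoff_cases x) as [[_ ->]|[(_ & _ & ->)|(_ & _ & ->)]]; lia.
  - intros. apply Nat.ltb_irrefl.
  - intros a b c _ _ _. rewrite !Nat.ltb_lt. lia.
  - intros a b _ _. rewrite !Nat.ltb_lt. lia.
Qed.

Lemma arena_name : GameName n (gameName n p) arena.
Proof.
  repeat split.
  - intros N. unfold gameName. rewrite pfst_pair, psnd_pair. simpl. now rewrite stateOf_word.
  - intros i a b Hi _ _. now apply gameName_pref.
  - intros i c Hi Hc Hup. apply GammaName_gameName. simpl g_k in *.
    assert (H04 : forall x, listedSet 3 = listedSet 4 /\ listedSet 1 = listedSet 6 /\
      ~ InD n (listedSet 0) x /\ ~ InD n (listedSet 7) x).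
    { intros x. repeat split; apply no_sets; intros beta [m Hm]; discriminate. }
    assert (H6 := listed6). unfold wonByFirst in H6.
    assert (Hno : forall a b, a < 3 -> b < 3 -> Nat.testbit c a = true -> Nat.testbit c b = false ->
       (if i =? 1 then a <? b else b <? a) = true -> False).
    { intros a b Ha Hb H1 H2 H3. specialize (Hup a b Ha Hb H1 H3). congruence. }
    unfold inMask.
    destruct c as [|[|[|[|[|[|[|[|c]]]]]]]]; [| | | | | | | |simpl in Hc; lia].
    3: { exfalso. destruct Hi as [-> | ->]; [apply (Hno 1 2)|apply (Hno 1 0)]; auto; lia. }
    (* The goals have been renumbered after the removal of mask 2, so the fifth one is mask 5. *)
    5: { exfalso. destruct Hi as [-> | ->]; [apply (Hno 0 1)|apply (Hno 2 1)]; auto; lia. }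
    all: (left; split; [reflexivity|]) || (right; split; [reflexivity|]).
    all: intros x; destruct (H04 x) as (E3 & E1 & E0 & E7); rewrite ?E3, ?E1, ?H6.
    all: destruct (payoff_cases x) as [[A1 A2]|[(A1 & A3 & A2)|(A1 & A3 & A2)]];
      unfold wonByFirst in *; simpl g_val; rewrite A2; cbn; intuition (try discriminate; try lia).
Qed.

(** * What an equilibrium decides *)

Section Equilibrium.
Variables (G : game) (s : profile).
Hypotheses (Hwf : game_wf G) (HG : GameName n (gameName n p) G) (Hs : IsSPE G s).

Lemma G_k : g_k G = 3.
Proof. destruct HG as [H _]. rewrite <- H. unfold gameName. now rewrite pfst_pair. Qed.

Lemma G_turn w : g_turn G w = turnOf (state w).
Proof.
  destruct HG as (_ & H & _). rewrite <- (wordOfNat_wcode w) at 1. rewrite <- H.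
  unfold gameName. rewrite pfst_pair, psnd_pair. simpl. now rewrite stateOf_word, wordOfNat_wcode.
Qed.

Lemma G_pref i a b : i = 1 \/ i = 2 -> a < 3 -> b < 3 ->
  g_pref G i a b = if i =? 1 then a <? b else b <? a.
Proof.
  intros Hi Ha Hb. destruct HG as (_ & _ & H & _). specialize (H i a b Hi). rewrite G_k in H.
  specialize (H Ha Hb). rewrite gameName_pref in H by auto.
  destruct (g_pref G i a b), (if i =? 1 then a <? b else b <? a); congruence.
Qed.

Lemma G_mask c : c = 4 \/ c = 6 ->
  forall x, inMask 3 c (g_val G x) <-> InD n (listedSet c) x.
Proof.
  intros Hc x. destruct HG as (_ & _ & _ & H). specialize (H 1 c (or_introl eq_refl)). rewrite G_k in H.
  assert (Hu : upperMask G 1 c).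
  { intros a b. rewrite G_k. intros Ha Hb H1 H2. rewrite G_pref in H2 by auto. simpl in H2.
    apply Nat.ltb_lt in H2. destruct Hc as [-> | ->];
      destruct a as [|[|[|a]]]; try discriminate; try lia; destruct b as [|[|[|b]]]; try reflexivity; lia. }
  specialize (H ltac:(destruct Hc; subst; simpl; lia) Hu). apply GammaName_gameName in H.
  destruct H as [[_ H]|[H _]]; auto. destruct Hc; subst; discriminate.
Qed.

(** A solution of [SPEP] belongs to some game with the given name, not necessarily to [arena]. The
    masks 4 and 6 separate the three outcomes and so determine its valuation. *)
Lemma G_val x : g_val G x = payoff x.
Proof.
  assert (H4 := G_mask 4 (or_introl eq_refl) x). assert (H6 := G_mask 6 (or_intror eq_refl) x).
  rewrite listed6 in H6. fold (wonByFirst x) in H4. unfold inMask in *.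
  assert (Hlt : g_val G x < 3) by (rewrite <- G_k; apply Hwf).
  destruct (payoff_cases x) as [[A1 ->]|[(A1 & A3 & ->)|(A1 & A3 & ->)]];
    destruct (g_val G x) as [|[|[|v]]]; auto; try lia; cbn in H4, H6; intuition discriminate.
Qed.

Lemma payoff_lt x : payoff x < 3.
Proof. destruct (payoff_cases x) as [[_ ->]|[(_ & _ & ->)|(_ & _ & ->)]]; lia. Qed.

Lemma no_improvement P lam y : follows s P lam y ->
  (if P then payoff (play s lam) <? payoff y else payoff y <? payoff (play s lam)) = false.
Proof.
  intros [H1 H2]. assert (H := proj1 (NashAt_iff G s lam) (Hs lam) (player P) y).
  rewrite !G_val, G_pref in H; try apply payoff_lt; [|destruct P; auto].
  destruct P; apply H; auto; intros m Hm; rewrite G_turn; apply H2; auto.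
Qed.

Definition node z := repeat false z ++ [true].

Lemma state_node z : state (node z) = mk 1 0 z (pfst z) (pfst (psnd z)) 0.
Proof.
  assert (H : state (repeat false z) = mk 0 z 0 0 0 0).
  { induction z; [reflexivity|]. simpl repeat. rewrite repeat_cons, state_snoc, IHz.
    unfold step. destruct (mkE 0 z 0 0 0 0) as (-> & -> & -> & -> & -> & ->). reflexivity. }
  unfold node. rewrite state_snoc, H. unfold step.
  destruct (mkE 0 z 0 0 0 0) as (-> & -> & -> & -> & -> & ->). reflexivity.
Qed.

Lemma state_enter z : state (node z ++ [true]) = mk 2 0 z (pfst z) (pfst (psnd z)) 0.
Proof.
  rewrite state_snoc, state_node. unfold step.
  destruct (mkE 1 0 z (pfst z) (pfst (psnd z)) 0) as (-> & -> & -> & -> & -> & ->). reflexivity.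
Qed.

Lemma leftPlay_node z y : extends y (node z ++ [false]) -> leftPlay y.
Proof.
  intros H. exists (length (node z ++ [false])). unfold stateAt. rewrite H, state_snoc, state_node.
  unfold step. destruct (mkE 1 0 z (pfst z) (pfst (psnd z)) 0) as (-> & -> & -> & -> & -> & ->). apply mkE.
Qed.

Lemma follows_snoc P w b y : follows s P (w ++ [b]) y -> (turnOf (state w) <> player P -> s w = b) ->
  follows s P w y.
Proof.
  intros [H1 H2] H3. destruct (extends_snoc _ _ _ H1) as [H4 H5]. split; auto.
  intros m Hm Ht. destruct (Nat.eq_dec m (length w)) as [->|Hne].
  - rewrite H4, H5. unfold stateAt in Ht. rewrite H4 in Ht. symmetry. auto.
  - apply H2; auto. rewrite length_app. simpl. lia.
Qed.

Lemma follows_play P w : follows s P w (play s w).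
Proof.
  split; [apply extends_play|]. intros m Hm _. rewrite play_eq.
  destruct (Nat.ltb_spec m (length w)); [lia|reflexivity].
Qed.

Lemma play_snoc w : play s (w ++ [s w]) = play s w.
Proof.
  assert (Hw := extends_play s w). apply play_unique.
  - unfold extends. rewrite length_app, Nat.add_1_r, prefix_S, Hw. do 2 f_equal.
    rewrite play_eq, Hw. destruct (Nat.ltb_spec (length w) (length w)); [lia|reflexivity].
  - intros m Hm. rewrite length_app in Hm. rewrite play_eq.
    destruct (Nat.ltb_spec m (length w)); [lia|reflexivity].
Qed.

Lemma play_snoc_eq w b : s w = b -> play s w = play s (w ++ [b]).
Proof. intros <-. symmetry. apply play_snoc. Qed.

(** Leaving yields 1. If [Q] holds, player 1 can deviate after entering so as to get 2, so leaving
    is not optimal; if it fails, player 2 can hold player 1 to 0 after entering, so entering is not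
    optimal. *)
Lemma node_decides z : let v := psnd (psnd z) in
  s (node z) = true <-> Q p v n false (pfst z) (pfst (psnd z)).
Proof.
  intros v.
  destruct (reach n 2 (node z ++ [true]) z (pfst z) (pfst (psnd z)) s) as [R1 R2];
    [lia|auto|apply state_enter|]. cbn [Nat.even negb] in R1, R2. fold v in R1, R2.
  assert (Ht : turnOf (state (node z)) = player true).
  { rewrite state_node. unfold turnOf. now destruct (mkE 1 0 z (pfst z) (pfst (psnd z)) 0) as (-> & _). }
  split.
  - intros E. apply NNPP. intros HQ. destruct (R2 HQ) as (y & H1 & H2 & H3).
    apply no_improvement in H1. cbn beta iota in H1. rewrite <- (play_snoc_eq _ _ E) in H1.
    assert (Hl : follows s true (node z) (play s (node z ++ [false]))).
    { apply follows_snoc with false; [apply follows_play|contradiction]. }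
    apply no_improvement in Hl. cbn beta iota in Hl.
    assert (HL := leftPlay_node z _ (extends_play s (node z ++ [false]))).
    apply Nat.ltb_ge in H1, Hl.
    destruct (payoff_cases y) as [[]|[(_ & ? & _)|(_ & _ & Hy)]]; try contradiction.
    destruct (payoff_cases (play s (node z ++ [false]))) as [[_ Hy']|[(_ & _ & Hy')|(_ & ? & _)]]; try contradiction; lia.
  - intros HQ. destruct (R1 HQ) as (y & H1 & H2).
    destruct (s (node z)) eqn:E; auto. exfalso.
    assert (Hf : follows s true (node z) y).
    { apply follows_snoc with true; [exact H1|contradiction]. }
    apply no_improvement in Hf. cbn beta iota in Hf. apply Nat.ltb_ge in Hf.
    rewrite (play_snoc_eq _ _ E) in Hf.
    assert (HL := leftPlay_node z _ (extends_play s (node z ++ [false]))).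
    assert (HnW := leftPlay_not_won _ HL). simpl in H2.
    destruct (payoff_cases y) as [[_ Hy]|[(? & _)|(? & _)]]; try contradiction.
    destruct (payoff_cases (play s (node z ++ [false]))) as [[? _]|[(_ & _ & Hy')|(_ & ? & _)]]; try contradiction; lia.
Qed.
End Equilibrium.
End Arena.

(** * Reading off the limit *)

Definition nodeCode z := ch (nat_rect (fun _ => nat) 0 (fun _ r => ch r false) z) true.

Lemma nodeCode_node z : nodeCode z = wcode (node z).
Proof.
  unfold nodeCode, node. rewrite wcode_snoc. f_equal. induction z; [reflexivity|].
  simpl repeat. rewrite repeat_cons, wcode_snoc. simpl. now rewrite IHz.
Qed.

Definition decode (q : baire) (m : nat) : nat :=
  psnd (least (fun y => q (nodeCode (pair m y)) = 0)).

(** The bit at the node of [(m, (i, v))] is 0 iff the last but one limit has the value [v] at all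
    [(m, j)] with [j >= i]. A point of convergence together with [t m] is such a pair, so the search
    ends. *)
Lemma decode_spec n p t q : 1 <= n -> LimIt n p t -> SPEP n (gameName n p) q ->
  (forall m, exists y, q (nodeCode (pair m y)) = 0) /\ decode q = t.
Proof.
  intros Hn Ht (G & Hwf & HG & s & Hq & Hs). destruct n as [|n]; [lia|].
  apply LimIt_S_snoc in Ht. destruct Ht as (r & H1 & H2).
  assert (Hbit : forall m y, q (nodeCode (pair m y)) = 0 <->
    forall j, pfst y <= j -> r (pair m j) = psnd y).
  { intros m y. rewrite Hq, nodeCode_node, wordOfNat_wcode.
    assert (HD := node_decides (S n) p Hn G s Hwf HG Hs (pair m y)). cbv zeta in HD.
    rewrite (Q_limit n p r _ H1), psnd_pair, pfst_pair in HD.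
    destruct (s (node (pair m y))); split; try discriminate; try reflexivity.
    - intros H. destruct (proj1 HD eq_refl) as (j & Hj & Hne). exfalso. apply Hne. auto.
    - intros _ j Hj. apply NNPP. intros Hne. enough (false = true) by discriminate. apply HD. eauto. }
  assert (Hex : forall m, exists y, q (nodeCode (pair m y)) = 0).
  { intros m. destruct (H2 m) as [N HN]. exists (pair N (t m)). apply Hbit.
    rewrite pfst_pair, psnd_pair. exact HN. }
  split; auto. apply functional_extensionality. intros m. unfold decode.
  destruct (least_spec _ (Hex m)) as [HL _]. set (y := least _) in *.
  rewrite Hbit in HL. destruct (H2 m) as [N HN]. rewrite <- (HL (max N (pfst y))) by lia. apply HN. lia.
Qed.

Lemma LimIt_WRed_SPEP n : 1 <= n -> WRed (LimIt n) (SPEP n).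
Proof.
  intros Hn. apply (WRed_intro (LimIt n) (SPEP n)
    (fun x => gameName n (proj1_sig x)) (fun xs => decode (snd xs))).
  - exact (RCS_map (fun x : {p | pdom (LimIt n) p} => proj1_sig x) _ _ (RCS_gameName n)).
  (* The strategy from the upper bound also shows that the constructed game has an equilibrium, as
     membership in the domain requires. *)
  - intros x. eexists. apply (SPEP_strategy n _ (arena n (proj1_sig x))); auto using arena_wf, arena_name.
  - eapply RCS_trans; [eapply RCS_snd, RCS_refl|]. unfold RCS, decode. apply RC_psnd.
    set (o := fun y : {y : {p | pdom (LimIt n) p} * baire | SPEP n (gameName n (proj1_sig (fst y))) (snd y)} =>
      snd (proj1_sig y)).
    apply RC_mu with (F := fun y e => o y (nodeCode (pair (nth 1 e 0) (nth 0 e 0)))).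
    + apply RC_oracle. unfold nodeCode. apply RC_ch; [|rc].
      apply (RC_prim 2 o (fun _ _ => 0) (fun _ _ r _ => ch r false)); rc.
    + intros [[[p Hp] q] Hq] [|m [|]] He; try discriminate. simpl in Hq. unfold o. cbn [nth snd proj1_sig].
      destruct Hp as [t Ht] eqn:Ep. clear Ep.
      destruct (decode_spec n p t q Hn Ht Hq) as [Hex _]. destruct (least_spec _ (Hex m)) as [L1 L2].
      split; auto. intros m' Hm' E. apply L2 in E. lia.
  - intros [p Hp] q Hq. cbn [snd proj1_sig] in *. destruct Hp as [t Ht].
    now rewrite (proj2 (decode_spec n p t q Hn Ht Hq)).
Qed.

Theorem theorem31 :
  forall (n : nat), 1 <= n ->
  forall L : nat -> problem, IsLimIter L ->
  WEquiv (SPEP n) (L n).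
Proof.
  intros n Hn L HL. apply WEquiv_trans with (LimIt n).
  - split; [now apply SPEP_WRed_LimIt|now apply LimIt_WRed_SPEP].
  - now apply WEquiv_sym, IsLimIter_LimIt.
Qed.
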